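(* Let $X$ be a real separable Banach space, and assume: (1) $Q:X^*\to X$ is linear, bounded, symmetric ($\langle Qx^*,y^*\rangle=\langle Qy^*,x^*\rangle$) and nonnegative ($\langle Qx^*,x^*\rangle\ge 0$), and $A:D(A)\subseteq X\to X$ generates a strongly continuous contraction semigroup $(e^{tA})_{t\ge0}$ on $X$; (2) for every $t>0$ the operator $Q_t:=\int_0^t e^{sA}Qe^{sA^*}\,ds$ is the covariance operator of a centred Gaussian measure on $X$; for every $x^*\in X^*$ the weak limit $Q_\infty x^*:=\lim_{t\to+\infty}Q_tx^*$ exists, and $Q_\infty$ is the covariance operator of a centred nondegenerate Gaussian measure $\mu_\infty$ on $X$; (3) for every $x^*\in D(A^* )$ one has $Q_\infty A^*x^*\in H$, and there is $c>0$ with $|Q_\infty A^*x^*|_H\le c\,|i^*x^*|_H$ for all $x^*\in D(A^* )$; (4) $U$ is a proper, $\|\cdot\|_X$-lower semicontinuous convex function on $X$ belonging to $W^{1,p}_H(X,\mu_\infty)$ for every $p\in[1,+\infty)$; set $\nu_\infty:=e^{-U}\mu_\infty$. Then for every $p\in(1,+\infty)$ the operator $D_H:\mathscr{FC}_b^1(X)\to L^p(X,\nu_\infty;H)$ is closable in $L^p(X,\nu_\infty)$. Denoting its closure still by $D_H$ and the domain of the closure by $W^{1,p}_H(X,\nu_\infty)$, for every $p\in(1,+\infty)$ the space $W^{1,p}_H(X,\nu_\infty)$ endowed with the norm $$\|f\|_{1,p,H}:=\|f\|_{L^p(X,\nu_\infty)}+\|D_Hf\|_{L^p(X,\nu_\infty;H)}$$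 is a Banach space, and for $p=2$ it is a Hilbert space with inner product $$\langle f,g\rangle_{W^{1,2}_H(X,\nu_\infty)}:=\int_Xfg\,d\nu_\infty+\int_X[D_Hf,D_Hg]_H\,d\nu_\infty .$$
   Context: $H$ is the Reproducing Kernel Hilbert Space of $Q$: the completion of $QX^*$ under $[Qx^*,Qy^*]_H:=\langle Qx^*,y^*\rangle_{X\times X^*}$, continuously embedded in $X$ by $i:H\to X$; $i^*:X^*\to H$ is the adjoint (with $H^*\cong H$), and $Q=i\circ i^*$. $\mathscr{FC}_b^{1}(X)$ is the set of functions $f(x)=\varphi(\langle x,x_1^*\rangle,\dots,\langle x,x_n^*\rangle)$ with $n\in\mathbb N$, $\varphi\in C_b^1(\mathbb R^n)$ (bounded, with bounded continuous first derivatives), $x_j^*\in X^*$. For such $f$, $D_Hf(x):=i^*Df(x)=\sum_{j}\frac{\partial\varphi}{\partial\xi_j}(\langle x,x_1^*\rangle,\dots,\langle x,x_n^*\rangle)\,i^*x_j^*$. Under (1)–(3), $D_H$ is known to be closable in $L^p(X,\mu_\infty)$; $W^{1,p}_H(X,\mu_\infty)$ is the domain of the closure in $L^p(X,\mu_\infty)$. Under (1)–(4), it is known that $e^{-U}\in W^{1,p}_H(X,\mu_\infty)$ for all $p\in[1,+\infty)$, so $\nu_\infty$ is a finite measure. *)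

(* Defs.v *)
From HB Require Import structures.
From mathcomp Require Import all_boot all_order all_algebra.
From mathcomp Require Import all_classical all_reals all_analysis.

Set Implicit Arguments.
Unset Strict Implicit.
Unset Printing Implicit Defensive.

Import Order.TTheory GRing.Theory Num.Theory.
Import numFieldNormedType.Exports.

Local Open Scope classical_set_scope.
Local Open Scope ring_scope.

HB.mixin Record CompleteNormedModule_isHilbert (R : realType) H
    & CompleteNormedModule R H := {
  inner : H -> H -> R;
  innerC : forall x y, inner x y = inner y x;
  innerDl : forall x y z, inner (x + y) z = inner x z + inner y z;
  innerZl : forall a x y, inner (a *: x) y = a * inner x y;
  inner_norm : forall x, inner x x = `|x| ^+ 2
}.

#[short(type="hilbertType")]
HB.structure Definition Hilbert (R : realType) :=
  {H of CompleteNormedModule_isHilbert R H & CompleteNormedModule R H}.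

(* Continuous linear maps, as a linear subspace of V -> W. *)
Section continuous_linear_maps.
Context {R : realType} {V W : normedModType R}.

Definition clin_pred : {pred V -> W} := mem [set f | linear f /\ continuous f].

Record clin := CLin { clin_fun :> V -> W; _ : clin_fun \in clin_pred }.

HB.instance Definition _ := [isSub for clin_fun].
HB.instance Definition _ := [Choice of clin by <:].

Lemma clin_pred_submod : submod_closed clin_pred.
Proof.
split.
  apply/mem_set; split; first by move=> a x y; rewrite scaler0 addr0.
  by move=> x; exact: cvg_cst.
move=> a f g /set_mem[lf cf] /set_mem[lg cg]; apply/mem_set; split.
  move=> b x y.
  have -> z : (a *: f + g) z = a *: f z + g z by [].
  rewrite !lf !lg !scalerDr !scalerA (mulrC a b) -!addrA; congr (_ + _).
  by rewrite addrCA.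
by move=> x; apply: cvgD (cg x); apply: cvgZl_tmp; exact: cf.
Qed.

HB.instance Definition _ :=
  GRing.isSubmodClosed.Build R (V -> W) clin_pred clin_pred_submod.
HB.instance Definition _ := [SubChoice_isSubLmodule of clin by <:].

Lemma clin_linear (f : clin) : linear f.
Proof. by have /set_mem[] := valP f. Qed.

Lemma clin_continuous (f : clin) : continuous f.
Proof. by have /set_mem[] := valP f. Qed.

HB.instance Definition _ (f : clin) :=
  GRing.isLinear.Build R V W _ f (clin_linear f).

End continuous_linear_maps.
Arguments clin {R} V W.

Lemma clin_comp_subproof (R : realType) (U V W : normedModType R)
    (g : clin V W) (f : clin U V) : g \o f \in @clin_pred R U W.
Proof.
apply/mem_set; split; first by move=> a x y /=; rewrite !linearP.
by move=> x; apply: continuous_comp; exact: clin_continuous.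
Qed.

Definition clin_comp (R : realType) (U V W : normedModType R)
    (g : clin V W) (f : clin U V) : clin U W := CLin (clin_comp_subproof g f).

Section banach.
Context {R : realType}.

Definition cdual (X : normedModType R) := clin X R^o.

Definition dual_norm (X : normedModType R) (f : cdual X) : R :=
  sup [set `|f x : R| | x in [set x : X | `|x| <= 1]].

Definition dual_map (X Y : normedModType R) (T : clin X Y) (f : cdual Y) :
  cdual X := clin_comp f T.

Definition borel (X : completeNormedModType R) :=
  g_sigma_algebraType (@open X).

Definition separable_space (X : topologicalType) :=
  exists D : set X, countable D /\ dense D.

(* Stated for t >= 0 only: the values T t for t < 0 are junk. *)
Definition contraction_semigroup (X : completeNormedModType R)
    (T : R -> clin X X) :=
  [/\ forall x, T 0 x = x,
      forall s t x, 0 <= s -> 0 <= t -> T (s + t) x = T s (T t x),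
      forall t x, 0 <= t -> `|T t x| <= `|x| &
      forall x, T t x @[t --> 0^'+] --> x].

(* The unbounded operator A has domain DA; its values outside DA are junk. *)
Definition generates (X : completeNormedModType R) (DA : set X) (A : X -> X)
    (T : R -> clin X X) :=
  forall x y, (DA x /\ A x = y) <->
    h^-1 *: (T h x - x) @[h --> 0^'+] --> y.

(* f belongs to the domain of the adjoint of (DA, A), which maps f to g. *)
Definition adjoint_at (X : completeNormedModType R) (DA : set X) (A : X -> X)
    (f g : cdual X) :=
  forall x, DA x -> f (A x) = g x.

(* z is the integral of v over [a, b] in the weak (Pettis) sense. *)
Definition is_integral (X : completeNormedModType R) (a b : R) (v : R -> X)
    (z : X) :=
  forall g : cdual X,
    lebesgue_measure.-integrable `[a, b] (fun s => (g (v s) : R)%:E) /\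
    (\int[lebesgue_measure]_(s in `[a, b]) (g (v s) : R)%:E)%E
      = (g z : R)%:E.

(* H is the completion of the range of Q under [Q f, Q g] = g (Q f): istar f is
   the element Q f of the completion, and i extends the inclusion into X. *)
Record is_rkhs (X : completeNormedModType R) (Q : cdual X -> X)
    (H : hilbertType R) (i : clin H X) (istar : cdual X -> H) : Prop := IsRkhs {
  rkhs_inner : forall f g : cdual X, inner (istar f) (istar g) = g (Q f);
  rkhs_dense : dense (range istar);
  rkhs_inj : injective i;
  rkhs_factor : forall f, Q f = i (istar f);
  rkhs_adjoint : forall (f : cdual X) h, inner (istar f) h = f (i h)
}.

End banach.

Section gaussian.
Context {R : realType} {X : completeNormedModType R}.
Implicit Types (m : probability (borel X) R) (f g : cdual X).

(* The law of f under m is N(0, s^2), the Dirac mass at 0 when s = 0. *)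
Definition centred_normal_law m f (s : R) :=
  forall B : set (measurableTypeR R), measurable B ->
    m [set x | B (f x)] = if s == 0 then \d_(0 : R) B else normal_prob 0 s B.

Definition centred_gaussian m := forall f, exists s, centred_normal_law m f s.

Definition nondegenerate_gaussian m :=
  forall f, f != 0 -> exists2 s, s != 0 & centred_normal_law m f s.

Definition covariance_operator m (C : cdual X -> X) :=
  forall f g,
    m.-integrable setT (fun x => ((f x : R) * (g x : R))%:E) /\
    (\int[m]_x ((f x : R) * (g x : R))%:E)%E = (g (C f) : R)%:E.

End gaussian.

Section convex_functions.
Context {R : realType} {X : completeNormedModType R}.
Implicit Types U : X -> \bar R.

Definition proper_fun U :=
  (forall x, U x != -oo%E) /\ (exists x, U x != +oo%E).

Definition convex_fun U := forall (x y : X) (t : R), 0 <= t <= 1 ->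
  (U (t *: x + (1 - t) *: y)%R <= t%:E * U x + (1 - t)%:E * U y)%E.

End convex_functions.

Section sobolev.
Context {R : realType} {X : completeNormedModType R} {H : hilbertType R}.
Variable istar : cdual X -> H.
Implicit Types (m : {measure set (borel X) -> \bar R}) (p : R).
Implicit Types (f g : X -> R) (F G : X -> H).

Definition partial n (phi : 'rV[R]_n -> R) (j : 'I_n) (v : 'rV[R]_n) : R :=
  'D_(delta_mx 0 j) phi v.

Definition Cb1 n (phi : 'rV[R]_n -> R) :=
  [/\ continuous phi, bounded_fun phi &
      forall j : 'I_n,
        [/\ forall v, derivable phi v (delta_mx 0 j),
            continuous (partial phi j) & bounded_fun (partial phi j)]].

Definition coords n (xs : 'I_n -> cdual X) (x : X) : 'rV[R]_n :=
  \row_j (xs j x : R).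

(* The graph of D_H on the cylindrical functions: f is in FC_b^1(X) and
   D_H f = F. *)
Definition DH f F :=
  exists (n : nat) (phi : 'rV[R]_n -> R) (xs : 'I_n -> cdual X),
    [/\ Cb1 phi,
        f = (fun x => phi (coords xs x)) &
        F = (fun x => \sum_(j < n)
               partial phi j (coords xs x) *: istar (xs j))].

Definition LpH m p F :=
  measurable_fun setT (F : borel X -> borel H) /\
  (fun x : borel X => `|F x|) \in Lfun m p%:E.

Definition Lp_cvg m p (f_ : nat -> X -> R) f :=
  Lnorm m p%:E (fun x => (f_ k x - f x)%:E) @[k --> \oo] --> 0%E.

Definition LpH_cvg m p (F_ : nat -> X -> H) F :=
  Lnorm m p%:E (fun x => `|F_ k x - F x|%:E) @[k --> \oo] --> 0%E.

(* The closure of the graph of D_H in L^p(X, m) x L^p(X, m; H), on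
   representatives. *)
Definition DH_closure m p f F :=
  [/\ (f : borel X -> R) \in Lfun m p%:E, LpH m p F &
      exists (f_ : nat -> X -> R) (F_ : nat -> X -> H),
        [/\ forall k, DH (f_ k) (F_ k), Lp_cvg m p f_ f & LpH_cvg m p F_ F]].

(* Applied to differences, closability also says that D_H is well defined on
   classes modulo m-almost everywhere equality. *)
Definition DH_closable m p :=
  forall F, DH_closure m p (fun=> 0) F ->
    {ae m, forall x : borel X, F x = 0}.

Definition W1p m p : set (X -> R) := [set f | exists F, DH_closure m p f F].

(* W is a linear space of functions, and cls identifies its quotient by
   m-almost everywhere equality with the vector space B. *)
Definition ae_quotient m (W : set (X -> R)) (B : lmodType R)
    (cls : (X -> R) -> B) :=
  [/\ W (fun=> 0),
      forall (a : R) f g, W f -> W g -> W (fun x => a * f x + g x) /\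
        cls (fun x => a * f x + g x) = a *: cls f + cls g,
      forall f g, W f -> W g ->
        (cls f = cls g <-> {ae m, forall x : borel X, f x = g x}) &
      forall b, exists2 f, W f & cls f = b].

Definition W1p_is_banach m p :=
  exists (B : completeNormedModType R) (cls : (X -> R) -> B),
    ae_quotient m (W1p m p) cls /\
    forall f F, DH_closure m p f F ->
      (`|cls f|%:E =
        Lnorm m p%:E (fun x => (f x)%:E) + Lnorm m p%:E (fun x => `|F x|%:E))%E.

Definition W12_is_hilbert m :=
  exists (B : hilbertType R) (cls : (X -> R) -> B),
    ae_quotient m (W1p m 2) cls /\
    forall f g F G, DH_closure m 2 f F -> DH_closure m 2 g G ->
      inner (cls f) (cls g) =
        \int[m]_x (f x * g x) + \int[m]_x inner (F x) (G x).

End sobolev.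

(* Main.v *)
From HB Require Import structures.
Require Import Defs.
From mathcomp Require Import all_boot all_order all_algebra.
From mathcomp Require Import all_classical all_reals all_analysis.
From mathcomp Require Import measurable_realfun ring lra.

(* If i h = Q_oo g, then integration by parts for mu_oo reads
     int [D_H f, h] dmu = int f g dmu
   on cylindrical functions; it is explicit for trigonometric polynomials, and
   these approximate the others through Bernstein polynomials of sines.
   By the Lyapunov equation 2 <Q_oo A^* f, f> = - |i^* f|^2 and (3), such h are
   dense in H.
   The density e^(-U) is not regular enough to enter this formula, but
   eta(U) = 1 / (1 + e^U) is: it is bounded and Lipschitz in U, which lies in
   W^{1,q}(mu), and eta(U) <= e^(-U/p), so that convergence in L^p(nu)
   becomes convergence in L^1(mu) after multiplication by eta(U).
   If f_k -> 0 and D_H f_k -> F, this shows that [F, h] eta(U) is orthogonal to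
   the cylindrical functions, which are dense enough to contain it in their
   closure; hence [F, h] = 0 for a countable dense set of h.
   The measure nu is finite, because a convex lower semicontinuous function has
   an affine minorant, whose exponential is integrable by Gaussianity. *)

Set Implicit Arguments.
Unset Strict Implicit.
Unset Printing Implicit Defensive.

Import Order.TTheory GRing.Theory Num.Theory.
Import numFieldNormedType.Exports.

Local Open Scope classical_set_scope.
Local Open Scope ring_scope.

(** * Cylindrical functions *)

(** Multiplying by e^(-U) would bring in the term f e^(-U) [D_H U, h], and s -> e^(-s) is neither
    bounded nor Lipschitz on the line. The derivative of eta is - eta (1 - eta), so the term
    produced by D_H U carries the factor eta(U) again. It is thus the product of f e^(-U/p), which
    is in L^p(mu) exactly when f is in L^p(nu), with a function of L^q(mu), where 1/p + 1/q = 1: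
    hence U is taken in W^{1,q} for the conjugate exponent, which is finite because p > 1. No
    general density theorem for cylindrical functions in L^1(mu) enters. The function [F, h] eta(U)
    is the L^1(mu) limit of difference quotients of f_k times eta(u_n), u_n being cylindrical
    approximations of U, and a bounded odd function built from eta turns these approximants into
    test functions. The translation identity for trigonometric polynomials involves no derivative of
    the function, so it passes to uniform limits; derivatives reappear only at the end, as limits of
    difference quotients. *)

Lemma cvg_rV (K : numFieldType) (T : Type) (F : set_system T) (FF : Filter F) n
    (f : T -> 'rV[K]_n) (y : 'rV[K]_n) :
  (forall j, f t 0 j @[t --> F] --> y 0 j) -> f @ F --> y.
Proof.
move=> H A [P MP sPA].
have : \forall t \near F, forall j, P 0 j (f t 0 j).
  by apply: filter_forall => j; exact: (H j _ (MP 0 j)).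
by apply: filterS => t Ht; apply: sPA => i j; rewrite (ord1 i).
Qed.

Section continuous_operations.
Context {K : numFieldType} {T : topologicalType} {V : normedModType K}.

Lemma continuous_fD (f g : T -> V) : continuous f -> continuous g ->
  continuous (fun x => f x + g x).
Proof. by move=> cf cg x; apply: cvgD; [exact: cf|exact: cg]. Qed.

Lemma continuous_fM (f g : T -> K) : continuous f -> continuous g ->
  continuous (fun x => f x * g x).
Proof. by move=> cf cg x; apply: cvgM; [exact: cf|exact: cg]. Qed.

Lemma continuous_fcst (v : V) : continuous (fun _ : T => v).
Proof. by move=> x; exact: cvg_cst. Qed.

Lemma continuous_fcomp (T' U : topologicalType) (f : T' -> T) (g : T -> U) :
  continuous f -> continuous g -> continuous (fun x => g (f x)).
Proof. by move=> cf cg x; apply: continuous_comp; [exact: cf|exact: cg]. Qed.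

Lemma continuous_rV n (f : T -> 'rV[K]_n) :
  (forall j, continuous (fun t => f t 0 j)) -> continuous f.
Proof. by move=> H x; apply: cvg_rV => j; exact: H. Qed.

End continuous_operations.

Lemma cvg_fun_sum (K : numFieldType) (W : normedModType K) (T : Type)
    (F : set_system T) (FF : Filter F) n (f : 'I_n -> T -> W) (y : 'I_n -> W) :
  (forall j, f j t @[t --> F] --> y j) ->
  (\sum_j f j t) @[t --> F] --> \sum_j y j.
Proof.
elim: n f y => [|n IH] f y H.
  by under eq_fun do rewrite big_ord0; rewrite big_ord0; exact: cvg_cst.
under eq_fun do rewrite big_ord_recl; rewrite big_ord_recl.
by apply: cvgD => //; apply: IH.
Qed.

Lemma bounded_funP (R : realType) (T : Type) (f : T -> R) :
  bounded_fun f <-> exists M : R, forall x, `|f x| <= M.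
Proof.
split=> [[M [_ MP]]|[M MP]].
  by exists (M + 1) => x; apply: MP => //; rewrite ltrDl.
exists M; split; first exact: num_real.
by move=> N MN x _ /=; rewrite (le_trans (MP x))// ltW.
Qed.

(** Restriction to a line turns directional derivatives into derivatives of one variable, for which
    the chain rule is at hand. *)
Lemma is_derive_lineP (R : numFieldType) (V W : normedModType R) (f : V -> W)
    (x v : V) (df : W) :
  is_derive x v f df <-> is_derive (0 : R) 1 (fun h => f (h *: v + x)) df.
Proof.
have E : (fun h : R => h^-1 *: (f (h *: v + x) - f x)) =
    (fun h : R => h^-1 *: (f ((h *: (1 : R) + 0) *: v + x) - f (0 *: v + x))).
  by apply/funext => h; rewrite addr0 scale0r add0r [_%:A]mulr1.
split=> -[d1 d2]; split.
- by rewrite /derivable -E.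
- by rewrite /derive -E.
- by rewrite /derivable E.
- by rewrite /derive E.
Qed.

Section Cb1_functions.
Context {R : realType} {n : nat}.
Implicit Types (phi : 'rV[R]_n -> R) (y b : 'rV[R]_n).

Lemma Cb1_line phi j y (t : R) : Cb1 phi ->
  is_derive t 1 (fun s : R => phi (y + s *: delta_mx 0 j))
    (partial phi j (y + t *: delta_mx 0 j)).
Proof.
move=> [_ _ /(_ j)[dphi _ _]].
have E : (fun h : R => h^-1 *: (phi (y + (h *: 1 + t) *: delta_mx 0 j)
      - phi (y + t *: delta_mx 0 j))) =
    (fun h : R => h^-1 *: (phi (h *: delta_mx 0 j + (y + t *: delta_mx 0 j))
      - phi (y + t *: delta_mx 0 j))).
  apply/funext => h; congr (_ *: (phi _ - _)).
  by rewrite scalerDl [h *: 1]mulr1 addrCA.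
by split; [rewrite /derivable E; exact: dphi|rewrite /derive E].
Qed.

Lemma Cb1_increment1 phi j y (c : R) : Cb1 phi ->
  exists2 d : R, `|d| <= `|c| &
    phi (y + c *: delta_mx 0 j) - phi y =
    c * partial phi j (y + d *: delta_mx 0 j).
Proof.
move=> Hphi.
have cont : continuous (fun s : R => phi (y + s *: delta_mx 0 j)).
  by move=> t; apply/differentiable_continuous/derivable1_diffP;
    case: (Cb1_line j y t Hphi).
have [c0|c0] := leP 0 c.
  have [d dc E] := MVT_segment c0 (fun t _ => Cb1_line j y t Hphi)
    (continuous_subspaceT cont).
  exists d.
    by move: dc; rewrite in_itv/= => /andP[d0 dc]; rewrite !ger0_norm.
  by move: E; rewrite scale0r addr0 subr0 mulrC.
have [d dc E] := MVT_segment (ltW c0) (fun t _ => Cb1_line j y t Hphi)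
    (continuous_subspaceT cont).
exists d.
  move: dc; rewrite in_itv/= => /andP[d0 dc].
  by rewrite !ler0_norm ?(ltW c0)// lerN2.
move: E; rewrite scale0r addr0 sub0r => /eqP.
by rewrite -eqr_opp opprB => /eqP->; rewrite mulrN opprK mulrC.
Qed.

(** Only continuous partial derivatives are given, so the increment is telescoped along a staircase
    from [y] to [y + b] that changes one coordinate at a time, with the mean value theorem on each
    step. The points [z j] stay in a box around [y] that shrinks with [b]. *)
Lemma Cb1_increment phi y b : Cb1 phi ->
  exists2 z : 'I_n -> 'rV[R]_n,
    (forall j i, `|z j 0 i - y 0 i| <= `|b 0 i|) &
    phi (y + b) - phi y = \sum_j b 0 j * partial phi j (z j).
Proof.
move=> Hphi.
pose t (k : nat) : 'rV[R]_n := \row_i (if (i < k)%N then b 0 i else 0).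
have tS (j : 'I_n) : t j.+1 = t j + b 0 j *: delta_mx 0 j.
  apply/rowP => i; rewrite !mxE eqxx /= ltnS leq_eqVlt.
  have [->|ij] := eqVneq i j; first by rewrite eqxx ltnn/= add0r mulr1.
  by have /negbTE-> : (i != j :> nat) by []; rewrite mulr0 addr0.
have /choice[d dP] (j : 'I_n) : exists d : R, `|d| <= `|b 0 j| /\
    phi (y + t j.+1) - phi (y + t j) =
    b 0 j * partial phi j (y + t j + d *: delta_mx 0 j).
  by have [d ? ?] := Cb1_increment1 j (y + t j) (b 0 j) Hphi;
    exists d; rewrite tS addrA.
exists (fun j : 'I_n => y + t j + d j *: delta_mx 0 j) => [j i|].
  rewrite !mxE eqxx/= -addrA addrAC subrr add0r.
  have [->|ij] := eqVneq i j.
    by rewrite ltnn add0r mulr1; have [] := dP j.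
  by rewrite mulr0 addr0; case: ifP; rewrite ?normr0.
have -> : phi (y + b) - phi y =
    \sum_(0 <= k < n) (phi (y + t k.+1) - phi (y + t k)).
  rewrite (telescope_sumr (fun k => phi (y + t k)))//.
  congr (phi (y + _) - phi _); apply/rowP => i; rewrite !mxE ?ltn_ord//.
  by rewrite addr0.
by rewrite big_mkord; apply: eq_bigr => j _; have [] := dP j.
Qed.

Lemma Cb1_lipschitz phi : Cb1 phi ->
  exists2 L : R, 0 <= L & forall y b,
    `|phi (y + b) - phi y| <= L * \sum_j `|b 0 j|.
Proof.
move=> Hphi.
have /choice[M MP] (j : 'I_n) : exists M : R, forall z, `|partial phi j z| <= M.
  by case: Hphi => _ _ /(_ j)[_ _ /bounded_funP].
have M0 j : 0 <= M j by apply: le_trans (MP j 0).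
exists (\sum_j M j); first by apply: sumr_ge0.
move=> y b; have [z _ ->] := Cb1_increment y b Hphi.
rewrite mulr_sumr (le_trans (ler_norm_sum _ _ _))//; apply: ler_sum => j _.
rewrite normrM mulrC ler_wpM2r//.
by rewrite (bigD1 j)//= ler_wpDr ?sumr_ge0.
Qed.

(** The intermediate points of [Cb1_increment] tend to [y] with [h], and the partial derivatives are
    continuous there. *)
Lemma Cb1_derivable_direction phi y b : Cb1 phi ->
  h^-1 * (phi (y + h *: b) - phi y) @[h --> (0 : R)^'] -->
    \sum_j b 0 j * partial phi j y.
Proof.
move=> Hphi.
have /choice[z zP] (h : R) : exists z : 'I_n -> 'rV[R]_n,
    (forall j i, `|z j 0 i - y 0 i| <= `|h| * `|b 0 i|) /\
    phi (y + h *: b) - phi y = h * \sum_j b 0 j * partial phi j (z j).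
  have [z z1 z2] := Cb1_increment y (h *: b) Hphi; exists z; split.
    by move=> j i; rewrite (le_trans (z1 j i))// mxE normrM.
  by rewrite z2 mulr_sumr; apply: eq_bigr => j _; rewrite mxE mulrA.
have zy j : z h j @[h --> (0 : R)^'] --> y.
  apply: cvg_rV => i; apply/cvgrPdist_le => e e0.
  have : (fun h : R => `|h| * `|b 0 i|) h @[h --> (0 : R)^'] --> (0 : R).
    rewrite -[X in _ --> X](mul0r `|b 0 i|); apply: cvgMr_tmp.
    by rewrite -[X in _ --> X](@normr0 R R^o); apply: cvg_norm; exact: cvg_within.
  move/cvgrPdist_le => /(_ _ e0); apply: filterS => h.
  rewrite sub0r normrN normrM !normr_id; apply: le_trans.
  by rewrite distrC; have [+ _] := zP h; apply.
apply: (@cvg_trans _ ((fun h => \sum_j b 0 j * partial phi j (z h j)) @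
    (0 : R)^')).
  apply: near_eq_cvg; near=> h.
  have [_ ->] := zP h; rewrite mulrA mulVf ?mul1r//.
  by near: h; exact: nbhs_dnbhs_neq.
apply: cvg_fun_sum => j; apply: cvgMl_tmp.
case: Hphi => _ _ /(_ j)[_ cphi _].
by apply: continuous_cvg (zy j); exact: cphi.
Unshelve. all: by end_near. Qed.

End Cb1_functions.

Section Cb1_closure.
Context {R : realType}.

Lemma Cb1I n (phi : 'rV[R]_n -> R) (dphi : 'I_n -> 'rV[R]_n -> R) :
  continuous phi -> (exists M : R, forall v, `|phi v| <= M) ->
  (forall j v, is_derive v (delta_mx 0 j) phi (dphi j v)) ->
  (forall j, continuous (dphi j)) ->
  (forall j, exists M : R, forall v, `|dphi j v| <= M) ->
  Cb1 phi /\ partial phi = dphi.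
Proof.
move=> c b d dc db.
have E : partial phi = dphi.
  by apply/funext => j; apply/funext => v; rewrite /partial; case: (d j v).
split=> //; split=> //; first exact/bounded_funP.
move=> j; split; first by move=> v; case: (d j v).
  by rewrite E; exact: dc.
by rewrite E; exact/bounded_funP.
Qed.

Variable n : nat.
Implicit Types phi psi : 'rV[R]_n -> R.

Lemma Cb1_is_derive phi j v : Cb1 phi ->
  is_derive v (delta_mx 0 j) phi (partial phi j v).
Proof. by case=> _ _ /(_ j)[/(_ v) /derivableP]. Qed.

Lemma Cb1_bounded phi : Cb1 phi -> exists M : R, forall v, `|phi v| <= M.
Proof. by case=> _ /bounded_funP. Qed.

Lemma Cb1_partial_bounded phi j : Cb1 phi ->
  exists M : R, forall v, `|partial phi j v| <= M.
Proof. by case=> _ _ /(_ j)[_ _ /bounded_funP]. Qed.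

Lemma Cb1_partial_continuous phi j : Cb1 phi -> continuous (partial phi j).
Proof. by case=> _ _ /(_ j)[]. Qed.

Lemma Cb1_continuous phi : Cb1 phi -> continuous phi.
Proof. by case. Qed.

Lemma Cb1D phi psi : Cb1 phi -> Cb1 psi ->
  Cb1 (fun v => phi v + psi v) /\
  partial (fun v => phi v + psi v) =
    (fun j v => partial phi j v + partial psi j v).
Proof.
move=> H1 H2.
have [M1 M1P] := Cb1_bounded H1; have [M2 M2P] := Cb1_bounded H2.
apply: Cb1I.
- by apply: continuous_fD; exact: Cb1_continuous.
- by exists (M1 + M2) => v; rewrite (le_trans (ler_normD _ _))// lerD.
- by move=> j v; apply: is_deriveD; exact: Cb1_is_derive.
- by move=> j; apply: continuous_fD; exact: Cb1_partial_continuous.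
- move=> j; have [N1 N1P] := Cb1_partial_bounded j H1.
  have [N2 N2P] := Cb1_partial_bounded j H2.
  by exists (N1 + N2) => v; rewrite (le_trans (ler_normD _ _))// lerD.
Qed.

Lemma Cb1M phi psi : Cb1 phi -> Cb1 psi ->
  Cb1 (fun v => phi v * psi v) /\
  partial (fun v => phi v * psi v) =
    (fun j v => phi v * partial psi j v + psi v * partial phi j v).
Proof.
move=> H1 H2.
have [M1 M1P] := Cb1_bounded H1; have [M2 M2P] := Cb1_bounded H2.
apply: Cb1I.
- by apply: continuous_fM; exact: Cb1_continuous.
- by exists (M1 * M2) => v; rewrite normrM ler_pM.
- by move=> j v; apply: is_deriveM; exact: Cb1_is_derive.
- by move=> j; apply: continuous_fD; apply: continuous_fM;
    (exact: Cb1_continuous || exact: Cb1_partial_continuous).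
- move=> j; have [N1 N1P] := Cb1_partial_bounded j H1.
  have [N2 N2P] := Cb1_partial_bounded j H2.
  exists (M1 * N2 + M2 * N1) => v; rewrite (le_trans (ler_normD _ _))//.
  by rewrite lerD// normrM ler_pM.
Qed.

Lemma Cb1_cst (c : R) : Cb1 (fun _ : 'rV[R]_n => c) /\
  partial (fun _ : 'rV[R]_n => c) = (fun _ _ => 0).
Proof.
apply: Cb1I.
- exact: continuous_fcst.
- by exists `|c|.
- by move=> j; exact: continuous_fcst.
- by move=> j; exists 0 => v; rewrite normr0.
Qed.

Lemma Cb1_comp phi (s ds : R -> R) : Cb1 phi ->
  (forall t : R, is_derive t 1 s (ds t)) -> continuous ds ->
  (exists M : R, forall t, `|s t| <= M) ->
  (exists M : R, forall t, `|ds t| <= M) ->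
  Cb1 (s \o phi) /\
  partial (s \o phi) = (fun j v => ds (phi v) * partial phi j v).
Proof.
move=> H1 dsP cds [M MP] [N NP].
have [M1 M1P] := Cb1_bounded H1.
apply: Cb1I.
- move=> v; apply: continuous_comp; first exact: Cb1_continuous.
  by apply/differentiable_continuous/derivable1_diffP; case: (dsP (phi v)).
- by exists M => v; exact: MP.
- move=> j v; apply/is_derive_lineP.
  apply: (@is_derive1_comp _ s (fun h => phi (h *: delta_mx 0 j + v))).
    by rewrite scale0r add0r.
  by apply: (iffLR (is_derive_lineP _ _ _ _)); exact: Cb1_is_derive.
- move=> j; apply: continuous_fM; last exact: Cb1_partial_continuous.
  by move=> v; apply: continuous_comp; [exact: Cb1_continuous|exact: cds].
- move=> j; have [N1 N1P] := Cb1_partial_bounded j H1.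
  by exists (N * N1) => v; rewrite normrM ler_pM.
Qed.

Lemma Cb1_shift phi (w : 'rV[R]_n) : Cb1 phi ->
  Cb1 (fun v => phi (v + w)) /\
  partial (fun v => phi (v + w)) = (fun j v => partial phi j (v + w)).
Proof.
move=> H1; have [M1 M1P] := Cb1_bounded H1.
have cw : continuous (fun v : 'rV[R]_n => v + w).
  by apply: continuous_fD; [move=> v; exact: cvg_id|exact: continuous_fcst].
apply: Cb1I.
- exact: continuous_fcomp cw (Cb1_continuous H1).
- by exists M1.
- move=> j v; apply/is_derive_lineP.
  under eq_fun do rewrite -addrA.
  by apply: (iffLR (is_derive_lineP _ _ _ _)); exact: Cb1_is_derive.
- by move=> j; exact: continuous_fcomp cw (Cb1_partial_continuous H1).
- by move=> j; have [N1 N1P] := Cb1_partial_bounded j H1; exists N1.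
Qed.

(** Covers the two block projections: a basis vector goes to a basis vector or to 0, so every
    partial derivative of the composite is a partial derivative of [phi] or zero, and no total
    differential is involved. *)
Lemma Cb1_proj m (p : {linear 'rV[R]_m -> 'rV[R]_n}) phi :
  continuous p -> (forall j, p (delta_mx 0 j) = 0 \/
    exists i, p (delta_mx 0 j) = delta_mx 0 i) -> Cb1 phi ->
  Cb1 (phi \o p) /\
  partial (phi \o p) = (fun j v => 'D_(p (delta_mx 0 j)) phi (p v)).
Proof.
move=> cp pP H1; have [M1 M1P] := Cb1_bounded H1.
apply: Cb1I.
- by move=> v; apply: continuous_comp; [exact: cp|exact: Cb1_continuous].
- by exists M1 => v; exact: M1P.
- move=> j v; apply/is_derive_lineP.
  have -> : (fun h : R => (phi \o p) (h *: delta_mx 0 j + v)) =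
      (fun h : R => phi (h *: p (delta_mx 0 j) + p v)).
    by apply/funext => h /=; rewrite linearP.
  apply: (iffLR (is_derive_lineP _ _ _ _)).
  have [->|[i ->]] := pP j; last exact: Cb1_is_derive.
  by rewrite derive0; exact: is_derive0.
- move=> j; have [->|[i ->]] := pP j.
    by under eq_fun do rewrite derive0; exact: continuous_fcst.
  by move=> v; apply: (@continuous_comp _ _ _ p (partial phi i));
    [exact: cp|exact: Cb1_partial_continuous].
- move=> j; have [->|[i ->]] := pP j.
    by exists 0 => v; rewrite derive0 normr0.
  by have [N1 N1P] := Cb1_partial_bounded i H1; exists N1 => v; exact: N1P.
Qed.

End Cb1_closure.

Section cylindrical_functions.
Context {R : realType} {X : completeNormedModType R} {H : hilbertType R}.
Variable istar : cdual X -> H.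
Implicit Types (f g : X -> R) (F G : X -> H).

Lemma lsubmx_continuous n1 n2 :
  continuous (lsubmx : 'rV[R]_(n1 + n2) -> 'rV[R]_n1).
Proof.
apply: continuous_rV => i; under eq_fun do rewrite mxE.
exact: coord_continuous.
Qed.

Lemma rsubmx_continuous n1 n2 :
  continuous (rsubmx : 'rV[R]_(n1 + n2) -> 'rV[R]_n2).
Proof.
apply: continuous_rV => i; under eq_fun do rewrite mxE.
exact: coord_continuous.
Qed.

Lemma lsubmx_delta n1 n2 (j : 'I_(n1 + n2)) :
  lsubmx (delta_mx 0 j : 'rV[R]_(n1 + n2)) =
  match fintype.split j with inl i => delta_mx 0 i | inr _ => 0 end.
Proof.
apply/rowP => k; rewrite !mxE eqxx/=; case: (splitP j) => i ij.
  by rewrite mxE eqxx/= -val_eqE/= ij val_eqE.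
by rewrite mxE -val_eqE/= ij ltn_eqF// ltn_addr.
Qed.

Lemma rsubmx_delta n1 n2 (j : 'I_(n1 + n2)) :
  rsubmx (delta_mx 0 j : 'rV[R]_(n1 + n2)) =
  match fintype.split j with inl _ => 0 | inr i => delta_mx 0 i end.
Proof.
apply/rowP => k; rewrite !mxE eqxx/=; case: (splitP j) => i ij.
  by rewrite mxE -val_eqE/= ij gtn_eqF// ltn_addr.
by rewrite mxE eqxx/= -val_eqE/= ij eqn_add2l val_eqE.
Qed.

(** Concatenating the two lists of functionals gives both functions the same variables, so that
    algebra on cylindrical functions reduces to algebra on C_b^1. The gradients [F] and [G] are
    unchanged because the partial derivatives in the foreign variables vanish. *)
Lemma DH_common f F g G : DH istar f F -> DH istar g G ->
  exists n (phi psi : 'rV[R]_n -> R) (xs : 'I_n -> cdual X),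
    [/\ Cb1 phi, Cb1 psi,
      f = (fun x => phi (coords xs x)) /\
      F = (fun x => \sum_(j < n) partial phi j (coords xs x) *: istar (xs j)) &
      g = (fun x => psi (coords xs x)) /\
      G = (fun x => \sum_(j < n) partial psi j (coords xs x) *: istar (xs j))].
Proof.
move=> [n1 [phi [xs1 [H1 -> ->]]]] [n2 [psi [xs2 [H2 -> ->]]]].
pose xs (j : 'I_(n1 + n2)) := match fintype.split j with inl i => xs1 i | inr i => xs2 i end.
have lP j : lsubmx (delta_mx 0 j : 'rV[R]_(n1 + n2)) = 0 \/
    exists i, lsubmx (delta_mx 0 j : 'rV[R]_(n1 + n2)) = delta_mx 0 i.
  by rewrite lsubmx_delta; case: fintype.split => i; [right; exists i|left].
have rP j : rsubmx (delta_mx 0 j : 'rV[R]_(n1 + n2)) = 0 \/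
    exists i, rsubmx (delta_mx 0 j : 'rV[R]_(n1 + n2)) = delta_mx 0 i.
  by rewrite rsubmx_delta; case: fintype.split => i; [left|right; exists i].
have [K1 E1] := Cb1_proj (@lsubmx_continuous n1 n2) lP H1.
have [K2 E2] := Cb1_proj (@rsubmx_continuous n1 n2) rP H2.
have xl x : lsubmx (coords xs x) = coords xs1 x.
  by apply/rowP => i; rewrite !mxE /xs (unsplitK (inl i)).
have xr x : rsubmx (coords xs x) = coords xs2 x.
  by apply/rowP => i; rewrite !mxE /xs (unsplitK (inr i)).
exists (n1 + n2)%N, (phi \o lsubmx), (psi \o rsubmx), xs; split=> //; split.
- by apply/funext => x /=; rewrite xl.
- apply/funext => x; rewrite E1 big_split_ord/= [X in _ = _ + X]big1 ?addr0.
    apply: eq_bigr => i _.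
    by rewrite xl lsubmx_delta /xs (unsplitK (inl i)).
  by move=> i _; rewrite lsubmx_delta (unsplitK (inr i)) derive0 scale0r.
- by apply/funext => x /=; rewrite xr.
- apply/funext => x; rewrite E2 big_split_ord/= [X in _ = X + _]big1 ?add0r.
    apply: eq_bigr => i _.
    by rewrite xr rsubmx_delta /xs (unsplitK (inr i)).
  by move=> i _; rewrite rsubmx_delta (unsplitK (inl i)) derive0 scale0r.
Qed.

Lemma DH_D f F g G : DH istar f F -> DH istar g G ->
  DH istar (fun x => f x + g x) (fun x => F x + G x).
Proof.
move=> Hf Hg.
have [n [phi [psi [xs [H1 H2 [-> ->] [-> ->]]]]]] := DH_common Hf Hg.
have [K E] := Cb1D H1 H2; exists n, (fun v => phi v + psi v), xs; split=> //.
apply/funext => x; rewrite E -big_split; apply: eq_bigr => j _ /=.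
by rewrite scalerDl.
Qed.

Lemma DH_M f F g G : DH istar f F -> DH istar g G ->
  DH istar (fun x => f x * g x) (fun x => f x *: G x + g x *: F x).
Proof.
move=> Hf Hg.
have [n [phi [psi [xs [H1 H2 [-> ->] [-> ->]]]]]] := DH_common Hf Hg.
have [K E] := Cb1M H1 H2; exists n, (fun v => phi v * psi v), xs; split=> //.
apply/funext => x; rewrite E !scaler_sumr -big_split; apply: eq_bigr => j _ /=.
by rewrite scalerDl !scalerA.
Qed.

Lemma DH_cst (c : R) : DH istar (fun=> c) (fun=> 0).
Proof.
have [K E] := @Cb1_cst R 0 c.
exists 0%N, (fun=> c), (fun=> 0); split=> //.
by apply/funext => x; rewrite big_ord0.
Qed.

Lemma DH_Z (c : R) f F : DH istar f F ->
  DH istar (fun x => c * f x) (fun x => c *: F x).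
Proof.
move=> Hf; have := DH_M (DH_cst c) Hf.
suff -> : (fun x => c *: F x + f x *: 0) = (fun x => c *: F x) by [].
by apply/funext => x; rewrite scaler0 addr0.
Qed.

Lemma DH_comp f F (s ds : R -> R) : DH istar f F ->
  (forall t : R, is_derive t 1 s (ds t)) -> continuous ds ->
  (exists M : R, forall t, `|s t| <= M) ->
  (exists M : R, forall t, `|ds t| <= M) ->
  DH istar (s \o f) (fun x => ds (f x) *: F x).
Proof.
move=> [n [phi [xs [H1 -> ->]]]] h1 h2 h3 h4.
have [K E] := Cb1_comp H1 h1 h2 h3 h4; exists n, (s \o phi), xs; split=> //.
apply/funext => x; rewrite E scaler_sumr; apply: eq_bigr => j _.
by rewrite scalerA.
Qed.

(** Keeps difference quotients of cylindrical functions cylindrical. *)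
Lemma DH_shift f F (z : X) : DH istar f F ->
  DH istar (fun x => f (x + z)) (fun x => F (x + z)).
Proof.
move=> [n [phi [xs [H1 -> ->]]]].
have [K E] := Cb1_shift (coords xs z) H1.
have cD x : coords xs (x + z) = coords xs x + coords xs z.
  by apply/rowP => j; rewrite !mxE linearD.
exists n, (fun v => phi (v + coords xs z)), xs; split=> //.
  by apply/funext => x; rewrite cD.
apply/funext => x; rewrite E; apply: eq_bigr => j _.
by rewrite cD.
Qed.

Lemma coords_continuous n (xs : 'I_n -> cdual X) : continuous (coords xs).
Proof.
move=> x; apply: cvg_rV => j; rewrite mxE; under eq_fun do rewrite mxE.
exact: clin_continuous.
Qed.

Lemma DH_continuous f F : DH istar f F -> continuous f.
Proof.
move=> [n [phi [xs [H1 -> _]]]] x.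
by apply: continuous_comp; [exact: coords_continuous|exact: Cb1_continuous].
Qed.

Lemma DH_continuous_grad f F : DH istar f F -> continuous F.
Proof.
move=> [n [phi [xs [H1 _ ->]]]] x.
apply: cvg_fun_sum => j; apply: cvgZr_tmp.
apply: continuous_comp; first exact: coords_continuous.
exact: Cb1_partial_continuous.
Qed.

Lemma DH_bounded f F : DH istar f F -> exists M : R, forall x, `|f x| <= M.
Proof.
move=> [n [phi [xs [H1 -> _]]]]; have [M MP] := Cb1_bounded H1.
by exists M.
Qed.

Lemma DH_bounded_grad f F : DH istar f F ->
  exists M : R, forall x, `|F x| <= M.
Proof.
move=> [n [phi [xs [H1 _ ->]]]].
have /choice[M MP] j := Cb1_partial_bounded j H1.
exists (\sum_j M j * `|istar (xs j)|) => x.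
rewrite (le_trans (ler_norm_sum _ _ _))//; apply: ler_sum => j _.
by rewrite normrZ ler_wpM2r.
Qed.

End cylindrical_functions.

(** * Uniform approximation by trigonometric polynomials *)

Section bernstein.
Context {R : realType}.
Implicit Types (F G : nat -> R) (y a L : R).

(* The expectation of [F S] for a binomial variable [S] of parameters [m, y]. *)
Fixpoint bernstein m F y : R :=
  if m is k.+1 then y * bernstein k (F \o S) y + (1 - y) * bernstein k F y
  else F 0%N.

Lemma bernstein_le m F G y : 0 <= y <= 1 -> (forall k, F k <= G k) ->
  bernstein m F y <= bernstein m G y.
Proof.
move=> /andP[y0 y1]; elim: m F G => [|m IH] F G FG /=; first exact: FG.
by rewrite lerD// ler_wpM2l ?subr_ge0// IH// => k; exact: FG.
Qed.

Lemma bernsteinD m F G y :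
  bernstein m (fun k => F k + G k) y = bernstein m F y + bernstein m G y.
Proof.
elim: m F G => [//|m IH] F G /=.
have -> : (fun k => F k + G k) \o S = (fun k => (F \o S) k + (G \o S) k) by [].
by rewrite !IH; ring.
Qed.

Lemma bernsteinZ m F y a :
  bernstein m (fun k => a * F k) y = a * bernstein m F y.
Proof.
elim: m F => [//|m IH] F /=.
have -> : (fun k => a * F k) \o S = (fun k => a * (F \o S) k) by [].
by rewrite !IH; ring.
Qed.

Lemma bernstein_cst m a y : bernstein m (fun=> a) y = a.
Proof.
by elim: m => [//|m IH] /=; rewrite (_ : _ \o S = fun=> a)// IH; ring.
Qed.

(** Variance of the binomial law plus the squared distance from its mean to [a]. *)
Lemma bernstein_sqr m a y :
  bernstein m (fun k => (k%:R - a) ^+ 2) y =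
  m%:R * (y * (1 - y)) + (m%:R * y - a) ^+ 2.
Proof.
elim: m a => [|m IH] a /=; first ring.
have -> : (fun k : nat => (k%:R - a) ^+ 2) \o S =
    (fun k => (k%:R - (a - 1)) ^+ 2).
  by apply/funext => k /=; rewrite -natr1; ring.
by rewrite !IH -natr1; ring.
Qed.

(** The Lipschitz bound is averaged with the help of [z <= e + z ^+ 2 / e], which trades the first
    absolute moment for the variance; [y * (1 - y) <= 1] is then enough. *)
Lemma bernstein_approx (phi : R -> R) L y (e : R) m : 0 <= y <= 1 -> 0 < e ->
  (forall s t, `|phi s - phi t| <= L * `|s - t|) -> (0 < m)%N ->
  `|phi y - bernstein m (fun k => phi (k%:R / m%:R)) y| <=
    L * (e + (e * m%:R)^-1).
Proof.
move=> y01 e0 phiL m0.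
have mR : 0 < m%:R :> R by rewrite ltr0n.
have L0 : 0 <= L.
  by have := phiL 1 0; rewrite subr0 normr1 mulr1; exact: le_trans.
have key k : `|phi y - phi (k%:R / m%:R)| <=
    L * (e + (e * m%:R ^+ 2)^-1 * (k%:R - m%:R * y) ^+ 2).
  rewrite (le_trans (phiL _ _))// ler_wpM2l//.
  set d := k%:R - _; have -> : y - k%:R / m%:R = - (d / m%:R).
    by rewrite /d; field; exact: lt0r_neq0.
  have -> : (e * m%:R ^+ 2)^-1 * d ^+ 2 = e^-1 * `|d / m%:R| ^+ 2.
    by rewrite real_normK ?num_real//; field; rewrite !lt0r_neq0.
  rewrite normrN; set z := `|_|; have z0 : 0 <= z by rewrite normr_ge0.
  by rewrite -(ler_pM2l e0) mulrDr mulVKf ?lt0r_neq0//; nra.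
have B : bernstein m (fun k => L * (e + (e * m%:R ^+ 2)^-1 *
    (k%:R - m%:R * y) ^+ 2)) y <= L * (e + (e * m%:R)^-1).
  rewrite bernsteinZ bernsteinD bernstein_cst bernsteinZ bernstein_sqr subrr.
  rewrite expr0n addr0 ler_wpM2l// lerD2l.
  rewrite (_ : (e * m%:R)^-1 = (e * m%:R ^+ 2)^-1 * m%:R); last first.
    by field; rewrite !lt0r_neq0.
  have em0 : 0 <= (e * m%:R ^+ 2)^-1.
    by rewrite invr_ge0 mulr_ge0 ?exprn_ge0// ltW.
  rewrite ler_wpM2l//.
  by rewrite ler_piMr ?ltW//; case/andP: y01 => *; nra.
have -> : phi y - bernstein m (fun k => phi (k%:R / m%:R)) y =
    bernstein m (fun k => phi y - phi (k%:R / m%:R)) y.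
  have -> : (fun k : nat => phi y - phi (k%:R / m%:R)) =
      (fun k => phi y + -1 * phi (k%:R / m%:R)).
    by apply/funext => k; rewrite mulN1r.
  by rewrite bernsteinD bernstein_cst bernsteinZ mulN1r.
rewrite ler_norml; apply/andP; split; last first.
  apply: le_trans B; apply: bernstein_le => // k.
  by rewrite (le_trans (ler_norm _)).
rewrite lerNl; apply: le_trans B.
rewrite -mulN1r -bernsteinZ; apply: bernstein_le => // k.
by rewrite mulN1r (le_trans (ler_norm _))// normrN.
Qed.

End bernstein.

Section trigonometric_functions.
Context {R : realType} {X : completeNormedModType R}.
Implicit Types (f g : cdual X) (u v w : X -> R).

(** The phase [c] turns sines and constants into multiples of cosines; products need no constructor,
    thanks to the product-to-sum formula. *)
Inductive trig : (X -> R) -> Prop :=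
| trig_cos f c : trig (fun x => cos ((f x : R) + c))
| trigD u v : trig u -> trig v -> trig (fun x => u x + v x)
| trigZ a u : trig u -> trig (fun x => a * u x).

Lemma trig_cst a : trig (fun=> a).
Proof.
have := trigZ a (trig_cos 0 0).
by under eq_fun do rewrite (_ : (0 : cdual X) _ = 0)// add0r cos0 mulr1.
Qed.

Lemma trig_sin f c : trig (fun x => sin ((f x : R) + c)).
Proof.
have := trig_cos f (c - pi / 2).
suff -> : (fun x => cos ((f x : R) + (c - pi / 2))) =
    (fun x => sin ((f x : R) + c)) by [].
apply/funext => x; rewrite addrA cosB cos_pihalf sin_pihalf.
by rewrite mulr0 add0r mulr1.
Qed.

Lemma trigM u v : trig u -> trig v -> trig (fun x => u x * v x).
Proof.
move=> tu; elim: tu v => [f c v|u1 u2 _ IH1 _ IH2 v tv|a u1 _ IH v tv].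
- elim=> [g d|v1 v2 _ IH1 _ IH2|a v1 _ IH].
  + have := trigD (trigZ 2^-1 (trig_cos (f + g) (c + d)))
      (trigZ 2^-1 (trig_cos (f - g) (c - d))).
    set w := (X in trig X -> _); set w' := (X in _ -> trig X).
    suff -> : w = w' by [].
    apply/funext => x; rewrite /w /w'.
    have -> : ((f + g) x : R) + (c + d) = (f x + c) + (g x + d).
      by rewrite addrACA.
    have -> : ((f - g) x : R) + (c - d) = (f x + c) - (g x + d).
      by rewrite opprD addrACA.
    have E (s t : R) : 2^-1 * cos (s + t) + 2^-1 * cos (s - t) = cos s * cos t.
      by rewrite cosD cosB; field.
    exact: E.
  + by under eq_fun do rewrite mulrDr; exact: trigD.
  + by under eq_fun do rewrite mulrCA; exact: trigZ.
- by under eq_fun do rewrite mulrDl; apply: trigD; [exact: IH1|exact: IH2].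
- by under eq_fun do rewrite -mulrA; apply: trigZ; exact: IH.
Qed.

Lemma trig_bounded u : trig u -> exists2 M : R, 0 <= M & forall x, `|u x| <= M.
Proof.
elim=> [f c|u1 u2 _ [M1 ? P1] _ [M2 ? P2]|a u1 _ [M M0 P]].
- by exists 1 => // x; rewrite ler_norml cos_geN1 cos_le1.
- exists (M1 + M2) => [|x]; first exact: addr_ge0.
  by rewrite (le_trans (ler_normD _ _))// lerD.
- by exists (`|a| * M) => [|x]; [exact: mulr_ge0|rewrite normrM ler_wpM2l].
Qed.

Lemma trig_continuous u : trig u -> continuous u.
Proof.
elim=> [f c|u1 u2 _ H1 _ H2|a u1 _ H].
- apply: (@continuous_fcomp R X R (fun x => (f x : R) + c) cos).
    by apply: continuous_fD; [exact: clin_continuous|exact: continuous_fcst].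
  exact: continuous_cos.
- exact: continuous_fD.
- by apply: continuous_fM => //; exact: continuous_fcst.
Qed.

Lemma trig_shift u (z : X) : trig u -> trig (fun x => u (x + z)).
Proof.
elim=> [f c|u1 u2 _ H1 _ H2|a u1 _ H].
- under eq_fun do rewrite linearD -addrA; exact: trig_cos.
- exact: trigD.
- exact: trigZ.
Qed.

Definition utrig u := forall e : R, 0 < e ->
  exists2 w, trig w & forall x, `|u x - w x| <= e.

Lemma utrig_trig u : trig u -> utrig u.
Proof.
by move=> tu e e0; exists u => // x; rewrite subrr normr0 ltW.
Qed.

Lemma utrigD u v : utrig u -> utrig v -> utrig (fun x => u x + v x).
Proof.
move=> hu hv e e0.
have [u' tu ue] := hu _ (divr_gt0 e0 (ltr0n _ 2)).
have [v' tv ve] := hv _ (divr_gt0 e0 (ltr0n _ 2)).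
exists (fun x => u' x + v' x) => [|x]; first exact: trigD.
by rewrite opprD addrACA (le_trans (ler_normD _ _))// [e]splitr lerD.
Qed.

Lemma utrigM u w : trig w -> utrig u -> utrig (fun x => w x * u x).
Proof.
move=> tw hu e e0; have [M M0 MP] := trig_bounded tw.
have M1 : 0 < M + 1 by rewrite ltr_wpDl.
have [u' tu ue] := hu _ (divr_gt0 e0 M1).
exists (fun x => w x * u' x) => [|x]; first exact: trigM.
rewrite -mulrBr normrM (@le_trans _ _ (M * (e / (M + 1))))//.
  by rewrite ler_pM.
by rewrite mulrCA ger_pMr// ler_pdivrMr// mul1r lerDl.
Qed.

Lemma utrig_lim u :
  (forall e : R, 0 < e -> exists2 w, utrig w & forall x, `|u x - w x| <= e) ->
  utrig u.
Proof.
move=> H e e0; have e2 := divr_gt0 e0 (ltr0n _ 2).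
have [w /(_ _ e2)[w' tw ww'] uw] := H _ e2.
exists w' => // x; rewrite -(subrKA (w x)) (le_trans (ler_normD _ _))//.
by rewrite [e]splitr lerD.
Qed.

Lemma utrig_bernstein m (F : nat -> X -> R) w : trig w ->
  (forall k, utrig (F k)) ->
  utrig (fun x => bernstein m (fun k => F k x) (w x)).
Proof.
move=> tw; elim: m F => [|m IH] F hF; first exact: hF.
apply: utrigD; apply: utrigM => //.
- by apply: (IH (F \o S)) => k; exact: hF.
- apply: trigD; first exact: trig_cst.
  by under eq_fun do rewrite -mulN1r; exact: trigZ.
- exact: IH.
Qed.

(** Induction on the number [l] of coordinates that vary with [x], the others being frozen. The next
    coordinate is released by a one-variable Bernstein polynomial, whose coefficients are functions
    with that coordinate frozen at the nodes and are covered by the induction hypothesis. *)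
Lemma utrig_comp n (phi : 'rV[R]_n -> R) (L : R) (s : 'I_n -> X -> R) :
  0 <= L ->
  (forall y z, `|phi y - phi z| <= L * \sum_j `|y 0 j - z 0 j|) ->
  (forall j, trig (s j)) -> (forall j x, 0 <= s j x <= 1) ->
  utrig (fun x => phi (\row_j s j x)).
Proof.
move=> L0 phiL ts s01.
suff H l (ln : (l <= n)%N) (c : 'rV[R]_n) :
    utrig (fun x => phi (\row_j if (j < l)%N then s j x else c 0 j)).
  have := H n (leqnn _) 0.
  suff -> : (fun x => phi (\row_j if (j < n)%N then s j x else (0 : 'rV_n) 0 j))
      = (fun x => phi (\row_j s j x)) by [].
  by apply/funext => x; congr phi; apply/rowP => j; rewrite !mxE ltn_ord.
elim: l ln c => [_ c|l IH ln c].
  by apply: utrig_trig; exact: (trig_cst (phi (\row_j c 0 j))).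
pose k := Ordinal ln.
pose row t x := \row_j (if (j < l)%N then s j x else
  if j == k then t else c 0 j) : 'rV[R]_n.
have rowE x : (\row_j if (j < l.+1)%N then s j x else c 0 j) = row (s k x) x.
  apply/rowP => j; rewrite !mxE ltnS leq_eqVlt.
  have [->|jk] := eqVneq j k; first by rewrite eqxx ltnn.
  by have /negbTE-> : (j != l :> nat) by [].
have rowL x t t' : `|phi (row t x) - phi (row t' x)| <= L * `|t - t'|.
  rewrite (le_trans (phiL _ _))// ler_wpM2l// (bigD1 k)//= !mxE ltnn eqxx.
  rewrite big1 ?addr0// => j jk; rewrite !mxE (negbTE jk).
  by case: ifP; rewrite subrr normr0.
have rowU t : utrig (fun x => phi (row t x)).
  have := IH (ltnW ln) (\row_j if j == k then t else c 0 j).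
  suff -> : (fun x => phi (\row_j if (j < l)%N then s j x
      else (\row_j0 (if j0 == k then t else c 0 j0)) 0 j)) =
      (fun x => phi (row t x)) by [].
  apply/funext => x; congr phi; apply/rowP => j; rewrite !mxE.
  by case: ifP.
under eq_fun do rewrite rowE.
apply: utrig_lim => e e0.
(* With [d = e / (2 * (L + 1))] and [m > 1 / d ^ 2], both terms in the bracket are at most [d], and
   [L * (d + d) <= e]. *)
have [m m0 me] : exists2 m, (0 < m)%N &
    L * (e / (2 * (L + 1)) + (e / (2 * (L + 1)) * m%:R)^-1) <= e.
  have L1 : 0 < L + 1 by rewrite ltr_wpDl.
  have d0 : 0 < e / (2 * (L + 1)) by rewrite divr_gt0// mulr_gt0.
  set d := e / _; pose m := (Num.truncn (d^-1 / d)).+1; exists m => //.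
  have mlt : d^-1 / d < m%:R by exact: truncnS_gt.
  have m0 : 0 < m%:R :> R by rewrite ltr0n.
  have : (d * m%:R)^-1 <= d.
    have dm0 : 0 < d * m%:R by exact: mulr_gt0.
    have dV0 : 0 < d^-1 by rewrite invr_gt0.
    rewrite -[leRHS]invrK lef_pV2 ?posrE//.
    rewrite -(ler_pM2l (_ : 0 < d^-1))// mulKf ?lt0r_neq0//.
    by rewrite mulrC ltW.
  move=> H; apply: (@le_trans _ _ (L * (d + d))).
    by rewrite ler_wpM2l// lerD2l.
  have -> : e = (L + 1) * (d + d).
    by rewrite /d; field; exact: lt0r_neq0.
  by rewrite ler_wpM2r ?addr_ge0 ?ltW// ltrDl.
exists (fun x => bernstein m (fun k => phi (row (k%:R / m%:R) x)) (s k x)).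
  apply: (@utrig_bernstein m (fun k0 x => phi (row (k0%:R / m%:R) x))) => //.
move=> x; apply: le_trans me.
apply: (@bernstein_approx R (fun t => phi (row t x))) => //.
by rewrite divr_gt0// mulr_gt0// ltr_wpDl.
Qed.

(** [N * sin (t / N)] confines the arguments to a cube, where Bernstein polynomials apply, and tends
    to [t] as [N] grows. Rescaling the cube to [[0, 1]] multiplies the Lipschitz constant by
    [2 * N]. *)
Lemma utrig_sin n (phi : 'rV[R]_n -> R) (L N : R) (xs : 'I_n -> cdual X) :
  0 <= L -> 0 < N ->
  (forall y z, `|phi y - phi z| <= L * \sum_j `|y 0 j - z 0 j|) ->
  utrig (fun x => phi (\row_j (N * sin ((xs j x : R) / N)))).
Proof.
move=> L0 N0 phiL.
pose s j (x : X) : R := 2^-1 * (1 + sin (((N^-1 *: xs j) x : R) + 0)).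
pose psi (y : 'rV[R]_n) : R := phi (\row_j (N * (2 * y 0 j - 1))).
have -> : (fun x => phi (\row_j (N * sin ((xs j x : R) / N)))) =
    (fun x => psi (\row_j s j x)).
  apply/funext => x; congr phi; apply/rowP => j; rewrite !mxE /s addr0.
  have -> : ((N^-1 *: xs j) x : R) = N^-1 * xs j x by [].
  have E (t : R) : 2 * (2^-1 * (1 + t)) - 1 = t by field.
  by rewrite E (mulrC N^-1).
apply: (utrig_comp (L := L * (N * 2))).
- by rewrite mulr_ge0// mulr_ge0// ltW.
- move=> y z; rewrite (le_trans (phiL _ _))// -mulrA ler_wpM2l// mulr_sumr.
  apply: ler_sum => j _; rewrite !mxE -mulrBr opprB addrA subrK -mulrBr mulrA.
  by rewrite normrM ger0_norm// mulr_ge0// ltW.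
- move=> j; apply: trigZ; apply: trigD; first exact: trig_cst.
  exact: trig_sin.
- move=> j x; rewrite /s; set t := sin _.
  have := sin_geN1 (((N^-1 *: xs j) x : R) + 0).
  have := sin_le1 (((N^-1 *: xs j) x : R) + 0); rewrite -/t => *.
  by apply/andP; split; lra.
Qed.

End trigonometric_functions.

(** * Gaussian integration by parts *)

Section integral_density.
Context d (T : measurableType d) (R : realType).
Variables (mu nu : {measure set T -> \bar R}) (g : T -> R).
Hypotheses (mg : measurable_fun setT g) (g0 : forall x, 0 <= g x).
Hypothesis nuE : forall A, measurable A -> nu A = (\int[mu]_(x in A) (g x)%:E)%E.
Import HBNNSimple.
Local Open Scope ereal_scope.

Let integralM_indic (A : set T) : measurable A ->
  \int[mu]_x ((\1_A x)%:E * (g x)%:E) = nu A.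
Proof.
move=> mA; rewrite nuE// [RHS]integral_mkcond; apply: eq_integral => x _.
by rewrite epatch_indic/= muleC.
Qed.

(** [nu] is known through its values on sets, hence the passage through simple functions and
    monotone convergence on both sides. *)
Lemma ge0_integral_density (f : T -> \bar R) :
  measurable_fun setT f -> (forall x, 0 <= f x) ->
  \int[nu]_x f x = \int[mu]_x (f x * (g x)%:E).
Proof.
move=> mf f0; have mT := @measurableT _ T.
pose f_ := nnsfun_approx mT mf.
have f_f x : (f_ n x)%:E @[n --> \oo] --> f x.
  exact: cvg_nnsfun_approx.
transitivity (limn (fun n => \int[nu]_x (f_ n x)%:E)).
  rewrite -monotone_convergence//.
  - by apply: eq_integral => y _; apply/esym/cvg_lim => //.
  - by move=> n; exact/measurable_EFinP/measurable_funP.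
  - by move=> n y _; rewrite lee_fin.
  - by move=> y _ m n mn; rewrite lee_fin; exact/lefP/nd_nnsfun_approx.
have mfg n : measurable_fun setT (fun x => (f_ n x)%:E * (g x)%:E).
  by apply: emeasurable_funM; apply/measurable_EFinP => //; exact/measurable_funP.
rewrite [X in limn X](_ : _ = (fun n => \int[mu]_x ((f_ n x)%:E * (g x)%:E))).
  rewrite -monotone_convergence//.
  - apply: eq_integral => y _; apply/cvg_lim => //.
    by apply: cvgeZr => //; exact: f_f.
  - by move=> n x _; rewrite mule_ge0// lee_fin.
  - move=> x _ m n mn; rewrite lee_wpmul2r ?lee_fin//.
    exact/lefP/nd_nnsfun_approx.
apply/funext => n.
have mfn r : measurable (f_ n @^-1` [set r]) by [].
transitivity (\sum_(k \in range (f_ n)) k%:E * nu (f_ n @^-1` [set k])).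
  by rewrite integralT_nnsfun sintegralE.
transitivity (\sum_(k \in range (f_ n))
    \int[mu]_x (k%:E * ((\1_(f_ n @^-1` [set k]) x)%:E * (g x)%:E))).
  apply: eq_fsbigr => r /[!inE] -[x _ fxr]; rewrite -integralM_indic//.
  rewrite ge0_integralZl//.
  - by apply: emeasurable_funM; exact/measurable_EFinP.
  - by move=> y _; rewrite mule_ge0// lee_fin.
  - by rewrite lee_fin -fxr.
rewrite -ge0_integral_fsum//.
- apply: eq_integral => x _; rewrite [in RHS]fimfunE -fsumEFin//.
  rewrite ge0_mule_fsuml; last first.
    by move=> r; rewrite EFinM nnfun_muleindic_ge0.
  by apply: eq_fsbigr => r _; rewrite EFinM muleA.
- move=> r; apply: emeasurable_funM => //.
  by apply: emeasurable_funM; exact/measurable_EFinP.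
- move=> r x _; rewrite muleA; apply: mule_ge0; last by rewrite lee_fin.
  exact: nnfun_muleindic_ge0.
Qed.

Lemma integrable_density (f : T -> R) : measurable_fun setT f ->
  mu.-integrable setT (fun x => (f x * g x)%:E) ->
  nu.-integrable setT (EFin \o f) /\
  \int[nu]_x (f x)%:E = \int[mu]_x (f x * g x)%:E.
Proof.
move=> mf /integrableP[mfg ifg]; split.
  apply/integrableP; split; first exact/measurable_EFinP.
  rewrite ge0_integral_density//; last first.
    by apply: measurableT_comp => //; exact/measurable_EFinP.
  apply: le_lt_trans ifg; rewrite le_eqVlt; apply/orP; left; apply/eqP.
  by apply: eq_integral => x _ /=; rewrite normrM (ger0_norm (g0 x)) EFinM.
rewrite integralE [RHS]integralE; congr (_ - _).
  rewrite ge0_integral_density//; last first.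
    by apply: measurable_funepos; exact/measurable_EFinP.
  apply: eq_integral => x _; rewrite !funeposE.
  by rewrite EFinM maxe_pMl ?lee_fin// mul0e.
rewrite ge0_integral_density//; last first.
  by apply: measurable_funeneg; exact/measurable_EFinP.
apply: eq_integral => x _; rewrite !funenegE.
by rewrite -!EFinN -mulNr EFinM maxe_pMl ?lee_fin// mul0e.
Qed.

End integral_density.

Section borel_measurability.
Context {R : realType} {X : completeNormedModType R}.

Lemma open_borel (A : set X) : open A -> measurable (A : set (borel X)).
Proof. by move=> oA; exact: sub_sigma_algebra. Qed.

Lemma continuous_borel_measurable (f : X -> R) : continuous f ->
  measurable_fun setT (f : borel X -> R).
Proof.
move=> cf; apply: (measurability _ (RGenOInfty.measurableE R)) => //.
move=> _ [_ [x ->] <-]; rewrite setTI; apply: open_borel.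
by apply: open_comp => [? _|]; [exact: cf|exact: interval_open].
Qed.

Lemma continuous_borel_measurableH (H : completeNormedModType R) (f : X -> H) :
  continuous f -> measurable_fun setT (f : borel X -> borel H).
Proof.
move=> cf; apply: measurability => //.
move=> _ [B oB <-]; rewrite setTI; apply: open_borel.
by apply: open_comp => [? _|]; [exact: cf|exact: oB].
Qed.

End borel_measurability.

Section Rintegral_convergence.
Context d (T : measurableType d) (R : realType).
Variable mu : {measure set T -> \bar R}.

Lemma cvg_Rintegral (f_ : nat -> T -> R) (f g : T -> R) :
  (forall n, measurable_fun setT (f_ n)) -> measurable_fun setT f ->
  {ae mu, forall x, f_ n x @[n --> \oo] --> f x} ->
  mu.-integrable setT (EFin \o g) -> (forall n x, `|f_ n x| <= g x) ->
  \int[mu]_x f_ n x @[n --> \oo] --> \int[mu]_x f x.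
Proof.
move=> mf_ mf f_f ig f_g.
have [if_ _ H] := @dominated_convergence _ _ R mu setT measurableT
  (fun n x => (f_ n x)%:E) (EFin \o f) (EFin \o g)
  (fun n => (measurable_EFinP _ _).2 (mf_ n)) ((measurable_EFinP _ _).2 mf)
  ltac:(by apply: filterS f_f => x fx _; apply: cvg_EFin => //; exact: nearW) ig
  ltac:(by apply: aeW => x n _; rewrite lee_fin).
apply: fine_cvg; rewrite fineK//.
exact: integrable_fin_num.
Qed.

End Rintegral_convergence.

(** * Stein's identity on the line *)

Section normal_moments.
Context {R : realType}.
Variable s : R.
Hypothesis s0 : s != 0.
Local Notation p := (normal_pdf 0 s).
Local Notation leb := (@lebesgue_measure R).

Lemma expR_normal_pdf a y :
  expR (a * y) * p y = expR (a ^+ 2 * s ^+ 2 / 2) * normal_pdf (a * s ^+ 2) s y.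
Proof.
rewrite !normal_pdfE// /normal_fun mulrCA [RHS]mulrCA -!expRD; congr (_ * expR _).
by rewrite -mulr_natr; field.
Qed.

Lemma expR_normal_integral a :
  (\int[leb]_y (expR (a * y) * p y)%:E = (expR (a ^+ 2 * s ^+ 2 / 2))%:E)%E.
Proof.
under eq_integral do rewrite expR_normal_pdf EFinM.
rewrite integralZl//; last exact: integrable_normal_pdf.
by rewrite integral_normal_pdf mule1.
Qed.

(** A single majorant for the integrands below. Completing the square makes it a combination of two
    shifted normal densities, hence integrable and bounded. *)
Definition normal_dominant y : R := 4 * (expR y + expR (- y)) * p y.

Lemma normal_dominant_integrable : leb.-integrable setT (EFin \o normal_dominant).
Proof.
have -> : EFin \o normal_dominant = (fun y =>
    (4 * expR (s ^+ 2 / 2))%:E * (normal_pdf (s ^+ 2) s y)%:E +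
    (4 * expR (s ^+ 2 / 2))%:E * (normal_pdf (- s ^+ 2) s y)%:E)%E.
  apply/funext => y; rewrite /normal_dominant /= mulrDr mulrDl EFinD.
  have := expR_normal_pdf 1 y; have := expR_normal_pdf (-1) y.
  rewrite !mul1r !mulN1r sqrrN expr1n mul1r => E1 E2.
  by rewrite -!mulrA E1 E2 !mulrA -!EFinM.
by apply: integrableD => //; apply: integrableZl => //; exact: integrable_normal_pdf.
Qed.

Lemma normal_dominant_ge y : (1 + `|y|) ^+ 2 * p y <= normal_dominant y.
Proof.
rewrite /normal_dominant ler_wpM2r ?normal_pdf_ge0//.
(* [1 + |y| <= 2 * (1 + |y| / 2)]: squaring produces the factor 4 of the majorant. *)
have H : 1 + `|y| / 2 <= expR (`|y| / 2) by exact: expR_ge1Dx.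
have E : expR `|y| = expR (`|y| / 2) ^+ 2 by rewrite -expRM_natl; congr expR; field.
have A : expR `|y| <= expR y + expR (- y).
  have [y0|y0] := leP 0 y; first by rewrite ger0_norm// lerDl expR_ge0.
  by rewrite ltr0_norm// lerDr expR_ge0.
have z0 := normr_ge0 y; nra.
Qed.

Lemma normal_dominant_bounded :
  exists2 B, 0 <= B & forall y, normal_dominant y <= B.
Proof.
exists (8 * expR (s ^+ 2 / 2) * normal_peak s).
  by rewrite !mulr_ge0 ?expR_ge0 ?normal_peak_ge0.
move=> y; rewrite /normal_dominant.
have := expR_normal_pdf 1 y; have := expR_normal_pdf (-1) y.
rewrite !mul1r !mulN1r sqrrN expr1n mul1r => E1 E2.
rewrite mulrDr mulrDl -!(mulrA 4) E1 E2 -(mulrA 8).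
have := normal_pdf_ub (- s ^+ 2) y s0; have := normal_pdf_ub (s ^+ 2) y s0.
have := expR_gt0 (s ^+ 2 / 2); nra.
Qed.

(** [h y p - s^2 h' p] is the derivative of [- s^2 h p], which vanishes at infinity: the fundamental
    theorem of calculus on growing intervals, then dominated convergence. *)
Lemma stein_normal (h dh : R -> R) (C : R) :
  (forall y : R, is_derive y 1 h (dh y)) -> continuous dh ->
  (forall y, `|h y| <= C * (1 + `|y|)) -> (forall y, `|dh y| <= C) ->
  [/\ leb.-integrable setT (fun y => (h y * y * p y)%:E),
      leb.-integrable setT (fun y => (dh y * p y)%:E) &
      (\int[leb]_y (h y * y * p y) = s ^+ 2 * \int[leb]_y (dh y * p y))%R].
Proof.
move=> hP cdh hC dhC.
have C0 : 0 <= C by apply: le_trans (dhC 0).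
have ch : continuous h.
  by move=> y; apply/differentiable_continuous/derivable1_diffP; case: (hP y).
have cp : continuous p by exact: continuous_normal_pdf.
have p0 y : 0 <= p y by exact: normal_pdf_ge0.
pose G y : R := C * normal_dominant y.
have iG : leb.-integrable setT (EFin \o G).
  have -> : EFin \o G = (fun y => C%:E * (EFin \o normal_dominant) y)%E.
    by apply/funext => y; rewrite /= EFinM.
  by apply: integrableZl => //; exact: normal_dominant_integrable.
have dom y : (1 + `|y|) ^+ 2 * p y <= normal_dominant y.
  exact: normal_dominant_ge.
have le1 y : `|h y * y * p y| <= G y.
  rewrite !normrM (ger0_norm (p0 y)).
  apply: (@le_trans _ _ (C * (1 + `|y|) ^+ 2 * p y)); last first.
    by rewrite -mulrA ler_wpM2l.
  rewrite ler_wpM2r// expr2 mulrA ler_pM//.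
  by rewrite lerDr.
have le2 y : `|dh y * p y| <= G y.
  rewrite normrM (ger0_norm (p0 y)).
  apply: (@le_trans _ _ (C * (1 + `|y|) ^+ 2 * p y)); last first.
    by rewrite -mulrA ler_wpM2l.
  rewrite ler_wpM2r// (le_trans (dhC y))// ler_peMr//.
  by rewrite -[leLHS](expr1n _ 2) ler_pXn2r ?nnegrE ?addr_ge0// lerDl.
have c1 : continuous (fun y => h y * y * p y).
  by apply: continuous_fM => //; apply: continuous_fM => // y; exact: cvg_id.
have c2 : continuous (fun y => dh y * p y) by exact: continuous_fM.
have i1 : leb.-integrable setT (fun y => (h y * y * p y)%:E).
  apply: le_integrable iG => //.
    by apply/measurable_EFinP; exact: continuous_measurable_fun.
  by move=> y _ /=; rewrite lee_fin (le_trans (le1 y))// ler_norm.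
have i2 : leb.-integrable setT (fun y => (dh y * p y)%:E).
  apply: le_integrable iG => //.
    by apply/measurable_EFinP; exact: continuous_measurable_fun.
  by move=> y _ /=; rewrite lee_fin (le_trans (le2 y))// ler_norm.
split=> //.
pose k y := h y * y * p y - s ^+ 2 * (dh y * p y).
pose F y := - s ^+ 2 * (h y * p y).
have ck : continuous k.
  move=> y; apply: cvgB; first exact: c1.
  by apply: cvgMl_tmp; exact: c2.
have dF (y : R) : is_derive y 1 F (k y).
  have dp : is_derive y 1 p (- y / s ^+ 2 * p y).
    rewrite normal_pdfE// /normal_fun.
    have -> : (fun x : R => normal_peak s * expR (- (x - 0) ^+ 2 / (s ^+ 2 *+ 2)))
        = (fun x : R => normal_peak s * (expR \o
            (fun x => - (s ^+ 2 *+ 2)^-1 * x ^+ 2)) x).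
      by apply/funext => x /=; congr (_ * expR _); rewrite subr0 !mulNr (mulrC (x ^+ 2)).
    apply: is_derive_eq; rewrite /= ?scaler0 ?addr0 !subr0.
    rewrite /GRing.scale/= !mulr1.
    rewrite (_ : - y ^+ 2 / (s ^+ 2 *+ 2) = - (s ^+ 2 *+ 2)^-1 * y ^+ 2); last first.
      by rewrite !mulNr (mulrC (y ^+ 2)).
    by move: (expR _) (normal_peak s) => E P; rewrite -mulr_natr; field.
  rewrite /F; apply: is_derive_eq.
  by rewrite /k /GRing.scale/=; move: (p y) (h y) (dh y) => a b c; field.
have kint : (\int[leb]_y (k y) = \int[leb]_y (h y * y * p y) -
    s ^+ 2 * \int[leb]_y (dh y * p y))%R.
  rewrite RintegralB//; last first.
    have -> : EFin \o (fun x => s ^+ 2 * (dh x * p x)) =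
      (fun x => (s ^+ 2)%:E * (dh x * p x)%:E)%E by [].
    exact: integrableZl.
  by rewrite RintegralZl.
apply/eqP; rewrite -subr_eq0 -kint; apply/eqP.
have ik : leb.-integrable setT (EFin \o k).
  have -> : EFin \o k = ((fun y => (h y * y * p y)%:E) \-
      (fun y => (s ^+ 2)%:E * (dh y * p y)%:E))%E by [].
  by apply: integrableB => //; exact: integrableZl.
pose kn (n : nat) : R -> R := k \_ `[- n.+1%:R, n.+1%:R].
have knE n : (\int[leb]_y kn n y = F n.+1%:R - F (- n.+1%:R))%R.
  rewrite /kn -Rintegral_mkcond /Rintegral (@continuous_FTC2 _ _ F)//.
  - by rewrite (@lt_trans _ _ 0)// oppr_lt0.
  - exact: continuous_subspaceT.
  - have cF : continuous F.
      by move=> y; apply/differentiable_continuous/derivable1_diffP; case: (dF y).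
    split; first by move=> y _; case: (dF y).
      by apply: cvg_within_filter; exact: cF.
    by apply: cvg_within_filter; exact: cF.
  - by move=> y _; rewrite derive1E; case: (dF y).
have lim1 : (\int[leb]_y kn n y)%R @[n --> \oo] --> (\int[leb]_y k y)%R.
  apply: (@cvg_Rintegral _ _ R leb kn k (fun y => `|k y|)).
  - move=> n; apply/(measurable_restrictT _ _).1 => //.
    by apply: measurable_funTS; exact: continuous_measurable_fun.
  - exact: continuous_measurable_fun.
  - apply: aeW => y.
    apply: cvg_near_cst; near=> n; rewrite /kn patchE mem_set//=.
    rewrite in_itv/= -ler_norml ltW//.
    apply: lt_le_trans (truncnS_gt _) _; rewrite ler_nat ltnS.
    by near: n; exact: nbhs_infty_ge.
  - exact: integrable_norm.
  - by move=> n y; rewrite /kn patchE; case: ifP => // _; rewrite normr0.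
have [B B0 GB] := normal_dominant_bounded.
(* One factor [1 + |y|] of the bounded quantity [(1 + |y|) ^ 2 * p y] absorbs the growth of [h], the
   other gives the decay. *)
have Fle y : `|F y| <= s ^+ 2 * C * B * (1 + `|y|)^-1.
  have y1 : 0 < 1 + `|y| by rewrite ltr_pwDl.
  have A : `|h y * p y| * (1 + `|y|) <= C * B.
    rewrite normrM (ger0_norm (p0 y)).
    apply: (@le_trans _ _ (C * ((1 + `|y|) ^+ 2 * p y))); last first.
      by rewrite ler_wpM2l// (le_trans (dom y)).
    rewrite (_ : `|h y| * p y * (1 + `|y|) = `|h y| * ((1 + `|y|) * p y)); last by ring.
    rewrite (_ : C * _ = C * (1 + `|y|) * ((1 + `|y|) * p y)); last by ring.
    by rewrite ler_wpM2r// mulr_ge0// ltW.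
  rewrite -(ler_pM2r y1) mulfVK ?lt0r_neq0// /F normrM normrN.
  by rewrite (ger0_norm (sqr_ge0 s)) -mulrA -(mulrA _ C) ler_wpM2l ?sqr_ge0.
have F0 (u : nat -> R) : (forall n, `|u n| = n.+1%:R) ->
    F (u n) @[n --> \oo] --> (0 : R).
  move=> un.
  apply/norm_cvg0P; apply: (@squeeze_cvgr _ _ _ _ (fun=> 0)
      (fun n : nat => s ^+ 2 * C * B * n.+1%:R^-1)).
  - near=> n; rewrite normr_ge0/= (le_trans (Fle _))//.
    apply: ler_wpM2l; first by rewrite mulr_ge0// mulr_ge0 ?sqr_ge0.
    rewrite lef_pV2 ?posrE ?ltr_pwDl//.
    by rewrite un lerDr.
  - exact: cvg_cst.
  - rewrite -[X in _ --> X](mulr0 (s ^+ 2 * C * B)); apply: cvgMl_tmp.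
    exact: cvg_harmonic.
have lim2 : (\int[leb]_y kn n y)%R @[n --> \oo] --> (0 : R).
  rewrite (funext knE) -[X in _ --> X](subrr (0 : R)); apply: cvgB; apply: F0 => n.
    by rewrite normr_nat.
  by rewrite normrN normr_nat.
exact: (cvg_unique _ lim1 lim2).
Unshelve. all: by end_near. Qed.

End normal_moments.

(** Multiplication by the integrating factor [exp (a t^2 / 2)] leaves a function of zero
    derivative. *)
Lemma linear_ode (R : realType) (y : R -> R) (a t : R) :
  (forall t : R, is_derive t 1 y (- a * t * y t)) ->
  y t = y 0 * expR (- (a * t ^+ 2 / 2)).
Proof.
move=> dy; pose z (t : R) := y t * (expR \o (fun t => a / 2 * t ^+ 2)) t.
have dz (x : R) : is_derive x 1 z 0.
  rewrite /z; apply: is_derive_eq.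
  by rewrite /GRing.scale/= !mulr1; move: (expR _) (y x) => E Y; field.
have := is_derive_0_is_cst t 0 dz.
rewrite /z /= expr0n mulr0 expR0 mulr1 => <-.
by rewrite -mulrA -expRD (_ : _ + _ = 0) ?expR0 ?mulr1//; field.
Qed.

(** * Characteristic function and integration by parts of a Gaussian measure *)

Section gaussian_measure.
Context {R : realType} {X : completeNormedModType R}.
Variables (mu : probability (borel X) R) (Qoo : cdual X -> X).
Hypotheses (mu_gauss : centred_gaussian mu) (mu_cov : covariance_operator mu Qoo).
Implicit Types (f g : cdual X) (h dh : R -> R) (u w : X -> R).
Local Notation leb := (@lebesgue_measure R).
Local Notation "''E' u" := (Rintegral mu setT u) (at level 10, u at level 8).

Definition itg u := mu.-integrable setT (EFin \o (u : borel X -> R)).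

Lemma measurable_cdual f : measurable_fun setT (f : borel X -> R).
Proof. by apply: continuous_borel_measurable; exact: clin_continuous. Qed.

Lemma measurable_fun_cdual h f : continuous h ->
  measurable_fun setT (fun x : borel X => h (f x)).
Proof.
move=> ch; apply: (measurableT_comp (f := h)); last exact: measurable_cdual.
exact: continuous_measurable_fun.
Qed.

Lemma itg_le u w : measurable_fun setT (u : borel X -> R) ->
  (forall x, `|u x| <= w x) -> itg w -> itg u.
Proof.
move=> mf H; apply: le_integrable => //; first exact/measurable_EFinP.
by move=> x _ /=; rewrite lee_fin (le_trans (H x))// ler_norm.
Qed.

Lemma itg_cst (c : R) : itg (fun=> c).
Proof. exact: finite_measure_integrable_cst. Qed.

Lemma E_cst (c : R) : 'E (fun=> c) = c.
Proof.
rewrite /Rintegral integral_cst//.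
transitivity (fine (c%:E * 1)%E); last by rewrite mule1.
by congr (fine (_ * _)%E); exact: probability_setT.
Qed.

Lemma itg_bounded u M : measurable_fun setT (u : borel X -> R) ->
  (forall x, `|u x| <= M) -> itg u.
Proof. by move=> mu_ H; apply: (itg_le mu_ H); exact: itg_cst. Qed.

Lemma itgD u w : itg u -> itg w -> itg (fun x => u x + w x).
Proof. by move=> iu iw; apply: (integrableD _ iu iw). Qed.

Lemma itgZ (c : R) u : itg u -> itg (fun x => c * u x).
Proof. by move=> iu; apply: (integrableZl _ c iu). Qed.

Lemma itgB u w : itg u -> itg w -> itg (fun x => u x - w x).
Proof. by move=> iu iw; apply: (integrableB _ iu iw). Qed.

Lemma itg_norm u : itg u -> itg (fun x => `|u x|).
Proof. exact: integrable_norm. Qed.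

Lemma itgM_bounded u w M : itg u -> measurable_fun setT (w : borel X -> R) ->
  (forall x, `|w x| <= M) -> itg (fun x => u x * w x).
Proof.
move=> iu mw H.
have mu_ : measurable_fun setT (u : borel X -> R).
  by apply/measurable_EFinP; exact: measurable_int iu.
apply: (@itg_le _ (fun x => M * `|u x|)).
- exact: measurable_funM.
- by move=> x; rewrite normrM mulrC ler_wpM2r.
- by apply: itgZ; exact: itg_norm.
Qed.

Lemma law_ge0_integral f s h : centred_normal_law mu f s -> s != 0 ->
  continuous h -> (forall y, 0 <= h y) ->
  (\int[mu]_x (h (f x))%:E = \int[leb]_y (h y * normal_pdf 0 s y)%:E)%E.
Proof.
move=> fs s0 ch h0.
have mh : measurable_fun setT h by exact: continuous_measurable_fun.
have := @ge0_integral_pushforward _ _ (borel X) (measurableTypeR R) R f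
  (measurable_cdual f) mu setT (EFin \o h) measurableT ((measurable_EFinP _ _).2 mh)
  (fun y _ => h0 y : (0 <= (h y)%:E)%E).
rewrite preimage_setT => <-.
transitivity (\int[normal_prob 0 s]_y (EFin \o h) y)%E.
  apply: eq_measure_integral => [|mf A mA _]; first exact: measurable_cdual.
  have := fs A mA.
  by rewrite (negbTE s0).
rewrite (@ge0_integral_density _ _ R leb (normal_prob 0 s) (normal_pdf 0 s))//.
- exact: measurable_normal_pdf.
- by move=> y; exact: normal_pdf_ge0.
- exact/measurable_EFinP.
Qed.

Lemma law_integral f s h : centred_normal_law mu f s -> s != 0 ->
  continuous h -> leb.-integrable setT (fun y => (h y * normal_pdf 0 s y)%:E) ->
  itg (fun x => h (f x)) /\ 'E (fun x => h (f x)) = \int[leb]_y (h y * normal_pdf 0 s y).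
Proof.
move=> fs s0 ch ih.
have mh : measurable_fun setT h by exact: continuous_measurable_fun.
have mhf := measurable_fun_cdual f ch.
have ihf : itg (fun x => h (f x)).
  apply/integrableP; split; first exact/measurable_EFinP.
  move/integrableP : ih => [_]; apply: le_lt_trans.
  have /= -> := law_ge0_integral fs s0
    (h := fun y => `|h y|) (fun y => cvg_norm (ch y)) (fun y => normr_ge0 (h y)).
  rewrite le_eqVlt; apply/orP; left; apply/eqP.
  by apply: eq_integral => y _; rewrite normrM (ger0_norm (normal_pdf_ge0 _ _ _)).
split=> //.
have := @integral_pushforward _ _ (borel X) (measurableTypeR R) R f
  (measurable_cdual f) mu setT (EFin \o h) ((measurable_EFinP _ _).2 mh).
rewrite preimage_setT => /(_ ihf measurableT) E.
rewrite /Rintegral -[X in fine X = _]E; congr fine.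
transitivity (\int[normal_prob 0 s]_y (EFin \o h) y)%E.
  apply: eq_measure_integral => [|mf A mA _]; first exact: measurable_cdual.
  have := fs A mA.
  by rewrite (negbTE s0).
have [|_ ->] := (@integrable_density _ _ R leb (normal_prob 0 s) (normal_pdf 0 s)
  (measurable_normal_pdf 0 s) (normal_pdf_ge0 0 s) _ h mh ih) => //.
Qed.

Lemma law0_ae f : centred_normal_law mu f 0 -> {ae mu, forall x : borel X, f x = 0}.
Proof.
move=> f0; exists [set x | (~` [set 0 : R]) (f x)]; split.
- rewrite -[X in measurable X]setTI; apply: measurable_cdual => //.
  by apply: measurableC; exact: measurable_set1.
- have /f0 -> : measurable (~` [set 0 : R]).
    by apply: measurableC; exact: measurable_set1.
  by rewrite eqxx diracE memNset// => /(_ erefl).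
- by [].
Qed.

(** When [s = 0] the law is a Dirac mass, so [f] vanishes almost everywhere and both sides are 0;
    otherwise the identity is transported from the line. *)
Lemma gauss_stein0 f s h dh (C : R) : centred_normal_law mu f s ->
  (forall y : R, is_derive y 1 h (dh y)) -> continuous dh ->
  (forall y, `|h y| <= C * (1 + `|y|)) -> (forall y, `|dh y| <= C) ->
  'E (fun x => h (f x) * f x) = s ^+ 2 * 'E (fun x => dh (f x)).
Proof.
move=> fs hP cdh hC dhC.
have ch : continuous h.
  by move=> y; apply/differentiable_continuous/derivable1_diffP; case: (hP y).
have chy : continuous (fun y => h y * y) by apply: continuous_fM => // y; exact: cvg_id.
have [s0|s0] := eqVneq s 0.
  rewrite s0 expr0n mul0r /Rintegral (@ae_eq_integral _ _ _ mu setT (cst 0%E))//.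
  - by rewrite integral0.
  - by apply/measurable_EFinP; exact: (measurable_fun_cdual f chy).
  - have := law0_ae (f := f); rewrite -s0 => /(_ fs).
    by apply: filterS => x fx _ /=; rewrite fx s0 mulr0.
have [i1 i2 E] := stein_normal s0 hP cdh hC dhC.
have [_ ->] := law_integral fs s0 chy i1.
by have [_ ->] := law_integral fs s0 cdh i2.
Qed.

Lemma cov_itg f g : itg (fun x => (f x : R) * g x).
Proof. by have [] := mu_cov f g. Qed.

Lemma covE f g : 'E (fun x => (f x : R) * g x) = g (Qoo f).
Proof. by have [_] := mu_cov f g; rewrite /Rintegral => ->. Qed.

Lemma covC f g : g (Qoo f) = f (Qoo g) :> R.
Proof.
by rewrite -!covE; apply: eq_Rintegral => x _; rewrite mulrC.
Qed.

(** Stein's identity for the identity function. The parameter of the law is thereby read off from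
    [Qoo], in terms of which the later formulas are stated. *)
Lemma law_variance f s : centred_normal_law mu f s -> s ^+ 2 = f (Qoo f).
Proof.
move=> fs; rewrite -covE.
have := @gauss_stein0 f s id (cst 1) 1 fs.
rewrite /= => ->.
- by rewrite (E_cst 1) mulr1.
- by move=> y; exact: cvg_cst.
- by move=> y; rewrite mul1r lerDr.
- by move=> y; rewrite normr1.
Qed.

Lemma gauss_stein f h dh (C : R) :
  (forall y : R, is_derive y 1 h (dh y)) -> continuous dh ->
  (forall y, `|h y| <= C * (1 + `|y|)) -> (forall y, `|dh y| <= C) ->
  'E (fun x => h (f x) * f x) = f (Qoo f) * 'E (fun x => dh (f x)).
Proof.
by have [s fs] := mu_gauss f; rewrite -(law_variance fs); exact: gauss_stein0.
Qed.

Lemma itg_expR f : itg (fun x => expR (f x)).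
Proof.
have [s fs] := mu_gauss f; have [s0|s0] := eqVneq s 0.
  apply/integrableP; split.
    by apply/measurable_EFinP; exact: (measurable_fun_cdual f (@continuous_expR R)).
  rewrite (@ae_eq_integral _ _ _ mu setT (cst 1%E))//.
  - have -> : (\int[mu]_x (cst 1 x : \bar R) = 1)%E.
      by rewrite integral_cst// mul1e; exact: (probability_setT mu).
    exact: ltry.
  - apply/measurable_EFinP; apply: measurableT_comp => //.
    exact: (measurable_fun_cdual f (@continuous_expR R)).
  - have := law0_ae (f := f); rewrite -s0 => /(_ fs).
    by apply: filterS => x fx _ /=; rewrite fx s0 expR0 normr1.
apply: (law_integral fs s0 (@continuous_expR R) _).1.
apply/integrableP; split.
  apply/measurable_EFinP; apply: continuous_measurable_fun; apply: continuous_fM.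
    exact: continuous_expR.
  exact: continuous_normal_pdf.
under eq_integral => y _.
  rewrite /= ger0_norm ?mulr_ge0 ?expR_ge0 ?normal_pdf_ge0//.
  rewrite -[X in expR X]mul1r. over.
by rewrite expR_normal_integral// ltry.
Qed.

Lemma itg_cdual f : itg f.
Proof.
apply: (@itg_le _ (fun x => 1 + (f x : R) * f x)).
- exact: measurable_cdual.
- move=> x; set y : R := f x; have := normr_ge0 y.
  have : `|y| ^+ 2 = y * y by rewrite real_normK ?num_real// expr2.
  by nra.
- by apply: itgD; [exact: itg_cst|exact: cov_itg].
Qed.

(** Differentiation under the integral sign; [|f|] dominates because [|dh| <= 1], and it is
    integrable by the finiteness of the variance. *)
Lemma E_derive (h dh : R -> R) (a : X -> R) (f : cdual X) (t : R) :
  (forall y : R, is_derive y 1 h (dh y)) -> continuous dh ->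
  (forall y, `|h y| <= 1) -> (forall y, `|dh y| <= 1) ->
  continuous a ->
  is_derive t 1 (fun r : R => 'E (fun x => h (a x + r * f x)))
    ('E (fun x => dh (a x + t * f x) * f x)).
Proof.
move=> hP cdh h1 dh1 ca.
have ch : continuous h.
  by move=> y; apply/differentiable_continuous/derivable1_diffP; case: (hP y).
have caf (r : R) : continuous (fun x => a x + r * f x).
  apply: continuous_fD => //; apply: continuous_fM; first exact: continuous_fcst.
  exact: clin_continuous.
have der (r : R) (x : X) : is_derive r 1 (fun r : R => h (a x + r * f x)) (dh (a x + r * f x) * f x).
  have : is_derive r 1 (fun r : R => a x + r * (f x : R)) (f x).
    by apply: is_derive_eq; rewrite scaler0 !add0r mul1r [_%:A]mulr1.
  move=> ?; apply: (@is_derive1_comp _ h (fun r => a x + r * (f x : R))).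
have d1E r x : partial1of2 (fun r x => h (a x + r * f x)) r x = dh (a x + r * f x) * f x.
  by rewrite partial1of2E; case: (der r x).
have ub : itg (fun x => `|f x : R|) by exact: itg_norm (itg_cdual f).
have tI : `]t - 1, t + 1[%classic t.
  by rewrite /= in_itv/=; apply/andP; split; lra.
have H := @cvg_differentiation_under_integral R _ (borel X) mu
  (fun r x => h (a x + r * f x)) setT measurableT t (t - 1) (t + 1) tI _ _
  (fun x => `|f x : R|) _ ub _.
have cvgE : h0^-1 *: ('E (fun x => h (a x + (h0 + t) * f x)) -
     'E (fun x => h (a x + t * f x))) @[h0 --> (0 : R)^'] -->
    'E (fun x => dh (a x + t * f x) * f x).
  under [X in _ --> X]eq_Rintegral do rewrite -d1E.
  apply: H => //.
  - move=> r _; apply: (@itg_bounded _ 1) => //.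
    apply: continuous_borel_measurable.
    exact: continuous_fcomp (caf r) ch.
  - by move=> r x _ _; rewrite d1E normrM ler_piMl.
split.
  apply/cvg_ex; exists ('E (fun x => dh (a x + t * f x) * f x)).
  by under eq_fun do rewrite [_%:A]mulr1.
apply/cvg_lim => //; by under eq_fun do rewrite [_%:A]mulr1.
Qed.

(** Sine and cosine are treated together, as solutions of [h'' = - h]. Stein's identity turns the
    derivative of [t -> E h (t f)] into [- f (Qoo f) * t] times the function itself, a linear
    equation that determines it; [t = 1] gives the real or imaginary part of the characteristic
    function. *)
Lemma E_harmonic (h dh : R -> R) f :
  (forall y : R, is_derive y 1 h (dh y)) ->
  (forall y : R, is_derive y 1 dh (- h y)) ->
  (forall y, `|h y| <= 1) -> (forall y, `|dh y| <= 1) ->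
  'E (fun x => h (f x)) = h 0 * expR (- (f (Qoo f) / 2)).
Proof.
move=> hP dhP h1 dh1.
have ch : continuous h.
  by move=> y; apply/differentiable_continuous/derivable1_diffP; case: (hP y).
have cdh : continuous dh.
  by move=> y; apply/differentiable_continuous/derivable1_diffP; case: (dhP y).
have c0 : continuous (fun _ : X => 0 : R) by exact: continuous_fcst.
pose y (t : R) := 'E (fun x => h (0 + t * (f x : R))).
have dy (t : R) : is_derive t 1 y (- (f (Qoo f) : R) * t * y t).
  apply: (is_derive_eq (E_derive f t hP cdh h1 dh1 c0)).
  have ct : continuous (fun z : R => t * z) by exact: mulrl_continuous.
  have cht : continuous (fun z : R => h (t * z)) by exact: continuous_fcomp ct ch.
  have d (z : R) : is_derive z 1 (fun z => dh (t * z)) (- h (t * z) * t).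
    apply: (@is_derive1_comp _ dh (fun z => t * z)).
    by rewrite -[X in is_derive _ _ _ X]mulr1; exact: is_deriveZ.
  under eq_Rintegral do rewrite add0r.
  rewrite (gauss_stein f (h := fun z => dh (t * z)) (C := 1 + `|t|) d).
  - rewrite RintegralZr//; last first.
      apply: (@itg_bounded _ 1) => [|x]; last by rewrite normrN.
      apply: (measurable_fun_cdual f (h := fun z => - h (t * z))).
      by move=> z; apply: cvgN; exact: cht.
    rewrite /y; under [in RHS]eq_Rintegral do rewrite add0r.
    under [in LHS]eq_Rintegral do rewrite -mulN1r.
    rewrite RintegralZl//; first by ring.
    apply: (@itg_bounded _ 1) => //.
    exact: (measurable_fun_cdual f (h := fun z => h (t * z))).
  - apply: continuous_fM; last exact: continuous_fcst.
    by move=> z; apply: cvgN; exact: cht.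
  - move=> z; have := dh1 (t * z).
    have := normr_ge0 t; have := normr_ge0 z; nra.
  - move=> z; rewrite normrM normrN.
    by have := h1 (t * z); have := normr_ge0 t; nra.
have := linear_ode 1 dy.
rewrite /y; under eq_Rintegral do rewrite add0r mul1r.
move=> ->; under eq_Rintegral do rewrite add0r mul0r.
by rewrite E_cst expr1n mulr1.
Qed.

Lemma is_deriveNsin (y : R) : is_derive y 1 (fun y => - sin y) (- cos y).
Proof. exact: is_deriveN. Qed.

Lemma E_cos f : 'E (fun x => cos (f x)) = expR (- (f (Qoo f) / 2)).
Proof.
rewrite (E_harmonic f (@is_derive_cos R) is_deriveNsin) ?cos0 ?mul1r// => y.
  by rewrite ler_norml cos_geN1 cos_le1.
by rewrite normrN ler_norml sin_geN1 sin_le1.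
Qed.

Lemma E_sin f : 'E (fun x => sin (f x)) = 0.
Proof.
rewrite (E_harmonic f (@is_derive_sin R) (@is_derive_cos R)) ?sin0 ?mul0r// => y.
  by rewrite ler_norml sin_geN1 sin_le1.
by rewrite ler_norml cos_geN1 cos_le1.
Qed.

Lemma cov_expand f g (r : R) :
  (f + r *: g) (Qoo (f + r *: g)) =
  f (Qoo f) + 2 * r * f (Qoo g) + r ^+ 2 * g (Qoo g) :> R.
Proof.
have E1 (k1 k2 k : cdual X) : (k1 + r *: k2) (Qoo k) = k1 (Qoo k) + r * k2 (Qoo k) :> R by [].
rewrite E1 (covC _ f) (covC _ g) !E1 (covC f g).
by ring.
Qed.

(** Both sides are the derivative at [r = 0] of [E h (f + r g)], computed once under the integral
    and once from the closed form of [E_harmonic]. *)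
Lemma E_harmonicM (h dh : R -> R) f g :
  (forall y : R, is_derive y 1 h (dh y)) ->
  (forall y : R, is_derive y 1 dh (- h y)) ->
  (forall y, `|h y| <= 1) -> (forall y, `|dh y| <= 1) ->
  'E (fun x => dh (f x) * g x) = - h 0 * f (Qoo g) * expR (- (f (Qoo f) / 2)).
Proof.
move=> hP dhP h1 dh1.
have cdh : continuous dh.
  by move=> y; apply/differentiable_continuous/derivable1_diffP; case: (dhP y).
have d1 := E_derive g 0 hP cdh h1 dh1 (@clin_continuous R X R^o f).
have E : (fun r : R => 'E (fun x => h ((f x : R) + r * g x))) =
    (fun r : R => h 0 * (expR \o (fun r : R => - (f (Qoo f) / 2) +
      - (f (Qoo g) : R) * r + - (g (Qoo g) / 2) * r ^+ 2)) r).
  apply/funext => r.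
  rewrite (_ : 'E _ = 'E (fun x => h ((f + r *: g) x)))//.
  rewrite (E_harmonic (f + r *: g) hP dhP h1 dh1) cov_expand /=.
  by congr (_ * expR _); field.
have d2 : is_derive (0 : R) 1 (fun r : R => 'E (fun x => h ((f x : R) + r * g x)))
    (- h 0 * f (Qoo g) * expR (- (f (Qoo f) / 2))).
  rewrite E; apply: is_derive_eq.
  rewrite /GRing.scale/= expr0n !(mulr0, mul0r, addr0, add0r, mulr1).
  by ring.
have -> : 'E (fun x => dh (f x) * g x) = 'E (fun x => dh ((f x : R) + 0 * g x) * g x).
  by apply: eq_Rintegral => x _; rewrite mul0r addr0.
by case: d1 => _ <-; case: d2 => _ <-.
Qed.

(** Translation only shifts the phase of a cosine, so everything is explicit through [E_cos],
    [E_sin] and [E_harmonicM]. The derivative [gam] contains [u] undifferentiated, which is what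
    survives uniform approximation. *)
Lemma trig_translate u g (v := Qoo g) : trig u ->
  exists psi gam : R -> R,
   [/\ forall t : R, is_derive t 1 psi (gam t),
       forall t, psi t = 'E (fun x => u (x + t *: v)) &
       forall t, gam t = 'E (fun x => u (x + t *: v) * g x)].
Proof.
have itgM w : trig w -> forall t, itg (fun x => w (x + t *: v)) /\
    itg (fun x => w (x + t *: v) * g x).
  move=> tw t; have [M M0 MP] := trig_bounded tw.
  have mw := continuous_borel_measurable (trig_continuous (trig_shift (t *: v) tw)).
  split; first by apply: (@itg_bounded _ M).
  have := itgM_bounded (itg_cdual g) mw (fun x => MP (x + t *: v)).
  by apply: eq_integrable => // x _; rewrite /= mulrC.
elim=> [f c|w1 w2 t1 [p1 [g1 [d1 P1 G1]]] t2 [p2 [g2 [d2 P2 G2]]]|a w tw [p [q [d P G]]]].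
- pose e := expR (- (f (Qoo f) / 2)).
  exists (fun t => cos (t * f v + c) * e), (fun t => - sin (t * f v + c) * f v * e).
  have bc (y : R) : `|cos y| <= 1 by rewrite ler_norml cos_geN1 cos_le1.
  have bs (y : R) : `|sin y| <= 1 by rewrite ler_norml sin_geN1 sin_le1.
  have bNs (y : R) : `|- sin y| <= 1 by rewrite normrN.
  have mc := measurable_fun_cdual f (@continuous_cos R).
  have ms := measurable_fun_cdual f (@continuous_sin R).
  have ic : itg (fun x => cos (f x)) by exact: (@itg_bounded _ 1).
  have is_ : itg (fun x => sin (f x)) by exact: (@itg_bounded _ 1).
  have icg : itg (fun x => cos (f x) * g x).
    have := itgM_bounded (itg_cdual g) mc (fun x => bc (f x)).
    by apply: eq_integrable => // x _; rewrite /= mulrC.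
  have isg : itg (fun x => sin (f x) * g x).
    have := itgM_bounded (itg_cdual g) ms (fun x => bs (f x)).
    by apply: eq_integrable => // x _; rewrite /= mulrC.
  have shiftE t x : cos ((f (x + t *: v) : R) + c) =
      cos (t * f v + c) * cos (f x) - sin (t * f v + c) * sin (f x).
    have -> : (f (x + t *: v) : R) = f x + t * f v by rewrite linearD linearZ.
    by rewrite -cosD; congr cos; ring.
  split=> [t|t|t].
  + apply: is_derive_eq.
    rewrite /GRing.scale/= !(mulr0, mul0r, addr0, add0r, mulr1).
    by ring.
  + under eq_Rintegral do rewrite shiftE.
    rewrite RintegralB//; [|exact: itgZ|exact: itgZ].
    by rewrite !RintegralZl// E_cos E_sin mulr0 subr0.
  + under eq_Rintegral do rewrite shiftE mulrBl -!mulrA.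
    rewrite RintegralB//; [|exact: itgZ|exact: itgZ].
    rewrite !RintegralZl//.
    have -> : 'E (fun x => cos (f x) * g x) = 0.
      rewrite (E_harmonicM f g (@is_derive_sin R) (@is_derive_cos R) bs bc).
      by rewrite sin0 oppr0 !mul0r.
    have -> : 'E (fun x => sin (f x) * g x) = f v * e.
      have := E_harmonicM f g (@is_derive_cos R) is_deriveNsin bc bNs.
      have -> : (fun x => - sin (f x) * g x) = (fun x => -1 * (sin (f x) * g x)).
        by apply/funext => x; rewrite mulN1r mulNr.
      by rewrite RintegralZl// cos0 => /eqP; rewrite mulN1r eqr_oppLR => /eqP ->; rewrite /v /e; ring.
    by rewrite mulr0 sub0r; ring.
- exists (fun t => p1 t + p2 t), (fun t => g1 t + g2 t); split=> t.
  + exact: is_deriveD.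
  + by rewrite P1 P2 RintegralD//; [case: (itgM _ t1 t)|case: (itgM _ t2 t)].
  + rewrite G1 G2 -RintegralD//; [|by case: (itgM _ t1 t)|by case: (itgM _ t2 t)].
    by apply: eq_Rintegral => x _; rewrite mulrDl.
- exists (fun t => a * p t), (fun t => a * q t); split=> t.
  + exact: is_deriveZ.
  + by rewrite P RintegralZl//; case: (itgM _ tw t).
  + rewrite G -RintegralZl//; last by case: (itgM _ tw t).
    by apply: eq_Rintegral => x _; rewrite mulrA.
Qed.

Lemma E_dist u w (b : X -> R) : itg u -> itg w -> itg b ->
  (forall x, `|u x - w x| <= b x) -> `|'E u - 'E w| <= 'E b.
Proof.
move=> iu iw ib H; rewrite -RintegralB//.
have iuw := itgB iu iw.
rewrite (le_trans (le_normr_Rintegral _ iuw))//.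
by apply: le_Rintegral => //; exact: itg_norm.
Qed.

(** A second order estimate that mentions no derivative of [u]. For a trigonometric approximation it
    follows from the mean value theorem, since [gam] varies over [[0, t]] by at most [L * t * E |g|]
    up to the error of approximation, which is then sent to 0. *)
Lemma utrig_increment u g (L t : R) (v := Qoo g) : utrig u -> continuous u ->
  0 <= L -> (forall x s, 0 <= s -> `|u (x + s *: v) - u x| <= L * s) -> 0 <= t ->
  `|'E (fun x => u (x + t *: v)) - 'E u - t * 'E (fun x => u x * g x)| <=
    L * t ^+ 2 * 'E (fun x => `|g x : R|).
Proof.
move=> uu cu L0 uL t0; set G := 'E (fun x => `|g x : R|).
have iG : itg (fun x => `|g x : R|) by exact: itg_norm (itg_cdual g).
have G0 : 0 <= G by apply: Rintegral_ge0.
apply/ler_addgt0Pr => e e0.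
have D0 : 0 < 2 + 3 * t * G + 1 by rewrite ltr_wpDl// addr_ge0// !mulr_ge0.
(* Replacing [u] by its approximation costs [d] in each of two expectations and [3 * d * G] in the
   slope, hence [2 + 3 * t * G] times [d] in all. *)
pose d := e / (2 + 3 * t * G + 1).
have d0 : 0 < d by rewrite divr_gt0.
have [w tw uw] := uu d d0.
have [psi [gam [dpsi psiE gamE]]] := trig_translate g tw.
have [M M0 MP] := trig_bounded tw.
have uM x : `|u x| <= d + M.
  by rewrite -(subrK (w x) (u x)) (le_trans (ler_normD _ _))// lerD.
have cT s : continuous (fun x : X => x + s *: v).
  by apply: continuous_fD; [move=> x; exact: cvg_id|exact: continuous_fcst].
have mu_ s : measurable_fun setT (fun x : borel X => u (x + s *: v)).
  by apply: continuous_borel_measurable; exact: continuous_fcomp (cT s) cu.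
have mw s : measurable_fun setT (fun x : borel X => w (x + s *: v)).
  by apply: continuous_borel_measurable; exact: trig_continuous (trig_shift _ tw).
have iu s : itg (fun x => u (x + s *: v)) by exact: itg_bounded (mu_ s) (fun=> uM _).
have iw s : itg (fun x => w (x + s *: v)) by exact: itg_bounded (mw s) (fun=> MP _).
have iug s : itg (fun x => u (x + s *: v) * g x).
  have := itgM_bounded (itg_cdual g) (mu_ s) (fun x => uM (x + s *: v)).
  by apply: eq_integrable => // x _; rewrite /= mulrC.
have iwg s : itg (fun x => w (x + s *: v) * g x).
  have := itgM_bounded (itg_cdual g) (mw s) (fun x => MP (x + s *: v)).
  by apply: eq_integrable => // x _; rewrite /= mulrC.
have id (c : R) : itg (fun=> c) by exact: itg_cst.
have igG (c : R) : itg (fun x => c * `|g x : R|) by exact: itgZ.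
have A s : `|'E (fun x => u (x + s *: v)) - psi s| <= d.
  rewrite psiE -[leRHS]E_cst; apply: E_dist => // x; exact: uw.
have B s : `|'E (fun x => u (x + s *: v) * g x) - gam s| <= d * G.
  rewrite gamE /G -RintegralZl//; apply: E_dist => // x.
  by rewrite -mulrBl normrM ler_wpM2r.
have C s : 0 <= s -> `|gam s - gam 0| <= (L * s + 2 * d) * G.
  move=> s0; rewrite !gamE /G -RintegralZl//; apply: E_dist => // x.
  rewrite scale0r addr0 -mulrBl normrM ler_wpM2r//.
  have := uw (x + s *: v); have := uw x; have := uL x s s0.
  rewrite !ler_norml => /andP[? ?] /andP[? ?] /andP[? ?].
  by apply/andP; split; lra.
have cpsi : continuous psi.
  by move=> y; apply/differentiable_continuous/derivable1_diffP; case: (dpsi y).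
have [s st E] := MVT_segment t0 (fun y _ => dpsi y) (continuous_subspaceT cpsi).
move: st; rewrite in_itv/= => /andP[s0 st].
have := A t; have := A 0; have := B 0; have := C s s0.
rewrite scale0r; under [X in _ -> `|X - _| <= _ -> _]eq_Rintegral do rewrite addr0.
under [X in _ -> _ -> `|X - _| <= _ -> _]eq_Rintegral do rewrite addr0.
move: E; rewrite subr0.
set u0 := 'E u; set ug := 'E _; set ut := 'E _.
move=> E HC HB HA0 HAt.
have ed : e = d * (2 + 3 * t * G + 1) by rewrite /d mulfVK// lt0r_neq0.
have -> : ut - u0 - t * ug = (ut - psi t) - (u0 - psi 0) +
    t * ((gam s - gam 0) - (ug - gam 0)).
  by rewrite -(subrK (psi 0) (psi t)) E; ring.
rewrite (le_trans (ler_normD _ _))//.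
have H1 : `|ut - psi t - (u0 - psi 0)| <= d + d.
  by rewrite (le_trans (ler_normB _ _))// lerD.
have H2 : `|t * ((gam s - gam 0) - (ug - gam 0))| <=
    t * ((L * t + 2 * d) * G + d * G).
  rewrite normrM ger0_norm// ler_wpM2l// (le_trans (ler_normB _ _))// lerD//.
  by rewrite (le_trans HC)// ler_wpM2r// lerD2r ler_wpM2l.
apply: (le_trans (lerD H1 H2)); rewrite ed.
have : 0 <= d by rewrite ltW.
nra.
Qed.

Lemma cvg_mul_sin (a : R) :
  n.+1%:R * sin (a / n.+1%:R) @[n --> \oo] --> a.
Proof.
have d : is_derive (0 : R) 1 (fun r => sin (a * r)) (cos (a * 0) * a).
  apply: (@is_derive1_comp _ sin ( *%R a)).
  by rewrite -[X in is_derive _ _ _ X]mulr1; exact: is_deriveZ.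
case: d => /cvg_ex[l cl]; rewrite /derive (cvg_lim _ cl)// => lE.
move: cl; rewrite lE mulr0 cos0 mul1r => /cvgr_dnbhsP H.
have n0 n : (n.+1%:R^-1 : R) != 0 by rewrite invr_eq0 pnatr_eq0.
move: (H (fun n => n.+1%:R^-1) (conj n0 cvg_harmonic)); apply: cvg_trans.
apply: near_eq_cvg; apply: nearW => n /=.
by rewrite invrK addr0 sin0 subr0 [_%:A]mulr1.
Qed.

(** The estimate for [n * sin (t / n)] in place of the coordinates [t] is uniform in [n], because
    this substitution does not increase Lipschitz constants; dominated convergence then removes
    it. *)
Lemma lipschitz_increment n (phi : 'rV[R]_n -> R) (L M t : R)
    (xs : 'I_n -> cdual X) g (v := Qoo g) (u := fun x => phi (coords xs x)) :
  continuous phi -> 0 <= L ->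
  (forall y z, `|phi y - phi z| <= L * \sum_j `|y 0 j - z 0 j|) ->
  (forall y, `|phi y| <= M) -> 0 <= t ->
  `|'E (fun x => u (x + t *: v)) - 'E u - t * 'E (fun x => u x * g x)| <=
    L * (\sum_j `|xs j v : R|) * t ^+ 2 * 'E (fun x => `|g x : R|).
Proof.
move=> cphi L0 phiL phiM t0.
pose sn k (y : 'rV[R]_n) : 'rV[R]_n := \row_j (k.+1%:R * sin (y 0 j / k.+1%:R)).
pose un k (x : X) := phi (sn k (coords xs x)).
have unE k x : un k x = phi (\row_j (k.+1%:R * sin ((xs j x : R) / k.+1%:R))).
  by congr phi; apply/rowP => j; rewrite !mxE.
have cvn x : un k x @[k --> \oo] --> u x.
  apply: continuous_cvg; first exact: cphi.
  apply: cvg_rV => j; under eq_fun do rewrite mxE.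
  exact: cvg_mul_sin.
have cc : continuous (coords xs) by exact: coords_continuous.
have csn k : continuous (sn k).
  apply: continuous_rV => j; under eq_fun do rewrite mxE.
  apply: continuous_fM; first exact: continuous_fcst.
  apply: (@continuous_fcomp R _ R (fun y : 'rV[R]_n => y 0 j / k.+1%:R) sin).
    by apply: continuous_fM; [exact: coord_continuous|exact: continuous_fcst].
  exact: continuous_sin.
have cun k : continuous (un k).
  exact: continuous_fcomp (continuous_fcomp cc (csn k)) cphi.
have cu : continuous u by exact: continuous_fcomp cc cphi.
have cT s : continuous (fun x : X => x + s *: v).
  by apply: continuous_fD; [move=> x; exact: cvg_id|exact: continuous_fcst].
have sin_lip (a b : R) : `|sin a - sin b| <= `|a - b|.
  wlog ab : a b / b <= a.
    move=> H; have [|/ltW] := leP b a; first exact: H.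
    by move=> /H; rewrite distrC (distrC b).
  have [c _ ->] := MVT_segment ab (fun y _ => @is_derive_sin R y)
     (continuous_subspaceT (@continuous_sin R)).
  by rewrite normrM ler_piMl// ler_norml cos_geN1 cos_le1.
have step k : `|'E (fun x => un k (x + t *: v)) - 'E (un k) -
      t * 'E (fun x => un k x * g x)| <=
    L * (\sum_j `|xs j v : R|) * t ^+ 2 * 'E (fun x => `|g x : R|).
  apply: utrig_increment => //.
  - have := @utrig_sin R X n phi L k.+1%:R xs L0 (ltr0Sn _ _) phiL.
    by rewrite -(funext (unE k)).
  - by rewrite mulr_ge0// sumr_ge0.
  - move=> x s s0; rewrite (le_trans (phiL _ _))// -mulrA ler_wpM2l// mulr_suml.
    apply: ler_sum => j _; rewrite !mxE -mulrBr normrM.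
    apply: (le_trans (ler_wpM2l _ (sin_lip _ _))) => //.
    rewrite -normrM mulrBr ![k.+1%:R * _]mulrC !mulfVK ?pnatr_eq0//.
    by rewrite linearD linearZ/= addrAC subrr add0r normrM ger0_norm// mulrC.
have lim1 s : 'E (fun x => un k (x + s *: v)) @[k --> \oo] -->
    'E (fun x => u (x + s *: v)).
  apply: (@cvg_Rintegral _ _ R mu _ _ (fun=> M)).
  - move=> k; apply: continuous_borel_measurable.
    exact: continuous_fcomp (cT s) (cun k).
  - by apply: continuous_borel_measurable; exact: continuous_fcomp (cT s) cu.
  - by apply: aeW => x; exact: cvn.
  - exact: itg_cst.
  - by move=> k x; exact: phiM.
have lim2 : 'E (fun x => un k x * g x) @[k --> \oo] --> 'E (fun x => u x * g x).
  have mg := measurable_cdual g.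
  apply: (@cvg_Rintegral _ _ R mu _ _ (fun x => M * `|g x : R|)).
  - by move=> k; apply: measurable_funM => //; exact: continuous_borel_measurable.
  - by apply: measurable_funM => //; exact: continuous_borel_measurable.
  - by apply: aeW => x; apply: cvgMr_tmp; exact: cvn.
  - by apply: itgZ; exact: itg_norm (itg_cdual g).
  - by move=> k x; rewrite normrM ler_wpM2r//; exact: phiM.
have lim0 : 'E (un k) @[k --> \oo] --> 'E u.
  have := lim1 0; rewrite scale0r.
  under [X in _ --> X -> _]eq_Rintegral do rewrite addr0.
  by under eq_fun do under eq_Rintegral do rewrite addr0.
have lim3 := cvg_norm (cvgB (cvgB (lim1 t) lim0) (cvgM (cvg_cst t) lim2)).
by apply: (cvgr_to_le (lim3 _ _ _ _ _)); apply: nearW => k; exact: step.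
Qed.

(** The expectation of the increment of [phi (coords xs x)] along [t * Qoo g], divided by [t],
    converges to the left side by dominated convergence and lies within [O(t)] of the right side by
    [lipschitz_increment]. *)
Lemma gaussian_ibp n (phi : 'rV[R]_n -> R) (xs : 'I_n -> cdual X) g : Cb1 phi ->
  'E (fun x => \sum_j (xs j (Qoo g) : R) * partial phi j (coords xs x)) =
  'E (fun x => phi (coords xs x) * g x).
Proof.
move=> Hphi; set v := Qoo g.
have [L L0 phiL0] := Cb1_lipschitz Hphi.
have phiL y z : `|phi y - phi z| <= L * \sum_j `|y 0 j - z 0 j|.
  have := phiL0 z (y - z); rewrite (addrC z) subrK.
  by under eq_bigr do rewrite !mxE.
have [M phiM] := Cb1_bounded Hphi.
pose u x := phi (coords xs x).
pose S := \sum_j `|xs j v : R|.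
pose G := 'E (fun x => `|g x : R|).
have cc : continuous (coords xs) by exact: coords_continuous.
have cu : continuous u by exact: continuous_fcomp cc (Cb1_continuous Hphi).
have cT s : continuous (fun x : X => x + s *: v).
  by apply: continuous_fD; [move=> x; exact: cvg_id|exact: continuous_fcst].
have mu_ s : measurable_fun setT (fun x : borel X => u (x + s *: v)).
  by apply: continuous_borel_measurable; exact: continuous_fcomp (cT s) cu.
have mu0 : measurable_fun setT (u : borel X -> R) by exact: continuous_borel_measurable.
have iu s : itg (fun x => u (x + s *: v)) by exact: itg_bounded (mu_ s) (fun=> phiM _).
have iu0 : itg u by exact: itg_bounded mu0 (fun=> phiM _).
pose t k : R := k.+1%:R^-1.
have t0 k : 0 < t k by rewrite invr_gt0.
have coordsD x s : coords xs (x + s *: v) = coords xs x + s *: coords xs v.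
  by apply/rowP => j; rewrite !mxE linearD linearZ.
have lim1 : 'E (fun x => (t k)^-1 * (u (x + t k *: v) - u x)) @[k --> \oo] -->
    'E (fun x => \sum_j (xs j v : R) * partial phi j (coords xs x)).
  apply: (@cvg_Rintegral _ _ R mu _ _ (fun=> L * S)).
  - by move=> k; apply: measurable_funM => //; exact: measurable_funB.
  - apply: measurable_sum => j; apply: measurable_funM => //.
    apply: continuous_borel_measurable.
    exact: continuous_fcomp cc (Cb1_partial_continuous Hphi).
  - apply: aeW => x.
    have /cvgr_dnbhsP H := Cb1_derivable_direction (y := coords xs x) (b := coords xs v) Hphi.
    have := H t; rewrite (_ : \sum_j _ = \sum_j (xs j v : R) * partial phi j (coords xs x)); last first.
      by apply: eq_bigr => j _; rewrite mxE.
    move=> {}H; rewrite /u; under eq_fun do rewrite coordsD; apply: H.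
    by split; [move=> k; rewrite gt_eqF|exact: cvg_harmonic].
  - exact: itg_cst.
  - move=> k x; rewrite normrM (gtr0_norm (_ : 0 < (t k)^-1)) ?invr_gt0//.
    rewrite ler_pdivrMl//.
    rewrite /u coordsD (le_trans (phiL0 _ _))// mulrCA ler_wpM2l// /S mulr_sumr.
    by apply: ler_sum => j _; rewrite !mxE normrM ger0_norm// ltW.
have lim2 : 'E (fun x => (t k)^-1 * (u (x + t k *: v) - u x)) @[k --> \oo] -->
    'E (fun x => u x * g x).
  have bnd k : `|'E (fun x => (t k)^-1 * (u (x + t k *: v) - u x)) -
      'E (fun x => u x * g x)| <= L * S * G * t k.
    have := @lipschitz_increment n phi L M (t k) xs g
      (Cb1_continuous Hphi) L0 phiL phiM (ltW (t0 k)).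
    rewrite RintegralZl//; last exact: itgB.
    rewrite RintegralB//; last exact: iu.
    rewrite -/v -/u -/S -/G => H.
    rewrite -(ler_pM2l (t0 k)) -{1}(gtr0_norm (t0 k)) -normrM mulrBr.
    by rewrite mulVKf ?gt_eqF// (le_trans H)// le_eqVlt; apply/orP; left; apply/eqP; ring.
  apply/cvgrPdist_le => e e0.
  have : L * S * G * t k @[k --> \oo] --> L * S * G * 0.
    by apply: cvgMl_tmp; exact: cvg_harmonic.
  rewrite mulr0 => /cvgrPdist_le /(_ _ e0); apply: filterS => k.
  rewrite sub0r normrN distrC => H; rewrite (le_trans (bnd k))//.
  by rewrite (le_trans (ler_norm _)).
exact: (cvg_unique _ lim1 lim2).
Qed.

Lemma integrable_expR_cdual (c : R) f : itg (fun x => expR (c * f x)).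
Proof. exact: (itg_expR (c *: f)). Qed.

End gaussian_measure.

Lemma cauchy_seq_cvg (R : realType) (V : completeNormedModType R) (u : nat -> V) :
  (forall e : R, 0 < e -> exists N, forall n m, (N <= n)%N -> (N <= m)%N ->
    `|u n - u m| <= e) -> cvg (u @ \oo).
Proof.
move=> H; apply/cauchy_cvgP/cauchyP => e e0.
have [N NP] := H _ (divr_gt0 e0 (ltr0n R 2)).
exists (u N); exists N => // n /= Nn; rewrite -ball_normE/=.
by rewrite (le_lt_trans (NP _ _ _ Nn))// gtr_pMr// invf_lt1 ?ltr1n.
Qed.

(** * The reproducing kernel Hilbert space *)

Section hilbert_space.
Context {R : realType} {H : hilbertType R}.
Implicit Types (x y z k : H) (a : R) (S : set H).
Local Notation "[ x , y ]" := (@inner R H x y).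

Lemma inner0l y : [0, y] = 0.
Proof. by have := innerZl 0 0 y; rewrite scale0r mul0r. Qed.

Lemma inner0r y : [y, 0] = 0. Proof. by rewrite innerC inner0l. Qed.

Lemma innerDr x y z : [x, y + z] = [x, y] + [x, z].
Proof. by rewrite innerC innerDl !(innerC x). Qed.

Lemma innerZr a x y : [x, a *: y] = a * [x, y].
Proof. by rewrite innerC innerZl (innerC x). Qed.

Lemma innerNl x y : [- x, y] = - [x, y].
Proof. by rewrite -scaleN1r innerZl mulN1r. Qed.

Lemma innerNr x y : [x, - y] = - [x, y].
Proof. by rewrite innerC innerNl (innerC x). Qed.

Lemma innerBl x y z : [x - y, z] = [x, z] - [y, z].
Proof. by rewrite innerDl innerNl. Qed.

Lemma innerBr x y z : [x, y - z] = [x, y] - [x, z].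
Proof. by rewrite innerDr innerNr. Qed.

Lemma inner_suml n (f : 'I_n -> H) y : [\sum_j f j, y] = \sum_j [f j, y].
Proof.
elim: n f => [|n IH] f; first by rewrite !big_ord0 inner0l.
by rewrite !big_ord_recl innerDl IH.
Qed.

Lemma norm_sqrD x y : `|x + y| ^+ 2 = `|x| ^+ 2 + 2 * [x, y] + `|y| ^+ 2.
Proof. by rewrite -!inner_norm innerDl !innerDr (innerC y x); ring. Qed.

Lemma norm_sqrB x y : `|x - y| ^+ 2 = `|x| ^+ 2 - 2 * [x, y] + `|y| ^+ 2.
Proof. by rewrite -!inner_norm innerBl !innerBr (innerC y x); ring. Qed.

Lemma inner_le x y : `|[x, y]| <= `|x| * `|y|.
Proof.
rewrite -ler_sqr ?nnegrE ?mulr_ge0// exprMn real_normK ?num_real//.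
have [->|y0] := eqVneq y 0; first by rewrite inner0r normr0 expr0n mulr0.
have y2 : 0 < `|y| ^+ 2 by rewrite exprn_gt0// normr_gt0.
have := sqr_ge0 (`| (`|y| ^+ 2) *: x - [x, y] *: y |).
rewrite norm_sqrB !normrZ innerZl innerZr !exprMn normr_id !real_normK ?num_real//.
set a := `|x| ^+ 2; set b := `|y| ^+ 2 in y2 *; set c := [x, y].
rewrite (_ : _ + _ = b * (a * b - c ^+ 2)); last by ring.
by rewrite pmulr_rge0// subr_ge0.
Qed.

Lemma inner_continuous y : continuous (fun x => [x, y]).
Proof.
move=> x; apply/cvgrPdist_le => e e0.
have y1 : 0 < `|y| + 1 by rewrite ltr_wpDl.
have : \forall z \near x, `|x - z| < e / (`|y| + 1).
  have := nbhsx_ballx x _ (divr_gt0 e0 y1).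
  by apply: filterS => z; rewrite -ball_normE.
apply: filterS => z xz; rewrite -innerBl (le_trans (inner_le _ _))//.
rewrite (@le_trans _ _ (e / (`|y| + 1) * `|y|))//; first by rewrite ler_wpM2r// ltW.
by rewrite mulrAC ler_pdivrMr// ler_wpM2l ?(ltW e0)// lerDl ler01.
Qed.

Lemma inner_eq0 x : [x, x] = 0 -> x = 0.
Proof. by rewrite inner_norm => /eqP; rewrite sqrf_eq0 normr_eq0 => /eqP. Qed.

(* The minimising sequence of the distance from [x] to [S] is Cauchy by the
   parallelogram identity, and the difference between [x] and its limit is
   orthogonal to [S]. *)
Lemma orthogonal_dense S : S 0 ->
  (forall a x y, S x -> S y -> S (a *: x + y)) ->
  (forall k, (forall s, S s -> [s, k] = 0) -> k = 0) ->
  forall x (e : R), 0 < e -> exists2 s, S s & `|x - s| < e.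
Proof.
move=> S0 Slin Sperp x e e0; pose D := [set `|x - s| | s in S].
have D0 : D !=set0 by exists `|x - 0|; exists 0.
have Dge r : D r -> 0 <= r by case=> s _ <-.
have infD : has_inf D by split=> //; exists 0 => r /Dge.
pose d := inf D; have d0 : 0 <= d by apply: lb_le_inf => // r /Dge.
have dle s : S s -> d <= `|x - s| by move=> Ss; apply: ge_inf; [exists 0 => r /Dge|exists s].
have /choice[s sP] (n : nat) : exists s, S s /\ `|x - s| < d + n.+1%:R^-1.
  have n0 : 0 < n.+1%:R^-1 :> R by rewrite invr_gt0.
  by have [_ [s Ss <-] ?] := inf_adherent n0 infD; exists s.
have sd n m : `|s n - s m| ^+ 2 <=
    2 * ((d + n.+1%:R^-1) ^+ 2 + (d + m.+1%:R^-1) ^+ 2) - 4 * d ^+ 2.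
  have [Sn sn] := sP n; have [Sm sm] := sP m.
  have Smid : S (2^-1 *: (s n + s m)).
    by have := Slin 2^-1 _ _ (Slin 1 _ _ Sn Sm) S0; rewrite scale1r addr0.
  have E : `|s n - s m| ^+ 2 = 2 * (`|x - s n| ^+ 2 + `|x - s m| ^+ 2) -
      4 * `|x - 2^-1 *: (s n + s m)| ^+ 2.
    rewrite !norm_sqrB normrZ innerZr !innerDr exprMn norm_sqrD.
    by rewrite ger0_norm ?invr_ge0//; field.
  rewrite E lerD//.
    rewrite ler_wpM2l// lerD// ler_sqr ?nnegrE ?addr_ge0 ?invr_ge0// ltW//.
  by rewrite lerN2 ler_wpM2l// ler_sqr ?nnegrE// dle.
have cs : cvg (s @ \oo).
  apply: cauchy_seq_cvg => r r0.
  have : (fun n : nat => 4 * ((d + n.+1%:R^-1) ^+ 2 - d ^+ 2)) n @[n --> \oo] -->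
      4 * ((d + 0) ^+ 2 - d ^+ 2).
    apply: cvgMl_tmp; apply: cvgB; last exact: cvg_cst.
    under eq_fun do rewrite expr2; rewrite expr2.
    by apply: cvgM; apply: cvgD; (exact: cvg_cst || exact: cvg_harmonic).
  rewrite addr0 subrr mulr0 => /cvgrPdist_le/(_ (r ^+ 2)).
  have /[swap]/[apply] : 0 < r ^+ 2 by rewrite exprn_gt0.
  move=> [N _ NP]; exists N => n m Nn Nm.
  rewrite -(@ler_sqr _ _ r) ?nnegrE ?normr_ge0 ?(ltW r0)// (le_trans (sd n m))//.
  have := NP n Nn; have := NP m Nm; rewrite /= !sub0r !normrN.
  move=> /(le_trans (ler_norm _)) Am /(le_trans (ler_norm _)) An.
  set a := (d + n.+1%:R^-1) ^+ 2 in An *; set b := (d + m.+1%:R^-1) ^+ 2 in Am *.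
  by move: Am An; rewrite !mulrBr mulrDr; clearbody a b; lra.
pose z := lim (s @ \oo).
have zd u : S u -> d <= `|x - z - u|.
  move=> Su; have : `|x - s n - u| @[n --> \oo] --> `|x - z - u|.
    by apply: cvg_norm; apply: cvgB; [apply: cvgB => //; exact: cvg_cst|exact: cvg_cst].
  move=> /cvgr_to_ge; apply; apply: nearW => n.
  rewrite -addrA -opprD; apply: dle; rewrite addrC -[u]scale1r.
  by apply: Slin => //; have [] := sP n.
have zle : `|x - z| <= d.
  have /cvgr_to_le : `|x - s n| - n.+1%:R^-1 @[n --> \oo] --> `|x - z| - 0.
    apply: cvgB; last exact: cvg_harmonic.
    by apply: cvg_norm; apply: cvgB => //; exact: cvg_cst.
  rewrite subr0; apply; apply: nearW => n.
  by rewrite lerBlDr ltW//; have [] := sP n.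
have perp u : S u -> [u, x - z] = 0.
  move=> Su; rewrite innerC; set c := [_, u]; set q := `|u| ^+ 2.
  have q0 : 0 <= q by rewrite exprn_ge0.
  have H0 a : 0 <= - 2 * a * c + a ^+ 2 * q.
    have Sau : S (a *: u) by have := Slin a _ _ Su S0; rewrite addr0.
    have : `|x - z| ^+ 2 <= `|x - z - a *: u| ^+ 2.
      by rewrite ler_sqr ?nnegrE// (le_trans zle)// zd.
    rewrite (norm_sqrB _ (a *: u)) innerZr normrZ exprMn real_normK ?num_real// -/c -/q; lra.
  have q1 : 0 < q + 1 by rewrite ltr_wpDl.
  (* The minimiser is [c / q]; with [q + 1] in the denominator the case [u = 0] needs no separate
     treatment. *)
  have := H0 (c / (q + 1)).
  rewrite (_ : _ + _ = - (c ^+ 2 * (q + 2) / (q + 1) ^+ 2)); last first.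
    by field; exact: lt0r_neq0.
  rewrite oppr_ge0 pmulr_lle0 ?invr_gt0 ?exprn_gt0// pmulr_lle0 ?ltr_wpDl//.
  by move=> c2; apply/eqP; rewrite -sqrf_eq0 eq_le c2 sqr_ge0.
have xz := Sperp _ perp.
have d00 : d = 0.
  by apply/le_anti; rewrite d0 andbT; have := zd 0 S0; rewrite subr0 xz normr0.
have : inf D < e by rewrite -/d d00.
by move=> /(inf_lt D0)[_ [u Su <-] ue]; exists u.
Qed.

End hilbert_space.

Lemma cdual_bounded (R : realType) (X : normedModType R) (f : cdual X) :
  exists2 M : R, 0 < M & forall x, `|f x : R| <= M * `|x|.
Proof.
have : bounded_near f (nbhs 0).
  by apply/linear_bounded_continuous; exact: clin_continuous.
by move=> /linear_boundedP/pinfty_ex_gt0[M M0 MP]; exists M.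
Qed.

Section rkhs.
Context {R : realType} {X : completeNormedModType R} {H : hilbertType R}.
Variables (Q : cdual X -> X) (i : clin H X) (istar : cdual X -> H).
Hypothesis Hr : is_rkhs Q i istar.
Local Notation "[ x , y ]" := (@inner R H x y).

Lemma istarE (f : cdual X) h : [istar f, h] = f (i h).
Proof. exact: rkhs_adjoint Hr f h. Qed.

(** Linearity is forced by adjointness: the difference of the two sides is orthogonal to every
    vector, hence to itself. *)
Lemma istar_linear (a : R) (f g : cdual X) :
  istar (a *: f + g) = a *: istar f + istar g.
Proof.
apply/eqP; rewrite -subr_eq0; apply/eqP/inner_eq0.
set k := (X in [_, X]).
by rewrite innerBl innerDl innerZl !istarE subrr.
Qed.

(** Such an [h] is orthogonal to the range of [istar], so no point of that range is closer to [h]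
    than 0 is; density then forces [h = 0]. *)
Lemma rkhs_perp h : (forall f : cdual X, f (i h) = 0 :> R) -> h = 0.
Proof.
move=> fh; apply: inner_eq0; apply/eqP; rewrite inner_norm sqrf_eq0 -[_ == 0]negbK.
apply/negP => h0; have hp : 0 < `|h| by rewrite lt_neqAle eq_sym h0 /=.
have [y [/= h_lt [f _ fE]]] := rkhs_dense Hr (O := ball h `|h|)
  (ex_intro _ h (ballxx h hp)) (ball_open h _).
move: h_lt; rewrite -fE -ball_normE/= => hf.
have : `|h| ^+ 2 <= `|h - istar f| ^+ 2.
  by rewrite norm_sqrB (innerC h) istarE fh mulr0 subr0 lerDl sqr_ge0.
by rewrite ler_sqr ?nnegrE// leNgt hf.
Qed.

Lemma separable_seq : separable_space X ->
  exists d : nat -> X, forall x (e : R), 0 < e -> exists n, `|x - d n| < e.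
Proof.
move=> [D [cD dD]].
have [d dP] : exists d : nat -> X, set_surj setT D d by exact/pcard_surjP.
exists d => x e e0.
have [y [/= xy Dy]] := dD (ball x e) (ex_intro _ x (ballxx x e0)) (ball_open x _).
by have [n _ ny] := dP _ Dy; exists n; move: xy; rewrite -ball_normE ny.
Qed.

(* Countably many functionals, weakly* dense in every ball of the dual, are
   enough to separate the points of [i H]. *)
Lemma rkhs_separable : separable_space X ->
  exists e : nat -> H, forall h (r : R), 0 < r -> exists n, `|h - e n| < r.
Proof.
move=> /separable_seq[d dP].
(* [Sx (N, M, q)] consists of the functionals of norm at most [N] whose values at the first [M]
   points of [d] are within [1 / M] of the rationals [q]; [c] picks one of them, or 0 if there is
   none. *)
pose I : Type := (nat * nat * seq rat)%type.
pose Sx (p : I) := [set f : cdual X | (forall x, `|f x : R| <= p.1.1%:R * `|x|) /\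
   forall m, (m < p.1.2)%N -> `|(f (d m) : R) - ratr (nth 0 p.2 m)| < p.1.2%:R^-1].
pose c (p : I) : cdual X := xget 0 (Sx p).
have csep h : (forall p, c p (i h) = 0 :> R) -> h = 0.
  move=> ch; apply: rkhs_perp => f.
  have [B B0 BP] := cdual_bounded f.
  pose N := (Num.truncn B).+1.
  have BN : B <= N%:R by rewrite ltW//; exact: truncnS_gt.
  have N0 : 0 < N%:R :> R by rewrite ltr0n.
  apply/eqP; rewrite -normr_le0; apply/ler_addgt0Pr => e e0; rewrite add0r.
  pose r := e / (2 * N%:R + 2).
  have q0 : 0 < 2 * N%:R + 2 :> R by rewrite addr_gt0// mulr_gt0.
  have r0 : 0 < r by exact: divr_gt0.
  have [m mP] := dP (i h) r r0.
  pose M := maxn m.+1 (Num.truncn r^-1).+1.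
  have M0 : 0 < M%:R :> R by rewrite ltr0n leq_max ltn0Sn.
  have Mr : M%:R^-1 <= r.
    rewrite -[leRHS]invrK lef_pV2 ?posrE ?invr_gt0//.
    by rewrite (@le_trans _ _ (Num.truncn r^-1).+1%:R)// ?ler_nat ?leq_maxr// ltW// truncnS_gt.
  have /choice[q qP] j : exists q : rat, `|(f (d j) : R) - ratr q| < M%:R^-1.
    have /rat_in_itvoo[q] : (f (d j) : R) < f (d j) + M%:R^-1.
      by rewrite ltrDl invr_gt0.
    rewrite inE/= => /andP[q1 q2]; exists q.
    by rewrite distrC gtr0_norm ?subr_gt0// ltrBlDl.
  pose p : I := (N, M, [seq q j | j <- iota 0 M]).
  have Sf : Sx p f.
    split=> /= [x|j jM]; first by rewrite (le_trans (BP x))// ler_wpM2r.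
    by rewrite (nth_map 0%N) ?size_iota// nth_iota.
  have [cN cM] : Sx p (c p) by exact: (@xgetPex _ 0 (Sx p) (ex_intro _ f Sf)).
  have mM : (m < M)%N by rewrite leq_max leqnn.
  have [_ fM] := Sf.
  have -> : f (i h) = (f (i h - d m) : R) + ((f (d m) : R) - ratr (nth 0 p.2 m)) -
     ((c p (d m) : R) - ratr (nth 0 p.2 m)) - c p (i h - d m) :> R.
    by rewrite !linearB/= ch; ring.
  have e1 : `|f (i h - d m) : R| <= N%:R * r.
    by rewrite (le_trans (BP _))// ler_pM// ltW.
  have e2 : `|c p (i h - d m) : R| <= N%:R * r.
    by rewrite (le_trans (cN _))// ler_wpM2l// ltW.
  have e3 := ltW (lt_le_trans (fM m mM) Mr).
  have e4 := ltW (lt_le_trans (cM m mM) Mr).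
  have -> : e = N%:R * r + r + r + N%:R * r.
    by rewrite /r; field; rewrite lt0r_neq0// -(natrM _ 2) -natrD ltr0n addn_gt0 orbT.
  rewrite (le_trans (ler_normB _ _))// lerD//.
  rewrite (le_trans (ler_normB _ _))// lerD//.
  by rewrite (le_trans (ler_normD _ _))// lerD.
pose comb (s : seq (rat * I)) : H := \sum_(t <- s) ratr t.1 *: istar (c t.2).
have combD s1 s2 : comb s1 + comb s2 = comb (s1 ++ s2) by rewrite /comb big_cat.
have combZ (q : rat) s : ratr q *: comb s = comb [seq (q * t.1, t.2) | t <- s].
  rewrite /comb scaler_sumr big_map; apply: eq_bigr => t _ /=.
  by rewrite scalerA -rmorphM.
(* The closure of the countable set of rational combinations is a real subspace, to which
   [orthogonal_dense] applies; its density then passes to the combinations themselves. *)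
pose S := [set h : H | forall r : R, 0 < r -> exists s, `|h - comb s| < r].
have S0 : S 0 by move=> r r0; exists [::]; rewrite /comb big_nil subrr normr0.
have Slin a x y : S x -> S y -> S (a *: x + y).
  move=> Sx' Sy r r0; have r3 : 0 < r / 3 by rewrite divr_gt0.
  have a1 : 0 < `|a| + 1 by rewrite ltr_wpDl.
  have [s1 s1P] := Sx' _ (divr_gt0 r3 a1).
  have [s2 s2P] := Sy _ r3.
  have c1 : 0 < `|comb s1| + 1 by rewrite ltr_wpDl.
  have /rat_in_itvoo[q] : a < a + r / 3 / (`|comb s1| + 1).
    by rewrite ltrDl divr_gt0.
  rewrite inE/= => /andP[q1 q2].
  exists ([seq (q * t.1, t.2) | t <- s1] ++ s2); rewrite -combD -combZ.
  have -> : a *: x + y - (ratr q *: comb s1 + comb s2) =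
      a *: (x - comb s1) + (a - ratr q) *: comb s1 + (y - comb s2).
    by rewrite scalerBr scalerBl opprD addrACA subrKA -addrA.
  rewrite (le_lt_trans (ler_normD _ _))// (_ : r = r / 3 + r / 3 + r / 3); last by field.
  rewrite ltr_leD// ?(ltW s2P)// (le_lt_trans (ler_normD _ _))// ltrD// normrZ.
    rewrite (@le_lt_trans _ _ (`|a| * (r / 3 / (`|a| + 1))))//.
      by rewrite ler_wpM2l// ltW.
    by rewrite mulrCA gtr_pMr// ltr_pdivrMr// mul1r ltrDl.
  rewrite (@le_lt_trans _ _ (r / 3 / (`|comb s1| + 1) * `|comb s1|))//.
    by rewrite ler_wpM2r// distrC gtr0_norm ?subr_gt0// ltW// ltrBlDl.
  by rewrite mulrAC ltr_pdivrMr// ltr_pM2l// ltrDl.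
have Sperp k : (forall s, S s -> [s, k] = 0) -> k = 0.
  move=> Sk; apply: csep => p; rewrite -istarE; apply: Sk => r r0.
  exists [:: (1, p)]; rewrite /comb big_seq1 rmorph1 scale1r subrr normr0//.
have Sd := orthogonal_dense S0 Slin Sperp.
pose e n : H := if unpickle n is Some s then comb s else 0.
exists e => h r r0; have r2 : 0 < r / 2 by rewrite divr_gt0.
have [y Sy hy] := Sd h _ r2; have [s sP] := Sy _ r2.
exists (pickle s); rewrite /e pickleK -(subrKA y) (le_lt_trans (ler_normD _ _))//.
by rewrite [r]splitr ltrD.
Qed.

End rkhs.

(** * Measurable functions with values in a separable space *)

Section separable_measurability.
Context d (T : measurableType d) {R : realType} {H : completeNormedModType R}.
Variable e : nat -> H.
Hypothesis e_dense : forall h (r : R), 0 < r -> exists n, `|h - e n| < r.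
Implicit Types F G : T -> H.

(** Every open set is a countable union of balls around points of [e], so the distances to these
    points decide Borel measurability. *)
Lemma measurable_to_borel F :
  (forall n, measurable_fun setT (fun x => `|F x - e n|)) ->
  measurable_fun setT (F : T -> borel H).
Proof.
move=> mF; apply: (@measurability _ _ _ (borel H) setT F (@open H)) => //.
move=> V [W oW <-]; rewrite setTI.
pose J := [set p : nat * nat | ball (e p.1) p.2.+1%:R^-1 `<=` W].
have -> : F @^-1` W = \bigcup_(p in J) [set x | `|F x - e p.1| < p.2.+1%:R^-1].
  apply/seteqP; split=> [x /= WFx|x /= [p Jp]]; last first.
    by move=> Fp; apply: Jp; rewrite -ball_normE/= distrC.
  have : nbhs (F x) W by exact: open_nbhs_nbhs.
  move=> /nbhs_ballP[r /= r0 rW]; have r2 : 0 < r / 2 by rewrite divr_gt0.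
  pose k := Num.truncn (r / 2)^-1.
  have kr : k.+1%:R^-1 <= r / 2.
    by rewrite -[leRHS]invrK lef_pV2 ?posrE ?invr_gt0// ltW// truncnS_gt.
  have k0 : 0 < k.+1%:R^-1 :> R by rewrite invr_gt0.
  have [n nP] := e_dense (F x) k0.
  exists (n, k) => // y; rewrite -ball_normE/= => ye.
  apply: rW; rewrite -ball_normE/= -(subrKA (e n)) (le_lt_trans (ler_normD _ _))//.
  by rewrite [r]splitr ltrD// (lt_le_trans _ kr).
rewrite bigcup_mkcond; apply: countable_bigcupT_measurable => [|p]; first exact: countableP.
case: ifP => // _.
have -> : [set x | `|F x - e p.1| < p.2.+1%:R^-1] =
    (fun x => `|F x - e p.1|) @^-1` `]-oo, p.2.+1%:R^-1[.
  by apply/seteqP; split=> x /=; rewrite in_itv.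
by rewrite -[X in measurable X]setTI; apply: mF => //; exact: measurable_itv.
Qed.

Lemma continuous_measurable_comp (h : H -> R) F : continuous h ->
  measurable_fun setT (F : T -> borel H) -> measurable_fun setT (h \o F).
Proof.
by move=> ch mF; apply: (measurableT_comp _ mF); exact: continuous_borel_measurable.
Qed.

Lemma measurable_norm_subcst F k : measurable_fun setT (F : T -> borel H) ->
  measurable_fun setT (fun x => `|F x - k|).
Proof.
apply: (@continuous_measurable_comp (fun y => `|y - k|)).
by move=> y; apply: cvg_norm; apply: cvgB; [exact: cvg_id|exact: cvg_cst].
Qed.

(** Written as the countable infimum of [|F - e n| + |G - e n|], the distance is measurable without
    any comparison between the Borel sets of a product space and the product sigma-algebra. *)
Lemma measurable_norm_sub F G : measurable_fun setT (F : T -> borel H) ->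
  measurable_fun setT (G : T -> borel H) -> measurable_fun setT (fun x => `|F x - G x|).
Proof.
move=> mF mG.
have -> : (fun x => `|F x - G x|) =
    (fun x => inf [set `|F x - e n| + `|G x - e n| | n in [set n | (0 <= n)%N]]).
  apply/funext => x; set A := (X in inf X).
  have A0 : A !=set0 by exists (`|F x - e 0%N| + `|G x - e 0%N|); exists 0%N.
  have lb : lbound A `|F x - G x|.
    by move=> _ [n _ <-]; rewrite -(subrKA (e n)) (le_trans (ler_normD _ _))// lerD// distrC.
  apply/eqP; rewrite eq_le; apply/andP; split; first exact: lb_le_inf.
  apply/ler_addgt0Pr => r r0; have r2 : 0 < r / 2 by rewrite divr_gt0.
  have [n nP] := e_dense (G x) r2.
  apply: (@le_trans _ _ (`|F x - e n| + `|G x - e n|)).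
    by apply: ge_inf; [exists (`|F x - G x|)|exists n].
  rewrite -(subrKA (G x) (F x)) (le_trans (lerD (ler_normD _ _) (lexx _)))//.
  by rewrite -addrA lerD2l [r]splitr lerD// ltW.
apply: (@measurable_fun_infs _ _ _ _ (fun n x => `|F x - e n| + `|G x - e n|) 0%N) => [x _|n]; last first.
  by apply: measurable_funD; exact: measurable_norm_subcst.
by exists 0 => _ [n _ <-]; rewrite addr_ge0.
Qed.

Lemma measurable_borelD F G : measurable_fun setT (F : T -> borel H) ->
  measurable_fun setT (G : T -> borel H) ->
  measurable_fun setT ((fun x => F x + G x) : T -> borel H).
Proof.
move=> mF mG; apply: measurable_to_borel => n.
under eq_fun do rewrite -addrA -opprB.
apply: measurable_norm_sub => //.
apply: (measurableT_comp (f := (fun y : H => e n - y) : borel H -> borel H)) mG.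
apply: continuous_borel_measurableH.
by move=> y; apply: cvgB; [exact: cvg_cst|exact: cvg_id].
Qed.

Lemma measurable_borelZ (a : R) F : measurable_fun setT (F : T -> borel H) ->
  measurable_fun setT ((fun x => a *: F x) : T -> borel H).
Proof.
apply: (measurableT_comp (f := (fun y : H => a *: y) : borel H -> borel H)).
by apply: continuous_borel_measurableH; exact: scaler_continuous.
Qed.

Lemma measurable_borel_cvg (F_ : nat -> T -> H) F :
  (forall n, measurable_fun setT (F_ n : T -> borel H)) ->
  (forall x, F_ n x @[n --> \oo] --> F x) ->
  measurable_fun setT (F : T -> borel H).
Proof.
move=> mF FF; apply: measurable_to_borel => k.
apply: (@measurable_fun_cvg _ T R setT (fun n x => `|F_ n x - e k|)).
- by move=> n; exact: measurable_norm_subcst.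
- by move=> x _; apply: cvg_norm; apply: cvgB => //; exact: cvg_cst.
Qed.

End separable_measurability.

Lemma measurable_inner d (T : measurableType d) (R : realType) (H : hilbertType R)
    (e : nat -> H) (F G : T -> H) :
  (forall h (r : R), 0 < r -> exists n, `|h - e n| < r) ->
  measurable_fun setT (F : T -> borel H) -> measurable_fun setT (G : T -> borel H) ->
  measurable_fun setT (fun x => inner (F x) (G x)).
Proof.
move=> eP mF mG.
have mn (K : T -> H) : measurable_fun setT (K : T -> borel H) ->
    measurable_fun setT (fun x => `|K x|).
  by move=> mK; have := measurable_norm_subcst 0 mK; under eq_fun do rewrite subr0.
have -> : (fun x => inner (F x) (G x)) = (fun x =>
    2^-1 * (`|F x| ^+ 2 + `|G x| ^+ 2 - `|F x - G x| ^+ 2)).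
  by apply/funext => x; rewrite norm_sqrB; field.
apply: measurable_funM => //; apply: measurable_funB.
  by apply: measurable_funD; apply: measurable_funX; exact: mn.
by apply: measurable_funX; exact: (measurable_norm_sub eP).
Qed.

(** * The Lyapunov equation *)

Section antiderivative.
Context {R : realType}.
Implicit Types (phi F G : R -> R) (a b s t l : R).
Local Notation leb := (@lebesgue_measure R).

(** Integrating from -1 keeps 0 in the interior, so that the derivative at 0 is two-sided. *)
Lemma antiderivative phi : continuous phi ->
  exists P : R -> R, forall s : R, -1 < s -> is_derive s 1 P (phi s).
Proof.
move=> cphi; exists (fun x => \int[leb]_(t in [set` Interval (BLeft (-1)) (BRight x)]) phi t).
move=> s s1; have s2 : s < s + 1 by rewrite ltrDl.
have is1 : leb.-integrable [set` Interval (BLeft (-1)) (BRight (s + 1))] (EFin \o phi).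
  apply: continuous_compact_integrable; first exact: segment_compact.
  exact: continuous_subspaceT.
have [//|d1 d2] := continuous_FTC1 s2 is1 _ (cphi s).
by split; [exact: d1|rewrite -derive1E; exact: d2].
Qed.

Lemma is_derive_cts phi F a b : (forall s, a <= s <= b -> is_derive s 1 F (phi s)) ->
  {within `[a, b], continuous F}.
Proof.
move=> dF; apply: derivable_within_continuous => s sab.
by have [] := dF s sab.
Qed.

Lemma increment_eq phi F G a b : a <= b ->
  (forall s, a <= s <= b -> is_derive s 1 F (phi s)) ->
  (forall s, a <= s <= b -> is_derive s 1 G (phi s)) -> F b - F a = G b - G a.
Proof.
move=> ab dF dG.
have d s : a <= s <= b -> is_derive s 1 (F - G) 0.
  by move=> sab; have := dF s sab; have := dG s sab => ? ?; apply: is_derive_eq; rewrite subrr.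
have [|c _] := @MVT_segment _ (F - G) (fun=> 0) a b ab _ (is_derive_cts (phi := fun=> 0) d).
  by move=> s; rewrite in_itv/= => /andP[s1 s2]; apply: d; rewrite !ltW.
have E x : (F - G) x = F x - G x by [].
rewrite !E.
rewrite mul0r; move: (F b) (F a) (G b) (G a) => p q r u /eqP.
by rewrite subr_eq0 => /eqP ?; lra.
Qed.

Lemma increment_le phi F a b (K : R) : a <= b ->
  (forall s, a <= s <= b -> is_derive s 1 F (phi s)) ->
  (forall s, a <= s <= b -> `|phi s| <= K) -> `|F b - F a| <= K * (b - a).
Proof.
move=> ab dF pK.
have [|c cab ->] := @MVT_segment _ F phi a b ab _ (is_derive_cts dF).
  by move=> s; rewrite in_itv/= => /andP[s1 s2]; apply: dF; rewrite !ltW.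
by rewrite normrM (ger0_norm (_ : 0 <= b - a)) ?subr_ge0// ler_wpM2r ?subr_ge0// pK.
Qed.

Lemma integral_increment phi F a b : a < b -> continuous phi ->
  (forall s, a <= s <= b -> is_derive s 1 F (phi s)) ->
  (\int[leb]_(s in `[a, b]) (phi s)%:E = (F b - F a)%:E)%E.
Proof.
move=> ab cphi dF; rewrite EFinB; apply: continuous_FTC2 => //.
- exact: continuous_subspaceT.
- have /(continuous_within_itvP _ ab)[] := is_derive_cts dF.
  move=> _ Fa Fb; split=> // s; rewrite in_itv/= => /andP[s1 s2].
  by have [] := dF s; rewrite ?ltW.
- move=> s; rewrite in_itv/= => /andP[s1 s2]; rewrite derive1E.
  have sab : a <= s <= b by rewrite !ltW.
  by have [_] := dF s sab.
Qed.

Lemma is_derive_harmonic F a (l : R) : is_derive a 1 F l ->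
  n.+1%:R * (F (a + n.+1%:R^-1) - F a) @[n --> \oo] --> l.
Proof.
move=> [dF <-]; have /cvgr_dnbhsP := dF.
move=> /(_ (fun n => n.+1%:R^-1)); rewrite /comp.
have -> : (fun n : nat => n.+1%:R * (F (a + n.+1%:R^-1) - F a)) =
    (fun n : nat => (n.+1%:R^-1)^-1 *: (F (n.+1%:R^-1 *: 1 + a) - F a)).
  by apply/funext => n; rewrite invrK /GRing.scale/= mulr1 (addrC a).
apply; split; first by move=> n; rewrite invr_neq0.
exact: cvg_harmonic.
Qed.

End antiderivative.

Lemma cvg_lincomb (R : realType) (I : Type) (F : set_system I) (FF : Filter F)
    (u v : I -> R) (a l m : R) : u @ F --> l -> v @ F --> m ->
  a * u n + v n @[n --> F] --> a * l + m.
Proof. by move=> ul vm; apply: cvgD vm; exact: cvgMl_tmp. Qed.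

Lemma cdual_of_bounded (R : realType) (X : normedModType R) (F : X -> R) (M : R) :
  (forall a x y, F (a *: x + y) = a * F x + F y) -> (forall x, `|F x| <= M * `|x|) ->
  exists f : cdual X, forall x, f x = F x.
Proof.
move=> Flin FM.
have FB x y : F x - F y = F (x - y).
  by have := Flin (-1) y x; rewrite scaleN1r mulN1r addrC [RHS]addrC => <-; rewrite addrC.
have P : (F : X -> R^o) \in @clin_pred R X R^o.
  apply/mem_set; split; first exact: Flin.
  move=> x; apply/cvgrPdist_le => e e0; have M1 : 0 < `|M| + 1 by rewrite ltr_wpDl.
  have := nbhsx_ballx x _ (divr_gt0 e0 M1); apply: filterS => z; rewrite -ball_normE/= => xz.
  rewrite FB (le_trans (FM _))// (@le_trans _ _ ((`|M| + 1) * (e / (`|M| + 1))))//.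
    rewrite (@le_trans _ _ ((`|M| + 1) * `|x - z|))//.
      by rewrite ler_wpM2r// (le_trans (ler_norm M))// lerDl.
    by rewrite ler_wpM2l ?(ltW xz)// ltW.
  by rewrite mulrC divfK// lt0r_neq0.
by exists (CLin P).
Qed.

Lemma dual_norm_le (R : realType) (X : normedModType R) (f : cdual X) (K : R) :
  0 <= K -> (forall x, `|f x : R| <= K * `|x|) -> dual_norm f <= K.
Proof.
move=> K0 fK; apply: ge_sup; first by exists `|f 0 : R|; exists 0; rewrite /= ?normr0.
by move=> _ [x /= x1 <-]; rewrite (le_trans (fK x))// ler_piMr.
Qed.

(** * The contraction semigroup and its adjoint *)

Section semigroup.
Context {R : realType} {X : completeNormedModType R}.
Variable T : R -> clin X X.
Hypothesis T_semigroup : contraction_semigroup T.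
Implicit Types (f g : cdual X) (x y : X) (s t h : R).

Lemma semigroup0 x : T 0 x = x. Proof. by have [] := T_semigroup. Qed.

Lemma semigroupD s t x : 0 <= s -> 0 <= t -> T (s + t) x = T s (T t x).
Proof. by have [_ + _ _] := T_semigroup; exact. Qed.

Lemma semigroup_contr t x : 0 <= t -> `|T t x| <= `|x|.
Proof. by have [_ _ + _] := T_semigroup; exact. Qed.

(* [T] is junk for negative times, hence the truncation. *)
Definition orbit f x s : R := f (T (Num.max s 0) x).

Lemma orbitE f x s : 0 <= s -> orbit f x s = f (T s x).
Proof. by rewrite /orbit => /max_l ->. Qed.

Lemma semigroup_le s t x : 0 <= s -> s <= t -> `|T t x - T s x| <= `|T (t - s) x - x|.
Proof.
move=> s0 st; rewrite -[X in T X x](subrKC s t) (@semigroupD s) ?subr_ge0//.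
by rewrite -linearB semigroup_contr.
Qed.

(** Right continuity at 0 spreads to all times: by contraction, the increment between two times is
    at most the increment from 0 over the same length. *)
Lemma orbit_continuous f x : continuous (orbit f x).
Proof.
have c0 : T t x @[t --> 0^'+] --> x by have [_ _ _] := T_semigroup.
have [M M0 MP] := cdual_bounded f.
have m0 s : 0 <= Num.max s 0 :> R by rewrite le_max lexx orbT.
move=> s; apply/cvgrPdist_le => e e0; have eM : 0 < e / M by rewrite divr_gt0.
move/cvgrPdist_le : c0 => /(_ _ eM); rewrite near_withinE => /nbhs_ballP[d /= d0 dP].
have := nbhsx_ballx s _ d0; apply: filterS => t; rewrite -ball_normE/= => st.
rewrite /orbit -linearB (le_trans (MP _))// -ler_pdivlMl// mulrC.
set a := Num.max s 0; set b := Num.max t 0.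
have ab : `|a - b| <= `|s - t|.
  rewrite /a /b; case: (leP s 0) => s0; case: (leP t 0) => t0; rewrite ?subr0 ?normr0//.
  - by rewrite sub0r normrN gtr0_norm// distrC (le_trans _ (ler_norm _))// lerDl oppr_ge0.
  - by rewrite gtr0_norm// (le_trans _ (ler_norm _))// lerDl oppr_ge0.
have key u v : 0 <= u -> u <= v -> `|v - u| < d -> `|T v x - T u x| <= e / M.
  move=> u0 uv vd; rewrite (le_trans (semigroup_le x u0 uv))//.
  move: uv; rewrite le_eqVlt => /predU1P[->|uv]; first by rewrite subrr semigroup0 subrr normr0 ltW.
  by rewrite distrC; apply: dP; rewrite ?subr_gt0// -ball_normE/= sub0r normrN.
have abd := le_lt_trans ab st.
by case: (leP a b) => [|/ltW] le; [rewrite distrC|]; apply: key; rewrite ?m0// distrC.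
Qed.

Lemma orbit_bound f (M : R) x s : 0 < M -> (forall y, `|f y : R| <= M * `|y|) ->
  `|orbit f x s| <= M * `|x|.
Proof.
move=> M0 MP; rewrite (le_trans (MP _))// ler_pM2l// semigroup_contr//.
by rewrite le_max lexx orbT.
Qed.

(* [f] lies in the domain of the generator of the adjoint semigroup, in the
   sense that its orbit is norm Lipschitz and weak* differentiable at 0. *)
Definition smooth_dual f g :=
  (exists M : R, forall h x, 0 <= h -> `|f (T h x) - f x : R| <= M * h * `|x|) /\
  (forall x, h^-1 * (f (T h x) - f x) @[h --> 0^'+] --> (g x : R)).

Lemma smooth_dual_linear (a : R) f g f' g' : smooth_dual f g -> smooth_dual f' g' ->
  smooth_dual (a *: f + f') (a *: g + g').
Proof.
move=> [[M MP] fg] [[M' MP'] fg']; split.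
  exists (`|a| * M + M') => h x h0.
  have -> : (a *: f + f') (T h x) - (a *: f + f') x =
      a * (f (T h x) - f x : R) + (f' (T h x) - f' x) :> R.
    by rewrite mulrBr addrACA -opprD.
  rewrite (le_trans (ler_normD _ _))// normrM !mulrDl lerD ?MP'//.
  by rewrite -!mulrA ler_wpM2l// mulrA MP.
move=> x.
have -> : (fun h => h^-1 * ((a *: f + f') (T h x) - (a *: f + f') x : R)) =
    (fun h => a * (h^-1 * (f (T h x) - f x)) + h^-1 * (f' (T h x) - f' x)).
  apply/funext => h.
  have E z : (a *: f + f') z = a * f z + f' z :> R by [].
  by rewrite !E; ring.
have -> : (a *: g + g') x = a * g x + g' x :> R by [].
exact: (cvg_lincomb _ (fg x) (fg' x)).
Qed.

Lemma smooth_dual_adjoint DA (A : X -> X) f g : generates DA A T ->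
  smooth_dual f g -> adjoint_at DA A f g.
Proof.
move=> gen [_ fg] x xA.
have H1 : f (h^-1 *: (T h x - x)) @[h --> 0^'+] --> (f (A x) : R).
  apply: continuous_cvg; first exact: clin_continuous.
  exact: ((gen x (A x)).1 (conj xA erefl)).
have H2 : h^-1 * (f (T h x) - f x : R) @[h --> 0^'+] --> (f (A x) : R).
  apply: cvg_trans H1; apply: near_eq_cvg; apply: nearW => h /=.
  by rewrite linearZ/= linearB.
exact: (cvg_unique _ H2 (fg x)).
Qed.

(** [ft] is the mean over [[0, t]] of the orbit of [f] under the adjoint semigroup. That semigroup
    need not be strongly continuous, so the mean is formed pointwise, from antiderivatives of scalar
    orbits. Its derivative [g] is the increment of the orbit divided by [t], and the Lipschitz bound
    holds because a translation by [h] leaves only two boundary integrals of length [h]. *)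
Lemma mean_smooth f (t : R) : 0 < t -> exists ft g : cdual X,
  smooth_dual ft g /\ forall x (P : R -> R),
    (forall s, -1 < s -> is_derive s 1 P (orbit f x s)) -> ft x = t^-1 * (P t - P 0) :> R.
Proof.
move=> t0; have [M M0 MP] := cdual_bounded f.
have /choice[P dP] : forall x, exists P : R -> R,
    forall s, -1 < s -> is_derive s 1 P (orbit f x s).
  by move=> x; apply: antiderivative; exact: orbit_continuous.
have dP0 x s : 0 <= s -> is_derive s 1 (P x) (orbit f x s).
  by move=> s0; apply: dP; rewrite (lt_le_trans _ s0)// ltrN10.
have uniqP x G : (forall s, -1 < s -> is_derive s 1 G (orbit f x s)) ->
    G t - G 0 = P x t - P x 0.
  move=> dG; apply: (@increment_eq _ (orbit f x)); first exact: ltW.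
    by move=> s /andP[s0 _]; apply: dG; rewrite (lt_le_trans _ s0)// ltrN10.
  by move=> s /andP[s0 _]; exact: dP0.
have [||ft ftE] := @cdual_of_bounded _ X (fun x => t^-1 * (P x t - P x 0)) M.
- move=> a x y.
  suff dG s : -1 < s -> is_derive s 1 (fun s => a * P x s + P y s) (orbit f (a *: x + y) s).
    by rewrite -(uniqP _ _ dG); ring.
  move=> s1; have dx := dP x s s1; have dy := dP y s s1.
  rewrite (_ : orbit _ _ _ = a * orbit f x s + orbit f y s); last first.
    by rewrite /orbit linearP linearP.
  rewrite (_ : (fun _ => _) = (a \*: P x + P y)); last by apply/funext.
  exact: is_deriveD.
- move=> x; rewrite normrM gtr0_norm ?invr_gt0// mulrC ler_pdivrMr//.
  rewrite -[X in _ * X]subr0; apply: (@increment_le _ (orbit f x)) => [|s /andP[s0 _]|s _].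
  + exact: ltW.
  + exact: dP0.
  + exact: orbit_bound.
have shift h x : 0 <= h -> P (T h x) t - P (T h x) 0 = P x (t + h) - P x h.
  move=> h0; have := @increment_eq _ (orbit f (T h x)) (P (T h x)) (fun s => P x (s + h)) 0 t.
  rewrite add0r; apply; first exact: ltW.
    by move=> s /andP[s0 _]; exact: dP0.
  move=> s /andP[s0 _].
  have sh : 0 <= s + h by rewrite addr_ge0.
  rewrite orbitE// -semigroupD// -orbitE//.
  have := dP0 x _ sh => d1.
  have dsh : is_derive s 1 (fun u : R => u + h) 1.
    by apply: is_derive_eq; rewrite addr0.
  by have := @is_derive1_comp _ (P x) (fun u => u + h) s _ _ d1 dsh; rewrite mulr1.
exists ft, (t^-1 *: (dual_map (T t) f - f)); split; last first.
  by move=> x G dG; rewrite ftE (uniqP _ _ dG).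
have inc h x : 0 <= h -> ft (T h x) - ft x =
    t^-1 * ((P x (t + h) - P x t) - (P x h - P x 0)) :> R.
  by move=> h0; rewrite !ftE shift//; ring.
split.
  exists (t^-1 * (M + M)) => h x h0; rewrite inc// normrM gtr0_norm ?invr_gt0//.
  rewrite -!mulrA ler_pM2l ?invr_gt0// mulrA (le_trans (ler_normB _ _))//.
  rewrite mulrAC 2!mulrDl lerD//.
    rewrite (_ : M * `|x| * h = M * `|x| * (t + h - t)); last by ring.
    apply: (@increment_le _ (orbit f x)) => [|s /andP[s0 _]|s _]; first by rewrite lerDl.
      by apply: dP0; rewrite (le_trans _ s0)// ltW.
    exact: orbit_bound.
  rewrite (_ : M * `|x| * h = M * `|x| * (h - 0)); last by ring.
  apply: (@increment_le _ (orbit f x)) => [//|s /andP[s0 _]|s _].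
    exact: dP0.
  exact: orbit_bound.
move=> x.
have dq (a : R) : 0 <= a ->
    h^-1 * (P x (a + h) - P x a) @[h --> 0^'+] --> orbit f x a.
  move=> a0; have [dd <-] := dP0 x a a0; move: dd => /cvg_dnbhs_at_right.
  apply: cvg_trans; apply: near_eq_cvg; apply: nearW => h.
  by rewrite /GRing.scale/= mulr1 (addrC a).
have -> : ((t^-1 *: (dual_map (T t) f - f)) x : R) = t^-1 * (orbit f x t - orbit f x 0).
  by rewrite (orbitE _ _ (ltW t0)) (orbitE _ _ (lexx 0)) semigroup0.
have : t^-1 * (h^-1 * (P x (t + h) - P x t) - h^-1 * (P x (0 + h) - P x 0)) @[h --> 0^'+] -->
    t^-1 * (orbit f x t - orbit f x 0).
  apply: cvgMl_tmp; apply: cvgB; [exact: (dq _ (ltW t0))|exact: (dq 0 (lexx 0))].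
apply: cvg_trans; apply: near_eq_cvg; near=> h.
have h0 : 0 < h by near: h; exact: nbhs_right_gt.
rewrite inc ?ltW// add0r; set u := P x (t + h); set v := P x h.
by rewrite -mulrBr mulrCA.
Unshelve. all: by end_near.
Qed.

End semigroup.

Section lyapunov.
Context {R : realType} {X : completeNormedModType R}.
Variables (T : R -> clin X X) (Q : {linear cdual X -> X}).
Hypotheses (T_semigroup : contraction_semigroup T)
  (Q_bounded : exists M : R, forall f, `|Q f| <= M * dual_norm f)
  (Q_sym : forall f g : cdual X, g (Q f) = f (Q g)).
Variables (Qt : R -> cdual X -> X) (Qoo : cdual X -> X) (mu : probability (borel X) R).
Hypotheses (Qt_def : forall t f, 0 < t ->
     is_integral 0 t (fun s => T s (Q (dual_map (T s) f))) (Qt t f))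
  (Qoo_def : forall f g : cdual X, (g (Qt t f) : R) @[t --> +oo] --> (g (Qoo f) : R))
  (mu_gauss : centred_gaussian mu) (mu_cov : covariance_operator mu Qoo).
Implicit Types (f g : cdual X) (x y : X) (s t h : R).

Local Notation quad f s := (f (T (Num.max s 0) (Q (dual_map (T (Num.max s 0)) f))) : R).

(** [Q] is controlled by the dual norm, in which the adjoint orbit of a general [f] need not be
    continuous. The Lipschitz part of [smooth_dual] makes the orbit Lipschitz in that norm, and the
    quadratic form with it. *)
Lemma quad_continuous f g : smooth_dual T f g -> continuous (fun s => quad f s).
Proof.
move=> [[M' MP'] _]; have [N N0 NP] := cdual_bounded f.
pose M := `|M'|; have M0 : 0 <= M by exact: normr_ge0.
have m0 s : 0 <= Num.max s 0 :> R by rewrite le_max lexx orbT.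
have MP h x : 0 <= h -> `|f (T h x) - f x : R| <= M * h * `|x|.
  by move=> h0; rewrite (le_trans (MP' _ _ h0))// !ler_wpM2r// ler_norm.
have [K [K0 KP]] : exists K : R, 0 <= K /\ forall f, `|Q f| <= K * dual_norm f.
  have [K KP] := Q_bounded; exists `|K|; split=> // f'.
  rewrite (le_trans (KP _))// ler_wpM2r ?ler_norm//.
  have [B B0 BP] := cdual_bounded f'; apply: ub_le_sup.
    by exists B => _ [z /= z1 <-]; rewrite (le_trans (BP z))// ler_piMr// ltW.
  by exists 0; rewrite /= ?normr0 ?ler01// raddf0 normr0.
pose F s : cdual X := dual_map (T (Num.max s 0)) f.
have FN s y : `|F s y : R| <= N * `|y|.
  by rewrite (le_trans (NP _))// ler_pM2l// (semigroup_contr T_semigroup).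
have maxl s t : s <= t -> `|Num.max t 0 - Num.max s 0| <= `|t - s|.
  move=> st; case: (leP s 0) => s0; case: (leP t 0) => t0; rewrite ?subr0 ?subrr ?normr0//.
  - by rewrite gtr0_norm// (le_trans _ (ler_norm _))// lerDl oppr_ge0.
  - by have := lt_le_trans s0 st; rewrite ltNge t0.
have Flip s t y : `|F t y - F s y : R| <= M * `|t - s| * `|y|.
  wlog st : s t / s <= t => [H|].
    by case: (leP s t) => [/H//|/ltW/H]; rewrite distrC (distrC s).
  set a := Num.max s 0; set b := Num.max t 0.
  have ab : a <= b by rewrite /a /b ge_max !le_max st lexx orbT.
  have -> : F t y = f (T (b - a) (T a y)) :> R.
    by rewrite -(semigroupD T_semigroup) ?subr_ge0// ?m0// subrK.
  rewrite (le_trans (MP _ _ _)) ?subr_ge0// -!mulrA ler_wpM2l// ler_pM ?subr_ge0//.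
    by rewrite -[b - a]ger0_norm ?subr_ge0// maxl.
  by rewrite (semigroup_contr T_semigroup)// m0.
have QN f' B : 0 <= B -> (forall y, `|f' y : R| <= B * `|y|) -> `|Q f'| <= K * B.
  by move=> B0 /(dual_norm_le B0) fB; rewrite (le_trans (KP _))// ler_wpM2l.
have lip s t : `|quad f t - quad f s| <= (2 * M * K * N) * `|t - s|.
  have -> : quad f t - quad f s = (F t - F s) (Q (F t)) + F s (Q (F t - F s)) :> R.
    have -> : quad f t - quad f s = F t (Q (F t)) - F s (Q (F s)) :> R by [].
    have -> : (F t - F s) (Q (F t)) = F t (Q (F t)) - F s (Q (F t)) :> R by [].
    by rewrite (linearB Q) (linearB (F s)) /= addrA subrK.
  have n0 : 0 <= M * `|t - s| by rewrite mulr_ge0.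
  have A1 : `|(F t - F s) (Q (F t)) : R| <= M * `|t - s| * (K * N).
    by rewrite (le_trans (Flip _ _ _))// ler_wpM2l// QN// ltW.
  have A2 : `|F s (Q (F t - F s)) : R| <= N * (K * (M * `|t - s|)).
    by rewrite (le_trans (FN _ _))// ler_pM2l// QN// => y; exact: Flip.
  rewrite (le_trans (ler_normD _ _))// (le_trans (lerD A1 A2))//.
  by rewrite le_eqVlt; apply/orP; left; apply/eqP; ring.
move=> s; apply/cvgrPdist_le => e e0; set L := 2 * M * K * N in lip.
have L1 : 0 < `|L| + 1 by rewrite ltr_wpDl.
have := nbhsx_ballx s _ (divr_gt0 e0 L1); apply: filterS => t; rewrite -ball_normE/= => st.
rewrite (le_trans (lip _ _))// (@le_trans _ _ ((`|L| + 1) * `|s - t|))//.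
  by rewrite ler_wpM2r// (le_trans (ler_norm L))// lerDl.
by rewrite -ler_pdivlMl// mulrC ltW.
Qed.

(** By the semigroup law, replacing [f] by its adjoint image at time [h] shifts the integrand of
    [Qt] by [h]. *)
Lemma Qt_quadratic f g (P : R -> R) : smooth_dual T f g ->
  (forall s, -1 < s -> is_derive s 1 P (quad f s)) ->
  forall h t, 0 <= h -> 0 < t ->
  dual_map (T h) f (Qt t (dual_map (T h) f)) = P (t + h) - P h :> R.
Proof.
move=> fg dP h t h0 t0.
have [_ +] := Qt_def (dual_map (T h) f) t0 (dual_map (T h) f).
have qc : continuous (fun s => quad f (s + h)).
  move=> s; apply: (continuous_comp (f := fun s => s + h) (g := fun s => quad f s)).
    by apply: cvgD; [exact: cvg_id|exact: cvg_cst].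
  exact: (quad_continuous fg).
have dS s : 0 <= s <= t -> is_derive s 1 (fun s => P (s + h)) (quad f (s + h)).
  move=> /andP[s0 _]; have sh : -1 < s + h by rewrite (@lt_le_trans _ _ 0) ?ltrN10// addr_ge0.
  have dsh : is_derive s 1 (fun u : R => u + h) 1.
    by apply: is_derive_eq; rewrite addr0.
  by have := @is_derive1_comp _ P (fun u => u + h) s _ _ (dP _ sh) dsh; rewrite mulr1.
have := integral_increment t0 qc dS; rewrite add0r => I1 I2.
apply: EFin_inj; rewrite -I2 -I1; apply: eq_integral => s.
rewrite inE/= in_itv/= => /andP[s0 _]; congr EFin.
have sh : 0 <= s + h by rewrite addr_ge0.
rewrite (max_l sh) /=.
have E : dual_map (T s) (dual_map (T h) f) = dual_map (T (s + h)) f.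
  by apply: val_inj; apply/funext => y /=; rewrite addrC (semigroupD T_semigroup).
by rewrite E addrC (semigroupD T_semigroup).
Qed.

(** The expectations of [cos (e n)] are [exp (- e n (Qoo (e n)) / 2)] and converge to a positive
    limit, so they stay away from 0 and the variances cannot escape to infinity. *)
Lemma gaussian_cvg_variance (e : nat -> cdual X) g :
  (forall x, (e n x : R) @[n --> \oo] --> (g x : R)) ->
  exists C : R, \forall n \near \oo, e n (Qoo (e n)) <= C.
Proof.
move=> eg.
have : \int[mu]_x cos (e n x : R) @[n --> \oo] --> \int[mu]_x cos (g x : R).
  apply: (@cvg_Rintegral _ _ _ _ _ _ (fun=> 1)).
  - by move=> n; apply: measurable_fun_cdual; exact: continuous_cos.
  - by apply: measurable_fun_cdual; exact: continuous_cos.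
  - by apply: aeW => x; apply: continuous_cvg => //; exact: continuous_cos.
  - exact: finite_measure_integrable_cst.
  - by move=> n x; rewrite ler_norml cos_geN1 cos_le1.
rewrite (E_cos mu_gauss mu_cov).
have -> : (fun n => \int[mu]_x cos (e n x : R)) = (fun n => expR (- (e n (Qoo (e n)) / 2))).
  by apply/funext => n; rewrite (E_cos mu_gauss mu_cov).
set b := g (Qoo g); move=> /cvgr_gt/(_ (expR (- b / 2 - 1))).
have /[swap]/[apply] : expR (- b / 2 - 1) < expR (- (b / 2)).
  by rewrite ltr_expR mulNr ltrBlDr ltrDl.
move=> H; exists (b + 2); apply: filterS H => n; rewrite ltr_expR; lra.
Qed.

(** Letting [t] tend to infinity in [Qt_quadratic] shows that along the adjoint orbit of [f] the
    quadratic form of [Qoo] equals [f (Qoo f) - (P h - P 0)]; the equation is the derivative of this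
    at [h = 0]. The difference quotients [e n] converge to [g] only pointwise, so the quadratic
    remainder [h * e n (Qoo (e n))] is controlled by [gaussian_cvg_variance]. *)
Lemma lyapunov f g : smooth_dual T f g -> 2 * g (Qoo f) = - f (Q f) :> R.
Proof.
move=> fg; have [P dP] := antiderivative (quad_continuous fg).
have dP0 : is_derive (0 : R) 1 P (f (Q f)).
  have := dP 0 (ltrN10 R); rewrite (max_l (lexx (0 : R))) !(semigroup0 T_semigroup).
  have -> : dual_map (T 0) f = f; last by [].
  by apply: val_inj; apply/funext => y /=; rewrite (semigroup0 T_semigroup).
have inv h : 0 <= h -> dual_map (T h) f (Qoo (dual_map (T h) f)) =
    f (Qoo f) - (P h - P 0) :> R.
  move=> h0; apply: (cvg_unique _ (Qoo_def (f := _) (g := _))) => //.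
  have f0 : dual_map (T 0) f = f.
    by apply: val_inj; apply/funext => y /=; rewrite (semigroup0 T_semigroup).
  have : (f (Qt (t + h) f) : R) - (P h - P 0) @[t --> +oo] --> (f (Qoo f) : R) - (P h - P 0).
    apply: cvgB; last exact: cvg_cst.
    apply: (@cvg_comp _ _ _ (fun t => t + h) (fun t => (f (Qt t f) : R)) _ _ _ (cvg_addrr h)).
    exact: Qoo_def.
  apply: cvg_trans; apply: near_eq_cvg; near=> t.
  have t0 : 0 < t by near: t; exact: nbhs_pinfty_gt.
  rewrite (Qt_quadratic fg dP h0 t0).
  have := Qt_quadratic fg dP (lexx 0) (ltr_wpDr h0 t0); rewrite f0 addr0 => ->.
  by ring.
pose e n : cdual X := n.+1%:R *: (dual_map (T n.+1%:R^-1) f - f).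
have eg x : (e n x : R) @[n --> \oo] --> (g x : R).
  have [_ /(_ x)/cvg_at_rightP] := fg.
  move=> /(_ (fun n => n.+1%:R^-1)).
  have -> : (fun n : nat => e n x : R) =
    (fun n : nat => (n.+1%:R^-1)^-1 * (f (T n.+1%:R^-1 x) - f x)).
    by apply/funext => n; rewrite invrK.
  by apply; split=> [n|]; [rewrite invr_gt0|exact: cvg_harmonic].
have [C CP] := gaussian_cvg_variance eg.
have id1 n : 2 * e n (Qoo f) + n.+1%:R^-1 * e n (Qoo (e n)) =
    - (n.+1%:R * (P (0 + n.+1%:R^-1) - P 0)) :> R.
  have n0 : n.+1%:R != 0 :> R by [].
  have h0 : 0 <= n.+1%:R^-1 :> R by rewrite invr_ge0.
  have := inv _ h0.
  have -> : dual_map (T n.+1%:R^-1) f = f + n.+1%:R^-1 *: e n.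
    by rewrite /e scalerA mulVf// scale1r subrKC.
  rewrite (cov_expand mu_cov) (covC mu_cov (e n)) => inv'.
  rewrite add0r; move: inv'; set u := P _; set v := P 0.
  set a := f (Qoo f); set b := e n (Qoo f); set c := e n _ => inv'.
  have -> : u - v = - (2 * n.+1%:R^-1 * b + n.+1%:R^-1 ^+ 2 * c).
    by move: inv'; set p := 2 * _ * b; set q := _ ^+ 2 * c; lra.
  by field.
have L1 : 2 * e n (Qoo f) + n.+1%:R^-1 * e n (Qoo (e n)) @[n --> \oo] --> (2 * g (Qoo f) + 0 : R).
  apply: cvgD; first by apply: cvgMl_tmp; exact: eg.
  have e0 n : 0 <= e n (Qoo (e n)) :> R.
    by rewrite -(covE mu_cov); apply: Rintegral_ge0 => x _; rewrite -expr2 sqr_ge0.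
  have lim0 : n.+1%:R^-1 * C @[n --> \oo] --> (0 : R).
    by rewrite -[X in _ --> X](mul0r C); apply: cvgMr_tmp; exact: cvg_harmonic.
  apply: (squeeze_cvgr _ (cvg_cst 0) lim0).
  apply: filterS CP => n Cn; have n0 : 0 <= n.+1%:R^-1 :> R by rewrite invr_ge0.
  by apply/andP; split; [exact: mulr_ge0 (e0 n)|exact: ler_wpM2l].
move: L1; rewrite (funext id1) addr0 => L1.
have L2 : - (n.+1%:R * (P (0 + n.+1%:R^-1) - P 0)) @[n --> \oo] --> - (f (Q f) : R).
  by apply: cvgN; exact: is_derive_harmonic.
exact: (cvg_unique _ L1 L2).
Unshelve. all: by end_near.
Qed.

End lyapunov.

Section direction_density.
Context {R : realType} {X : completeNormedModType R} {H : hilbertType R}.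
Variables (T : R -> clin X X) (Q : {linear cdual X -> X}).
Variables (i : clin H X) (istar : cdual X -> H).
Hypotheses (T_semigroup : contraction_semigroup T) (Hr : is_rkhs Q i istar).
Local Notation "[ x , y ]" := (@inner R H x y).
Implicit Types (f g : cdual X) (h k : H).

(** If [h] is orthogonal to all these elements, the means of the orbit of any [f] over short
    intervals vanish at [i h]. They tend to [f (i h)], so every functional vanishes there. *)
Lemma istar_smooth_dense k (e : R) : 0 < e ->
  exists f g, smooth_dual T f g /\ `|k - istar f| < e.
Proof.
move=> e0; pose S := [set h | exists f g, smooth_dual T f g /\ istar f = h].
suff [_ [f [g [fg <-]]] ke] : exists2 h, S h & `|k - h| < e by exists f, g.
apply: orthogonal_dense e0.
- have s00 : smooth_dual T 0 0.
    split=> [|x]; first by exists 0 => h x _; rewrite subrr normr0 !mul0r.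
    rewrite (_ : (fun _ => _) = fun=> 0); first exact: cvg_cst.
    by apply/funext => h; rewrite subrr mulr0.
  exists 0, 0; split=> //; have := istar_linear Hr (-1) 0 0.
  by rewrite scaler0 addr0 scaleN1r addNr.
- move=> a _ _ [f [g [fg <-]]] [f' [g' [fg' <-]]].
  exists (a *: f + f'), (a *: g + g'); split; first exact: smooth_dual_linear.
  exact: (istar_linear Hr).
- move=> h hS; apply: (rkhs_perp Hr) => f.
  have [P dP] := antiderivative (orbit_continuous T_semigroup (f := f) (x := i h)).
  have P0 n : n.+1%:R * (P (0 + n.+1%:R^-1) - P 0) = 0.
    have n0 : 0 < n.+1%:R^-1 :> R by rewrite invr_gt0.
    have [ft [g [fg /(_ _ _ dP)]]] := mean_smooth T_semigroup f n0.
    rewrite invrK add0r => <-.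
    by rewrite -(istarE Hr); apply: hS; exists ft, g.
  have := is_derive_harmonic (dP 0 (ltrN10 R)).
  rewrite (funext P0) orbitE// (semigroup0 T_semigroup) => /(cvg_unique _ (cvg_cst (0:R))) H0.
  by rewrite H0.
Qed.

Variables (Qt : R -> cdual X -> X) (Qoo : cdual X -> X) (mu : probability (borel X) R).
Hypotheses (Q_bounded : exists M : R, forall f, `|Q f| <= M * dual_norm f)
  (Qt_def : forall t f, 0 < t ->
     is_integral 0 t (fun s => T s (Q (dual_map (T s) f))) (Qt t f))
  (Qoo_def : forall f g : cdual X, (g (Qt t f) : R) @[t --> +oo] --> (g (Qoo f) : R))
  (mu_gauss : centred_gaussian mu) (mu_cov : covariance_operator mu Qoo).
Variables (DA : set X) (A : X -> X).
Hypothesis A_gen : generates DA A T.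
Hypothesis hQA : exists2 c : R, 0 < c & forall f g : cdual X, adjoint_at DA A f g ->
     exists2 h : H, i h = Qoo g & `|h| <= c * `|istar f|.

(* [i h = Qoo g], tested against the dual: integration by parts against [g]
   differentiates along [h]. *)
Definition direction h g := forall f, f (i h) = f (Qoo g) :> R.

(* For [h] with [i h = Qoo A^* f], the Lyapunov equation reads
   [2 <i^* f, h> = - |i^* f|^2], so that (3) bounds [|i^* f|] by a multiple of
   the distance from [i^* f] to any [k] orthogonal to all these [h]. *)
Lemma direction_dense k (e : R) : 0 < e ->
  exists h g, direction h g /\ `|k - h| < e.
Proof.
move=> e0; pose S := [set h | exists g, direction h g].
suff [h [g hg] ke] : exists2 h, S h & `|k - h| < e by exists h, g.
apply: orthogonal_dense e0.
- by exists 0 => f; rewrite linear0 (covC mu_cov) linear0.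
- move=> a h h' [g hg] [g' hg']; exists (a *: g + g') => f.
  rewrite linearP linearP /= hg hg' (covC mu_cov g f) (covC mu_cov g' f).
  by rewrite (covC mu_cov (a *: g + g') f).
- move=> h hS; have [c c0 cP] := hQA.
  suff small (r : R) : 0 < r -> `|h| <= (2 * c + 1) * r.
    apply/eqP; rewrite -normr_le0; apply/ler_addgt0Pr => r r0; rewrite add0r.
    have q0 : 0 < 2 * c + 1 by rewrite addr_gt0// mulr_gt0.
    by have := small (r / (2 * c + 1)) (divr_gt0 r0 q0); rewrite mulrC divfK// gt_eqF.
  move=> r0; have [f [g [fg hf]]] := istar_smooth_dense h r0.
  have [k' k'E k'le] := cP _ _ (smooth_dual_adjoint A_gen fg).
  have Sk' : [k', h] = 0 by apply: hS; exists g => f'; rewrite k'E.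
  have := lyapunov T_semigroup Q_bounded Qt_def Qoo_def mu_gauss mu_cov fg.
  rewrite (covC mu_cov) -k'E -(istarE Hr) -(rkhs_inner Hr) inner_norm => Eq.
  have E2 : `|istar f| ^+ 2 = 2 * [h - istar f, k'].
    by rewrite innerBl (innerC h) Sk' sub0r mulrN Eq opprK.
  have le1 : `|istar f| ^+ 2 <= 2 * (r * (c * `|istar f|)).
    rewrite E2 ler_pM2l// (le_trans (ler_norm _))// (le_trans (inner_le _ _))//.
    by rewrite ler_pM// ltW.
  have le2 : `|istar f| <= 2 * c * r.
    have [->|f0] := eqVneq (`|istar f|) 0; first by rewrite !mulr_ge0// ltW.
    have fp : 0 < `|istar f| by rewrite lt_neqAle eq_sym f0 /=.
    by rewrite -(ler_pM2r fp) -expr2 (le_trans le1)// le_eqVlt; apply/orP; left; apply/eqP; ring.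
  rewrite -(subrK (istar f) h) (le_trans (ler_normD _ _))// mulrDl mul1r addrC lerD// ltW//.
Qed.

End direction_density.

(** * Finiteness of the weighted measure *)

Section hahn_banach.
Context {R : realType} {X : lmodType R}.
Implicit Types (p q : X -> R) (x y z : X) (c r s : R).

(** Homogeneity is asked as an inequality for [c > 0]: equality follows on scaling back by [c^-1],
    and an inequality is easily inherited by infima. *)
Definition sublinear q :=
  (forall x y, q (x + y) <= q x + q y) /\ (forall c x, 0 < c -> q (c *: x) <= c * q x).

Lemma sublinear0 q : sublinear q -> q 0 = 0.
Proof.
move=> [qD qZ]; apply/le_anti/andP; split.
  by have := qZ 2^-1 0; rewrite scaler0 invr_gt0 ltr0n => /(_ isT); lra.
by have := qD 0 0; rewrite addr0; lra.
Qed.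

Lemma sublinear_ge q x : sublinear q -> - q (- x) <= q x.
Proof. by move=> sq; have := sq.1 x (- x); rewrite subrr (sublinear0 sq); lra. Qed.

(** Serves three infima: over the perturbations of a minimal functional, over a chain, and over the
    cone that yields the affine minorant of a convex function. *)
Lemma sublinear_inf (S : X -> set R) : (forall x, has_inf (S x)) ->
  (forall x y r s, S x r -> S y s -> exists2 m, S (x + y) m & m <= r + s) ->
  (forall c x r, 0 < c -> S x r -> exists2 m, S (c *: x) m & m <= c * r) ->
  sublinear (fun x => inf (S x)).
Proof.
move=> iS SD SZ; split=> [x y|c x c0].
  rewrite -lerBlDr; apply: lb_le_inf => [|r Sr]; first by have [] := iS x.
  rewrite lerBlDr -lerBlDl; apply: lb_le_inf => [|s Ss]; first by have [] := iS y.
  have [m Sm mle] := SD _ _ _ _ Sr Ss; rewrite lerBlDl (le_trans _ mle)//.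
  by apply: ge_inf => //; have [] := iS (x + y).
rewrite -ler_pdivrMl//; apply: lb_le_inf => [|r Sr]; first by have [] := iS x.
rewrite ler_pdivrMl//; have [m Sm mle] := SZ _ _ _ c0 Sr.
by rewrite (le_trans _ mle)//; apply: ge_inf => //; have [] := iS (c *: x).
Qed.

(** The functional [z -> inf_{s >= 0} q (z + s y) - s q y] is sublinear and at most [q], hence equal
    to [q] by minimality; its bound at [s = 1] makes [q] superadditive. *)
Lemma minimal_sublinear_linear q : sublinear q ->
  (forall q', sublinear q' -> (forall x, q' x <= q x) -> q' = q) ->
  forall c x y, q (c *: x + y) = c * q x + q y.
Proof.
move=> sq qmin; have [qD qZ] := sq; have q0 := sublinear0 sq.
have qsup x y : q x + q y <= q (x + y).
  pose S z := [set r | exists2 s, 0 <= s & r = q (z + s *: y) - s * q y].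
  have sy s : 0 <= s -> q (s *: y) <= s * q y.
    by rewrite le_eqVlt => /predU1P[<-|/qZ//]; rewrite scale0r mul0r q0.
  have Slb z : lbound (S z) (- q (- z)).
    move=> _ [s s0 ->]; have := qD (z + s *: y) (- z); rewrite addrAC subrr add0r => le1.
    have sq' : s * q y <= q (s *: y).
      move: s0; rewrite le_eqVlt => /predU1P[<-|s0]; first by rewrite scale0r mul0r q0.
      have := qZ s^-1 (s *: y); rewrite scalerA mulVf ?gt_eqF// scale1r invr_gt0 => /(_ s0).
      by rewrite ler_pdivlMl.
    lra.
  have iS z : has_inf (S z).
    by split; [exists (q (z + 0 *: y) - 0 * q y); exists 0|exists (- q (- z))].
  have sS : sublinear (fun z => inf (S z)).
    apply: sublinear_inf => // [z z' _ _ [s s0 ->] [t t0 ->]|c z _ c0 [s s0 ->]].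
      exists (q (z + z' + (s + t) *: y) - (s + t) * q y); first by exists (s + t) => //; exact: addr_ge0.
      have := qD (z + s *: y) (z' + t *: y); rewrite addrACA -scalerDl; lra.
    exists (q (c *: z + (c * s) *: y) - c * s * q y); first by exists (c * s); rewrite ?mulr_ge0// ltW.
    by have := qZ c (z + s *: y) c0; rewrite scalerDr scalerA; lra.
  have Sq : (fun z => inf (S z)) = q.
    apply: qmin => // z; apply: ge_inf; first by exists (- q (- z)).
    by exists 0 => //; rewrite scale0r mul0r addr0 subr0.
  have := congr1 (fun f => f x) Sq => <- /=.
  rewrite -lerBrDr; apply: ge_inf; first by exists (- q (- x)).
  by exists 1; rewrite // scale1r mul1r.
have qadd x y : q (x + y) = q x + q y by apply/le_anti; rewrite qD qsup.
have qN x : q (- x) = - q x.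
  by apply/eqP; rewrite eq_sym -subr_eq0 -opprD oppr_eq0 -qadd subrr q0.
have qP c x : 0 < c -> q (c *: x) = c * q x.
  move=> c0; apply/le_anti; rewrite qZ//=.
  by have := qZ c^-1 (c *: x); rewrite scalerA mulVf ?gt_eqF// scale1r invr_gt0 ler_pdivlMl// => /(_ c0).
move=> c x y; rewrite qadd; congr (_ + _).
case: (ltgtP c 0) => [c0|/qP->//|->]; last by rewrite scale0r mul0r q0.
by have := qP (- c) x; rewrite oppr_gt0 scaleNr qN mulNr => /(_ c0)/oppr_inj.
Qed.

(* A minimal element among the sublinear functionals below [p] is linear. *)
Lemma hahn_banach p : sublinear p -> exists l : X -> R,
  (forall c x y, l (c *: x + y) = c * l x + l y) /\ forall x, l x <= p x.
Proof.
move=> sp; pose P q := sublinear q /\ forall x, q x <= p x.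
pose r (a b : {q | P q}) := `[< forall x, sval b x <= sval a x >].
have [||a b|F Fr|[q [sq qp]] qmax] := @Zorn {q | P q} r.
- by move=> a; apply/asboolP.
- by move=> b a c /asboolP ab /asboolP bc; apply/asboolP => x; exact: le_trans (bc x) (ab x).
- move=> /asboolP ab /asboolP ba; apply: eq_sig_hprop => [x|]; first exact: Prop_irrelevance.
  by apply/funext => x; apply/le_anti; rewrite ba ab.
- have [[a0 Fa0]|F0] := pselect (F !=set0); last first.
    by exists (exist P p (conj sp (fun x => lexx (p x)))) => a Fa; exfalso; apply: F0; exists a.
  pose S x := [set sval a x | a in F].
  have Slb x : lbound (S x) (- p (- x)).
    move=> _ [[q [sq qp]] _ <-] /=.
    by rewrite (le_trans _ (sublinear_ge x sq))// lerN2.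
  have iS x : has_inf (S x) by split; [exists (sval a0 x); exists a0|exists (- p (- x))].
  have sS : sublinear (fun x => inf (S x)).
    apply: sublinear_inf => // [x y _ _ [a Fa <-] [b Fb <-]|c x _ c0 [a Fa <-]].
      have [/asboolP ab|/asboolP ba] := Fr a b Fa Fb.
        exists (sval b (x + y)); first by exists b.
        by have [[bD _] _] := svalP b; rewrite (le_trans (bD x y))// lerD2r.
      exists (sval a (x + y)); first by exists a.
      by have [[aD _] _] := svalP a; rewrite (le_trans (aD x y))// lerD2l.
    exists (sval a (c *: x)); first by exists a.
    by have [[_ aZ] _] := svalP a; exact: aZ.
  have Sle a x : F a -> inf (S x) <= sval a x.
    by move=> Fa; apply: ge_inf; [exists (- p (- x))|exists a].
  have Sp : P (fun x => inf (S x)).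
    by split=> // x; rewrite (le_trans (Sle a0 x Fa0))//; have [_] := svalP a0.
  by exists (exist P _ Sp) => a Fa; apply/asboolP => x /=; exact: Sle.
exists q; split=> //; apply: minimal_sublinear_linear => // q' sq' q'q.
have Pq' : P q' by split=> // x; exact: le_trans (q'q x) (qp x).
have rq : r (exist P q (conj sq qp)) (exist P q' Pq') by apply/asboolP.
exact: (congr1 sval (qmax _ rq)).
Qed.

End hahn_banach.

(** * Affine minorants of convex functions *)

Section affine_minorant.
Context {R : realType} {X : completeNormedModType R}.
Variable U : X -> \bar R.
Hypotheses (U_proper : proper_fun U) (U_lsc : lower_semicontinuous U)
  (U_convex : convex_fun U).

(** Lower semicontinuity keeps [U] above [a - 1] on a ball of radius [d] around [x0]. For [x]
    outside it, the point at distance [d / 2] from [x0] on the segment towards [x] lies in this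
    ball, and convexity carries the bound on to [x] with slope [C = 2 / d]. *)
Lemma convex_norm_minorant : exists x0 (a C : R),
  [/\ U x0 = a%:E, 0 < C & forall x, ((a - 1 - C * `|x - x0|)%:E <= U x)%E].
Proof.
have [UN [x0 x0P]] := U_proper.
have [a Ua] : exists a, U x0 = a%:E.
  by move: (UN x0) x0P; case: (U x0) => // a _ _; exists a.
have [|V /nbhs_ballP[d /= d0 dV] VU] := U_lsc (x := x0) (a := a - 1).
  by rewrite Ua lte_fin ltrBlDr ltrDl.
pose C := (d / 2)^-1; have d2 : 0 < d / 2 by rewrite divr_gt0.
have C0 : 0 < C by rewrite invr_gt0.
exists x0, a, C; split=> // x.
have [xd|xd] := ltP (`|x - x0|) d.
  apply: (@le_trans _ _ (a - 1)%:E).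
    by rewrite lee_fin gerBl mulr_ge0// ltW.
  by apply/ltW/VU/dV; rewrite -ball_normE/= distrC.
set n := `|x - x0| in xd *; have n0 : 0 < n by rewrite (lt_le_trans d0).
pose t := d / 2 / n; have t0 : 0 < t by rewrite divr_gt0.
have t1 : t <= 1 by rewrite ler_pdivrMr// mul1r (le_trans _ xd)// ler_pdivrMr// ler_peMr ?ler1n// ltW.
have : V (t *: x + (1 - t) *: x0).
  apply: dV; rewrite -ball_normE/=.
  have -> : x0 - (t *: x + (1 - t) *: x0) = t *: (x0 - x).
    by rewrite scalerBl scale1r scalerBr; set y := t *: x; set z := t *: x0;
       rewrite opprD opprB addrCA subrKC addrC.
  rewrite normrZ gtr0_norm// distrC -/n divfK ?gt_eqF//.
  by rewrite ltr_pdivrMr// ltr_pMr// ltr1n.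
move=> /VU/lt_le_trans/(_ (U_convex x x0 (t := t) _)); rewrite (ltW t0) t1 => /(_ isT).
rewrite Ua; move: (UN x); case: (U x) => // [b _|_ _]; last by rewrite leey.
rewrite -!EFinM -EFinD lte_fin lee_fin => H.
have tC : t * (C * n) = 1.
  by rewrite /t /C; field; rewrite !gt_eqF.
rewrite -(ler_pM2l t0) !mulrBr tC mulr1; lra.
Qed.

(** Hahn-Banach is applied to the infimum, over [x] in the domain and [t >= 0], of
    [t * V x + C * |z - t x|]. A linear functional below it is at most [V] (take [t = 1] and
    [z = x]) and at most [C * |z|] (take [t = 0]), hence continuous. *)
Lemma convex_affine_minorant : exists (l : cdual X) (c : R),
  forall x, ((l x + c)%:E <= U x)%E.
Proof.
have [x0 [a [C [Ua C0 Ule]]]] := convex_norm_minorant.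
have C0' := ltW C0.
pose D := [set x | U (x + x0) != +oo%E].
(* The shift by [1 - a] turns the bound of [convex_norm_minorant] into [V x >= - C * |x|], which is
   what bounds the infimum from below. *)
pose V x := fine (U (x + x0)) - a + 1.
have UV x : D x -> U (x + x0) = (V x + a - 1)%:E.
  by rewrite /V/D/=; have [/(_ (x + x0))] := U_proper; case: (U _) => // b _ _ _; congr EFin => /=; ring.
have Vle x : D x -> - (C * `|x|) <= V x.
  by move=> /UV E; have := Ule (x + x0); rewrite E lee_fin addrK; lra.
have Vconv x y (t : R) : 0 <= t <= 1 -> D x -> D y ->
    D (t *: x + (1 - t) *: y) /\ V (t *: x + (1 - t) *: y) <= t * V x + (1 - t) * V y.
  move=> t01 Dx Dy; have := U_convex (x + x0) (y + x0) t01.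
  have -> : t *: (x + x0) + (1 - t) *: (y + x0) = t *: x + (1 - t) *: y + x0.
    by rewrite !scalerDr addrACA -scalerDl addrC subrKC // scale1r addrC.
  rewrite (UV x Dx) (UV y Dy) -!EFinM -EFinD => H.
  have Dz : D (t *: x + (1 - t) *: y).
    by rewrite /D/=; apply: contraTN H => /eqP ->; rewrite leye_eq.
  by split=> //; move: H; rewrite UV// lee_fin; lra.
have D0 : D 0 by rewrite /D/= add0r Ua.
pose S z := [set r | exists x t, [/\ D x, 0 <= t & r = t * V x + C * `|z - t *: x|]].
have Slb z : lbound (S z) (- (C * `|z|)).
  move=> _ [x [t [Dx t0 ->]]].
  have h1 := ler_wpM2l t0 (Vle x Dx).
  have h2 : C * `|z| + C * `|z - t *: x| >= C * (t * `|x|).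
    rewrite -mulrDr ler_pM2l// -[X in X * `|x|](ger0_norm t0) -normrZ.
    by rewrite -[X in `|X| <= _](subKr z) (le_trans (ler_normB _ _)).
  by move: h1 h2; rewrite mulrN mulrCA; lra.
have iS z : has_inf (S z).
  split; last by exists (- (C * `|z|)).
  by exists (0 * V 0 + C * `|z - 0 *: 0|); exists 0, 0.
have sS : sublinear (fun z => inf (S z)).
  apply: sublinear_inf => // [z z' _ _ [x [t [Dx t0 ->]]] [y [s [Dy s0 ->]]]|
      c z _ c0 [x [t [Dx t0 ->]]]].
    have [ts0|ts0] := eqVneq (t + s) 0.
      have t00 : t = 0 by lra.
      have s00 : s = 0 by lra.
      exists (0 * V 0 + C * `|z + z' - 0 *: 0|); first by exists 0, 0.
      by rewrite t00 s00 !scale0r !mul0r !subr0 !add0r -mulrDr ler_pM2l// ler_normD.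
    have tsp : 0 < t + s by rewrite lt_neqAle eq_sym ts0 addr_ge0.
    pose w := t / (t + s).
    have w1 : 1 - w = s / (t + s) by rewrite /w; field.
    have w01 : 0 <= w <= 1.
      by rewrite divr_ge0 ?(ltW tsp)//= ler_pdivrMr// mul1r lerDl.
    have [Dxy Vxy] := Vconv x y w w01 Dx Dy.
    exists ((t + s) * V (w *: x + (1 - w) *: y) +
        C * `|z + z' - (t + s) *: (w *: x + (1 - w) *: y)|).
      by exists (w *: x + (1 - w) *: y), (t + s); split=> //; exact: ltW.
    have e1 : (t + s) * w = t by rewrite mulrC divfK.
    have e2 : (t + s) * (1 - w) = s by rewrite w1 mulrC divfK.
    rewrite scalerDr !scalerA e1 e2 opprD addrACA.
    have h1 := ler_wpM2l (ltW tsp) Vxy.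
    have h0 : (t + s) * (w * V x + (1 - w) * V y) = t * V x + s * V y.
      by rewrite w1 /w; field.
    rewrite h0 in h1.
    have h2 : C * `|z - t *: x + (z' - s *: y)| <= C * `|z - t *: x| + C * `|z' - s *: y|.
      by rewrite -mulrDr ler_pM2l// ler_normD.
    lra.
  exists (c * t * V x + C * `|c *: z - (c * t) *: x|).
    by exists x, (c * t); split=> //; rewrite mulr_ge0// ltW.
  rewrite -scalerA -scalerBr normrZ gtr0_norm//.
  by rewrite le_eqVlt; apply/orP; left; apply/eqP; ring.
have [l [llin lS]] := hahn_banach sS.
have lle z : l z <= C * `|z|.
  apply: (le_trans (lS z)); apply: ge_inf; first by exists (- (C * `|z|)).
  by exists 0, 0; rewrite scale0r mul0r subr0 add0r.
have [|l' l'E] := cdual_of_bounded llin (M := C).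
  move=> z; rewrite ler_norml lle andbT lerNl.
  have := llin (-1) z 0; rewrite addr0 scaleN1r.
  have l0 : l 0 = 0 by have := llin 1 0 0; rewrite scaler0 addr0; lra.
  by rewrite l0 mulN1r addr0 => <-; rewrite (le_trans (lle _))// normrN.
exists l', (a - 1 - l x0) => x; have [->|Dx] := eqVneq (U x) +oo%E; first by rewrite leey.
have Dx0 : D (x - x0) by rewrite /D/= subrK.
have Ex := UV _ Dx0; rewrite subrK in Ex; rewrite Ex lee_fin l'E.
have le1 : l (x - x0) <= V (x - x0).
  apply: (le_trans (lS _)); apply: ge_inf; first by exists (- (C * `|x - x0|)).
  by exists (x - x0), 1; rewrite scale1r mul1r subrr normr0 mulr0 addr0.
have := llin (-1) x0 x; rewrite scaleN1r addrC mulN1r => E.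
rewrite E in le1; lra.
Qed.

End affine_minorant.

Section weighted_measure.
Context {R : realType} {X : completeNormedModType R}.
Variables (mu : probability (borel X) R) (Qoo : cdual X -> X).
Hypotheses (mu_gauss : centred_gaussian mu) (mu_cov : covariance_operator mu Qoo).
Variables (U : X -> \bar R) (u : borel X -> R) (nu : {measure set (borel X) -> \bar R}).
Hypotheses (U_proper : proper_fun U) (U_lsc : lower_semicontinuous U)
  (U_convex : convex_fun U) (mu_u : measurable_fun setT u)
  (Uu : {ae mu, forall x : borel X, U x = (u x)%:E})
  (nu_def : forall B : set (borel X), measurable B ->
     nu B = (\int[mu]_(x in B) expeR (- U x))%E).

Lemma lsc_measurable : measurable_fun setT (U : borel X -> \bar R).
Proof.
apply: (measurability _ (ErealGenOInfty.measurableE R)).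
move=> /= _ [_ [a ->]] <-; apply: measurableI => //; apply: open_borel.
by rewrite preimage_itvoy; move/lower_semicontinuousP : U_lsc; exact.
Qed.

Let mexp : measurable_fun setT (fun x : borel X => expeR (- U x)).
Proof.
apply: (measurability _ (ErealGenOInfty.measurableE R)).
move=> /= _ [_ [a ->]] <-; apply: measurableI => //; rewrite preimage_itvoy.
(* For [a > 0], [a < exp (- U x)] means [U x < - ln a]; for [a = 0] it means [U x < +oo]. *)
pose c : \bar R := if a == 0 then +oo%E else (- ln a)%:E.
have [a0|a0] := ltP a 0.
  rewrite (_ : [set _ | _] = setT)//; apply/seteqP; split=> // x _ /=.
  by rewrite (@lt_le_trans _ _ 0%E)// ?lte_fin// expeR_ge0.
rewrite (_ : [set _ | _] = [set x | (U x < c)%E]).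
  by have := lsc_measurable measurableT (emeasurable_itv `]-oo, c[); rewrite setTI set_itvNyo.
apply/seteqP; split=> x /=; rewrite /c; have [->|an0] := eqVneq a 0.
- by case: (U x) => [r||] //=; rewrite ?ltxx ?ltry ?ltNyr.
- have -> : a%:E = expeR (ln a)%:E by rewrite /= lnK// posrE lt_neqAle eq_sym an0.
  by rewrite lte_expeR lteNr.
- by case: (U x) => [r||] //= _; rewrite ?lte_fin ?expR_gt0// ltey.
- have -> : a%:E = expeR (ln a)%:E by rewrite /= lnK// posrE lt_neqAle eq_sym an0.
  by rewrite lte_expeR lteNr.
Qed.

Lemma weighted_finite : (nu setT < +oo)%E.
Proof.
rewrite nu_def//; have [l [c lU]] := convex_affine_minorant U_proper U_lsc U_convex.
have il := integrable_expR_cdual mu_gauss (-1) l.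
have := itgZ (expR (- c)) il; set w := (fun x => _) => iw.
have le_w x : (expeR (- U x) <= (w x)%:E)%E.
  rewrite /w -expRD -[(expR _)%:E]/(expeR _%:E) lee_expeR.
  have := lU x; rewrite -leeN2 => /le_trans; apply.
  by rewrite -EFinN lee_fin; lra.
apply: (@le_lt_trans _ _ (\int[mu]_x (w x)%:E)%E).
  apply: ge0_le_integral => //; first by move=> x _; exact: expeR_ge0.
  by have /integrableP[] := iw.
exact: integral_fune_lt_pinfty iw.
Qed.

(** [U] may be infinite on a null set; from here on the density is expressed by its real
    representative [u]. *)
Lemma weighted_density (B : set (borel X)) : measurable B ->
  nu B = (\int[mu]_(x in B) (expR (- u x))%:E)%E.
Proof.
move=> mB; rewrite nu_def//; apply: ae_eq_integral => //.
- exact: measurable_funTS mexp.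
- apply/measurable_EFinP; apply: measurable_funTS; apply: measurableT_comp => //.
  exact: measurableT_comp.
- by apply: filterS Uu => x Ux _; rewrite Ux.
Qed.

End weighted_measure.

Lemma continuous_powR_norm (R : realType) (p : R) : 0 < p ->
  continuous (fun y : R => `|y| `^ p).
Proof.
move=> p0 y; have [->|y0] := eqVneq y 0.
  apply/cvgrPdist_le => e e0; rewrite normr0 powR0 ?gt_eqF//.
  have := nbhsx_ballx (0 : R) _ (powR_gt0 p^-1 e0); apply: filterS => z.
  rewrite -ball_normE/= !sub0r !normrN (ger0_norm (powR_ge0 _ _)) => zp.
  rewrite -[leRHS]powRr1 ?(ltW e0)// -[X in _ <= _ `^ X](mulVf (lt0r_neq0 p0)) powRrM.
  by rewrite ge0_ler_powR ?nnegrE ?powR_ge0// ltW.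
apply: (@continuous_comp _ _ _ (fun y : R => `|y|) (fun z => z `^ p)); first exact: norm_continuous.
apply: differentiable_continuous; apply/derivable1_diffP.
have y1 : 0 < `|y| by rewrite normr_gt0.
by have [] := is_derive1_powR p y1.
Qed.

(** * Completeness of L^p *)

Section Lnorm_tools.
Context d (T : measurableType d) {R : realType} (m : {measure set T -> \bar R}) (p : R).
Hypothesis p1 : 1 <= p.
Implicit Types (a b c : T -> R) (e : R).
Local Notation N a := (Lnorm m p%:E (fun x => (a x)%:E)).

Let p0 : 0 < p. Proof. exact: lt_le_trans p1. Qed.
Let pn0 : p != 0. Proof. by rewrite gt_eqF. Qed.

Lemma measurable_powR_norm a : measurable_fun setT a ->
  measurable_fun setT (fun x => (`|a x| `^ p)%:E).
Proof.
move=> ma; apply/measurable_EFinP.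
by apply: (measurableT_comp (measurable_powR p)); exact: measurableT_comp.
Qed.

Lemma LnormE a : N a = ((\int[m]_x (`|a x| `^ p)%:E) `^ p^-1)%E.
Proof. by rewrite unlock /Lnorm; congr poweR; apply: eq_integral => x _ /=. Qed.

Lemma Lnorm_leP a e : 0 <= e ->
  (N a <= e%:E)%E <-> (\int[m]_x (`|a x| `^ p)%:E <= (e `^ p)%:E)%E.
Proof.
move=> e0; rewrite LnormE; set I : \bar R := integral _ _ _.
have I0 : (0 <= I)%E by apply: integral_ge0 => x _; rewrite lee_fin powR_ge0.
have IE : I = ((I `^ p^-1) `^ p)%E by rewrite -poweRrM mulVf// poweRe1.
have eE : e = (e `^ p) `^ p^-1 by rewrite -powRrM divff// powRr1.
split=> H.
  rewrite IE -poweR_EFin; apply: gt0_ler_poweR; first exact: ltW.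
  - by rewrite in_itv/= poweR_ge0 leey.
  - by rewrite in_itv/= lee_fin e0 leey.
  - exact: H.
have -> : e%:E = ((e `^ p)%:E `^ p^-1)%E by rewrite poweR_EFin -eE.
apply: gt0_ler_poweR; first by rewrite invr_ge0 ltW.
  by rewrite in_itv/= I0 leey.
  by rewrite in_itv/= lee_fin powR_ge0 leey.
exact: H.
Qed.

Lemma le_Lnorm a b : measurable_fun setT a -> measurable_fun setT b ->
  {ae m, forall x, `|a x| <= `|b x|} -> (N a <= N b)%E.
Proof.
move=> ma mb ab; rewrite !LnormE.
have I0 c : (0 <= \int[m]_x (`|c x| `^ p)%:E)%E.
  by apply: integral_ge0 => x _; rewrite lee_fin powR_ge0.
apply: gt0_ler_poweR; first by rewrite invr_ge0 ltW.
- by rewrite in_itv/= I0 leey.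
- by rewrite in_itv/= I0 leey.
apply: ae_ge0_le_integral => //; first exact: measurable_powR_norm.
  exact: measurable_powR_norm.
by apply: filterS ab => x abx _; rewrite lee_fin ge0_ler_powR ?nnegrE// ltW.
Qed.

Lemma Lnorm_leD a b c : measurable_fun setT a -> measurable_fun setT b ->
  measurable_fun setT c -> {ae m, forall x, `|c x| <= `|a x| + `|b x|} ->
  (N c <= N a + N b)%E.
Proof.
move=> ma mb mc cab.
have mN (f : T -> R) : measurable_fun setT f -> measurable_fun setT (fun x => `|f x|).
  by move=> mf; exact: measurableT_comp.
apply: (@le_trans _ _ (N (fun x => `|a x| + `|b x|))).
  apply: le_Lnorm => //; first by apply: measurable_funD; exact: mN.
  by apply: filterS cab => x; rewrite [X in _ -> _ <= X]ger0_norm// addr_ge0.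
have /le_trans := @minkowski_EFin _ _ _ m (fun x => `|a x|) (fun x => `|b x|) p
  (mN _ ma) (mN _ mb) p1; apply.
by apply: leeD; apply: le_Lnorm => //; rewrite ?normr_id; first [exact: mN|apply: aeW => x; rewrite normr_id].
Qed.

Lemma Lnorm_leZ a b e : measurable_fun setT a -> measurable_fun setT b -> 0 <= e ->
  {ae m, forall x, `|b x| <= e * `|a x|} -> (N b <= e%:E * N a)%E.
Proof.
move=> ma mb e0 ba.
apply: (@le_trans _ _ (N (fun x => e * a x))).
  apply: le_Lnorm => //; first exact: measurable_funM.
  by apply: filterS ba => x; rewrite normrM (ger0_norm e0).
rewrite !LnormE.
under eq_integral do rewrite normrM powRM// (ger0_norm e0) EFinM.
rewrite ge0_integralZl_EFin//.
- rewrite poweRM ?lee_fin ?powR_ge0//; last first.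
    by apply: integral_ge0 => x _; rewrite lee_fin powR_ge0.
  by rewrite poweR_EFin -powRrM divff// powRr1.
- exact: measurable_powR_norm.
- exact: powR_ge0.
Qed.

Lemma Lfun_intro a : measurable_fun setT a -> (N a < +oo)%E -> a \in Lfun m p%:E.
Proof. by move=> ma Na; apply/andP; split; rewrite inE. Qed.

Lemma Lfun_measurable a : a \in Lfun m p%:E -> measurable_fun setT a.
Proof. by case/andP; rewrite inE. Qed.

Lemma Lfun_norm_lty a : a \in Lfun m p%:E -> (N a < +oo)%E.
Proof. by case/andP => _; rewrite inE. Qed.

(** The bound holds only eventually, so Fatou's lemma is applied to a shifted sequence. *)
Lemma Lnorm_fatou (a_ : nat -> T -> R) a e : 0 <= e ->
  (forall k, measurable_fun setT (a_ k)) -> (forall x, a_ k x @[k --> \oo] --> a x) ->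
  (\forall k \near \oo, (N (a_ k) <= e%:E)%E) -> (N a <= e%:E)%E.
Proof.
move=> e0 ma aa [K _ Ke]; apply/Lnorm_leP => //.
have mf k : measurable_fun setT (fun x => (`|a_ (k + K)%N x| `^ p)%:E).
  exact: measurable_powR_norm.
have := @fatou _ T R m setT measurableT (fun k x => (`|a_ (k + K)%N x| `^ p)%:E) mf
  ltac:(by move=> k x _; rewrite lee_fin powR_ge0).
under eq_integral => x _.
  have -> : limn_einf (fun k => (`|a_ (k + K)%N x| `^ p)%:E) = (`|a x| `^ p)%:E.
    have cv : (`|a_ (k + K)%N x| `^ p)%:E @[k --> \oo] --> (`|a x| `^ p)%:E.
      apply: cvg_EFin; first exact: nearW.
      apply: (@continuous_cvg _ _ _ _ _ _ (fun y => `|y| `^ p)).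
        exact: continuous_powR_norm.
      have := aa x; rewrite -(@cvg_shiftn K); exact.
    by rewrite is_cvg_limn_einfE ?(cvg_lim _ cv)//; apply/cvg_ex; exists (`|a x| `^ p)%:E.
  over.
move=> /le_trans; apply; rewrite limn_einf_lim; apply: lime_le; first exact: is_cvg_einfs.
apply: nearW => k; apply: (@le_trans _ _ (\int[m]_x (`|a_ (k + K)%N x| `^ p)%:E)%E).
  by apply: ereal_inf_lbound; exists k => /=.
by apply/Lnorm_leP => //; apply: Ke; rewrite /= leq_addl.
Qed.

End Lnorm_tools.

Lemma ereal_cvg0P (R : realType) (u : nat -> \bar R) : (forall n, 0 <= u n)%E ->
  u n @[n --> \oo] --> 0%E <->
  forall e : R, 0 < e -> exists K, forall n, (K <= n)%N -> (u n <= e%:E)%E.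
Proof.
move=> u0; split=> [/fine_cvgP[uf /cvgrPdist_le cu] e e0|H].
  have [K _ KP] := filterI uf (cu e e0); exists K => n /KP[fu].
  by rewrite /= sub0r normrN ger0_norm ?fine_ge0// -lee_fin fineK.
apply/fine_cvgP; split.
  have [K KP] := H 1 ltr01; exists K => // n /= /KP u1.
  by rewrite ge0_fin_numE// (le_lt_trans u1)// ltry.
apply/cvgrPdist_le => e e0; have [K KP] := H e e0; exists K => // n /= /KP ue.
rewrite sub0r normrN ger0_norm ?fine_ge0// -lee_fin fineK//.
by rewrite ge0_fin_numE// (le_lt_trans ue)// ltry.
Qed.

Section finite_measure_tools.
Context d (T : measurableType d) {R : realType} (m : {measure set T -> \bar R}) (p : R).
Hypotheses (p1 : 1 <= p) (m_fin : (m setT < +oo)%E).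
Implicit Types (a b c : T -> R) (e : R).
Local Notation N a := (Lnorm m p%:E (fun x => (a x)%:E)).

Lemma Lnorm_bounded a e : 0 <= e -> measurable_fun setT a -> (forall x, `|a x| <= e) ->
  (N a < +oo)%E.
Proof.
move=> e0 ma ae; rewrite LnormE poweR_lty//.
apply: (@le_lt_trans _ _ (\int[m]_x (e `^ p)%:E)%E).
  apply: ge0_le_integral => //.
  - exact: measurable_powR_norm.
  - by move=> x _; rewrite lee_fin ge0_ler_powR ?nnegrE// (le_trans ler01).
rewrite integral_cst// lte_mul_pinfty// lee_fin powR_ge0//.
Qed.

(** Hoelder's inequality against the constant 1; the summand 1 added to the constant keeps it
    positive. *)
Lemma Lnorm1_le : exists2 C : R, 0 < C & forall a, measurable_fun setT a ->
  (\int[m]_x `|(a x)%:E| <= C%:E * N a)%E.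
Proof.
move: p1; rewrite le_eqVlt => /predU1P[<-|p1'].
  by exists 1 => // a ma; rewrite mul1e Lnorm1.
pose q := (1 - p^-1)^-1.
have p0 : 0 < p by exact: lt_trans p1'.
have q0 : 0 < q by rewrite invr_gt0 subr_gt0 invf_lt1.
have pq : p^-1 + q^-1 = 1 by rewrite /q invrK subrKC.
have c1 : (Lnorm m q%:E (fun=> 1%:E) < +oo)%E.
  by rewrite Lnorm_cst1 poweR_lty.
exists (fine (Lnorm m q%:E (fun=> 1%:E)) + 1) => [|a ma].
  by rewrite ltr_wpDl// fine_ge0// Lnorm_ge0.
rewrite -Lnorm1.
have := @hoelder _ _ _ m a (cst 1) p q ma (measurable_cst _) p0 q0 pq.
rewrite (_ : (EFin \o (a \* cst 1)) = (fun x => (a x)%:E)); last first.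
  by apply/funext => x /=; rewrite mulr1.
move=> /le_trans; apply; rewrite muleC lee_wpmul2r ?Lnorm_ge0//.
by rewrite EFinD fineK ?leeDl// ge0_fin_numE// Lnorm_ge0.
Qed.

(* Borel-Cantelli in L^1 form: summable norms force pointwise summability. *)
Lemma summable_ae (v : nat -> T -> R) (C : R) : (forall k, measurable_fun setT (v k)) ->
  (forall k x, 0 <= v k x) ->
  (forall k, \int[m]_x (v k x)%:E <= (C * (1/2) ^+ k)%:E)%E ->
  exists A : set T, [/\ measurable A, m (~` A) = 0 &
    forall x, A x -> cvgn (series (fun k => v k x))].
Proof.
move=> mv v0 vC.
pose S x := (\sum_(0 <= k <oo) (v k x)%:E)%E.
have S0 x : (0 <= S x)%E by apply: nneseries_ge0 => k _ _; rewrite lee_fin.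
have mS : measurable_fun setT S.
  apply: ge0_emeasurable_sum => [k x _ _|k _]; first by rewrite lee_fin.
  exact/measurable_EFinP.
have C0 : 0 <= C.
  have := vC 0%N; rewrite expr0 mulr1 => /(le_trans _); rewrite -lee_fin; apply.
  by apply: integral_ge0 => x _; rewrite lee_fin.
have IS : (\int[m]_x S x < +oo)%E.
  rewrite integral_nneseries//; last 2 first.
    by move=> k; exact/measurable_EFinP.
    by move=> k x _; rewrite lee_fin.
  apply: (@le_lt_trans _ _ (C * 2)%:E); last exact: ltry.
  apply: lime_le; first by apply: is_cvg_nneseries => k _ _; apply: integral_ge0 => x _; rewrite lee_fin.
  apply: nearW => k; apply: (@le_trans _ _ (\sum_(0 <= j < k) (C * (1/2) ^+ j)%:E)%E).
    by apply: lee_sum => j _; exact: vC.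
  rewrite sumEFin lee_fin -mulr_sumr ler_wpM2l// big_mkord.
  have := subrX1 (1 / 2 : R) k => H.
  have : 0 <= (1 / 2 : R) ^+ k by rewrite exprn_ge0// divr_ge0.
  lra.
exists [set x | (S x < +oo)%E]; split.
- by have := mS measurableT _ (emeasurable_itv `]-oo, +oo%E[); rewrite setTI set_itvNyo.
- have iS : m.-integrable setT S.
    apply/integrableP; split=> //.
    by under eq_integral do rewrite gee0_abs//.
  have [B [mB B0 SB]] := integrable_ae measurableT iS.
  apply: subset_measure0 B0 => //; last first.
    by move=> x /= Sx; apply: SB => /= /(_ I); rewrite ge0_fin_numE.
  apply: measurableC.
  by have := mS measurableT _ (emeasurable_itv `]-oo, +oo%E[); rewrite setTI set_itvNyo.
move=> x /= Sx; apply: nondecreasing_is_cvgn.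
  by apply: nondecreasing_series => k _ _.
exists (fine (S x)) => _ [k _ <-]; rewrite -lee_fin fineK ?ge0_fin_numE//.
rewrite /series/= -sumEFin; apply: nneseries_lim_ge => j _ _; by rewrite lee_fin.
Qed.

End finite_measure_tools.

Section riesz_fischer.
Context d (T : measurableType d) {R : realType} (m : {measure set T -> \bar R}) (p : R).
Hypotheses (p1 : 1 <= p) (m_fin : (m setT < +oo)%E).
Context {E : completeNormedModType R}.
Variable meas : set (T -> E).
Hypotheses (meas_sub : forall F G, meas F -> meas G ->
    measurable_fun setT (fun x => `|F x - G x|))
  (meas_cut : forall (A : set T) F, measurable A -> meas F ->
    meas (fun x => if x \in A then F x else 0))
  (meas_cvg : forall (F_ : nat -> T -> E) F, (forall n, meas (F_ n)) ->
    (forall x, F_ n x @[n --> \oo] --> F x) -> meas F).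
Implicit Types (F G : T -> E) (e : R).
Local Notation N F G := (Lnorm m p%:E (fun x => `|F x - G x|%:E)).

Lemma cauchy_subsequence (N : nat -> nat -> \bar R) :
  (forall e, 0 < e -> exists K, forall i j, (K <= i)%N -> (K <= j)%N -> (N i j <= e%:E)%E) ->
  exists s : nat -> nat, (forall k, (k <= s k)%N) /\
    forall k, (N (s k.+1) (s k) <= ((1/2) ^+ k)%:E)%E.
Proof.
move=> cN.
have /choice[K KP] (k : nat) : exists K, forall i j, (K <= i)%N -> (K <= j)%N ->
    (N i j <= ((1/2) ^+ k)%:E)%E.
  by apply: cN; rewrite exprn_gt0.
pose s := fix s k := if k is k'.+1 then maxn (maxn k (K k)) (s k') else K 0%N.
have sK k : (K k <= s k)%N by case: k => //= k; rewrite !leq_max leqnn orbT.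
exists s; split; first by case=> //= k; rewrite !leq_max leqnn.
move=> k; apply: KP => //; rewrite (leq_trans (sK k))//= leq_max leqnn orbT//.
Qed.

(** [meas] stands for measurability of real functions and of functions with values in a Hilbert
    space, so that one proof serves both. A subsequence with steps at most [2^-k] converges almost
    everywhere; setting it to 0 off a set of convergence defines the limit everywhere, and Fatou's
    lemma gives convergence in norm of the whole sequence. *)
Lemma riesz_fischer (F_ : nat -> T -> E) : (forall n, meas (F_ n)) ->
  (forall e, 0 < e -> exists K, forall i j, (K <= i)%N -> (K <= j)%N ->
    (N (F_ i) (F_ j) <= e%:E)%E) ->
  exists2 F, meas F & forall e, 0 < e -> exists K, forall n, (K <= n)%N ->
    (N (F_ n) F <= e%:E)%E.
Proof.
move=> mF cF; have [s [sk sN]] := cauchy_subsequence cF.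
pose v k x := `|F_ (s k.+1) x - F_ (s k) x|.
have mv k : measurable_fun setT (v k) by exact: meas_sub.
have [C C0 NC] := Lnorm1_le p1 m_fin.
have v0 k x : 0 <= v k x by exact: normr_ge0.
have vC k : (\int[m]_x (v k x)%:E <= (C * (1/2) ^+ k)%:E)%E.
  have := NC _ (mv k); under eq_integral do rewrite gee0_abs ?lee_fin//.
  move=> /le_trans; apply; rewrite EFinM lee_wpmul2l ?lee_fin ?(ltW C0)//; exact: sN.
have [A [mA A0 AP]] := summable_ae mv v0 vC.
have cA x : A x -> cvgn (fun k => F_ (s k) x).
  move=> Ax; have /normed_cvg : cvgn [normed series (fun k => F_ (s k.+1) x - F_ (s k) x)].
    exact: AP.
  have -> : series (fun k => F_ (s k.+1) x - F_ (s k) x) =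
      (fun k => F_ (s k) x - F_ (s 0%N) x).
    by rewrite -[LHS]/(series (telescope (fun k => F_ (s k) x))) telescopeK.
  move=> /cvg_ex[l cl]; apply/cvg_ex; exists (l + F_ (s 0%N) x).
  have -> : (fun k => F_ (s k) x) = (fun k => F_ (s k) x - F_ (s 0%N) x + F_ (s 0%N) x).
    by apply/funext => k; rewrite subrK.
  by apply: cvgD => //; exact: cvg_cst.
pose F' k x := if x \in A then F_ (s k) x else 0.
pose F x := lim (F' k x @[k --> \oo]).
have F'F x : F' k x @[k --> \oo] --> F x.
  rewrite /F /F'; have [xA|xA] := boolP (x \in A); last exact: is_cvg_cst.
  by apply: cA; exact: set_mem.
have mF' k : meas (F' k) by exact: meas_cut.
have mFl : meas F by exact: meas_cvg mF' F'F.
exists F => // e e0; have [K KP] := cF e e0; exists K => n Kn.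
apply: (@Lnorm_fatou _ _ _ _ _ p1 (fun k x => `|F_ n x - F' k x|)) => //.
- exact: ltW.
- by move=> k; exact: meas_sub.
- by move=> x; apply: cvg_norm; apply: cvgB => //; exact: cvg_cst.
exists K => // k /= Kk; apply: (@le_trans _ _ (N (F_ n) (F_ (s k)))); last first.
  by apply: KP => //; rewrite (leq_trans Kk).
apply: (le_Lnorm p1); [exact: meas_sub|exact: meas_sub|].
exists (~` A); split; [exact: measurableC|exact: A0|].
by move=> x /=; apply: contra_not => Ax; rewrite /F' mem_set.
Qed.

End riesz_fischer.

(** * Closability *)

Section logistic.
Context {R : realType}.
Implicit Types s t p : R.

(** Its derivative [- eta * (1 - eta)] is bounded by [eta] itself, so the weight survives
    differentiation. *)
Definition eta s : R := (1 + expR s)^-1.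

Let den_gt0 s : 0 < 1 + expR s. Proof. by rewrite addr_gt0// expR_gt0. Qed.

Lemma eta_gt0 s : 0 < eta s. Proof. by rewrite invr_gt0. Qed.

Lemma eta_lt1 s : eta s < 1.
Proof. by rewrite invf_lt1// ltrDl expR_gt0. Qed.

Lemma eta_norm s : `|eta s| <= 1.
Proof. by rewrite ger0_norm ?ltW ?eta_gt0 ?eta_lt1. Qed.

Lemma is_derive_eta s : is_derive s 1 eta (- (eta s * (1 - eta s))).
Proof.
have dn0 : 1 + expR s != 0 by rewrite gt_eqF.
have d1 : is_derive s 1 (fun t : R => 1 + expR t) (expR s).
  have -> : (fun t : R => 1 + expR t) = (cst (1 : R) : R -> R) + (expR : R -> R) by [].
  by apply: is_derive_eq; rewrite add0r.
have := @is_deriveV _ (fun t => 1 + expR t) s (expR s) _ dn0 d1.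
rewrite /eta /GRing.scale/= => d2; apply: is_derive_eq.
by rewrite /GRing.scale/=; move: (expR s) dn0 => E n0; field.
Qed.

Lemma eta_continuous : continuous eta.
Proof.
move=> s; apply: differentiable_continuous; apply/derivable1_diffP.
by have [] := is_derive_eta s.
Qed.

Lemma eta_slope_norm s : `|eta s * (1 - eta s)| <= 1.
Proof.
have e0 := eta_gt0 s; have e1 := eta_lt1 s.
rewrite ger0_norm; last by rewrite mulr_ge0 ?subr_ge0// ltW.
by rewrite mulr_ile1 ?subr_ge0 ?ltW// ltrBlDr ltrDl.
Qed.

Lemma eta_slope_continuous : continuous (fun s => - (eta s * (1 - eta s))).
Proof.
move=> s; apply: cvgN; apply: cvgM; first exact: eta_continuous.
by apply: cvgB; [exact: cvg_cst|exact: eta_continuous].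
Qed.

(** For [s > 0] the bound [exp (s / p) <= exp s] is used, for [s <= 0] the bound [exp (s / p) <= 1];
    the denominator [1 + exp s] dominates both. *)
Lemma eta_weight p s : 1 <= p -> `|eta s * expR (p^-1 * s)| <= 1.
Proof.
move=> p1; have p0 : 0 < p by exact: lt_le_trans p1.
have h0 : 0 <= eta s * expR (p^-1 * s) by rewrite mulr_ge0 ?expR_ge0// ltW ?eta_gt0.
rewrite (ger0_norm h0) mulrC ler_pdivrMr// mul1r.
have [s0|s0] := leP 0 s.
  rewrite (@le_trans _ _ (expR s))//; last by rewrite lerDr.
  by rewrite ler_expR ler_piMl// invf_le1.
rewrite (@le_trans _ _ 1)//; last by rewrite lerDl expR_ge0.
by rewrite -expR0 ler_expR pmulr_rle0 ?invr_gt0// ltW.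
Qed.

End logistic.

Section closability.
Context {R : realType} {X : completeNormedModType R} {H : hilbertType R}.
Variables (i : clin H X) (istar : cdual X -> H) (mu : probability (borel X) R)
  (Qoo : cdual X -> X).
Hypotheses (istarE : forall (f : cdual X) h, inner (istar f) h = f (i h))
  (mu_gauss : centred_gaussian mu) (mu_cov : covariance_operator mu Qoo).
Variable e : nat -> H.
Hypothesis e_dense : forall h (r : R), 0 < r -> exists n, `|h - e n| < r.
Implicit Types (f : X -> R) (F : X -> H) (h : H) (g : cdual X).
Local Notation "''E' u" := (Rintegral mu setT u) (at level 10, u at level 8).

Lemma DH_ibp f F h g : DH istar f F -> direction i Qoo h g ->
  'E (fun x => inner (F x) h) = 'E (fun x => f x * g x).
Proof.
move=> [n [phi [xs [Hphi -> ->]]]] hg.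
rewrite -(gaussian_ibp mu_gauss mu_cov xs g Hphi); apply: eq_Rintegral => x _.
by rewrite inner_suml; apply: eq_bigr => j _; rewrite innerZl istarE hg mulrC.
Qed.

Lemma DH_eta f F : DH istar f F ->
  DH istar (eta \o f) (fun x => - (eta (f x) * (1 - eta (f x))) *: F x).
Proof.
move=> fF; apply: (DH_comp fF (@is_derive_eta R) (@eta_slope_continuous R)).
  by exists 1; exact: eta_norm.
by exists 1 => t; rewrite normrN eta_slope_norm.
Qed.

Lemma DH_measurable f F : DH istar f F ->
  measurable_fun setT (f : borel X -> R) /\ measurable_fun setT (F : borel X -> borel H).
Proof.
move=> fF; split.
  by apply: continuous_borel_measurable; exact: DH_continuous fF.
by apply: continuous_borel_measurableH; exact: DH_continuous_grad fF.
Qed.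

Lemma measurable_innerr F h : measurable_fun setT (F : borel X -> borel H) ->
  measurable_fun setT (fun x : borel X => inner (F x) h).
Proof.
move=> mF; apply: (measurableT_comp (f := (fun y => inner y h) : borel H -> R)) mF.
by apply: continuous_borel_measurable; exact: inner_continuous.
Qed.

Lemma DH_inner_bounded f F h : DH istar f F ->
  exists M : R, forall x, `|inner (F x) h| <= M.
Proof.
move=> /DH_bounded_grad[M MP]; exists (M * `|h|) => x.
by rewrite (le_trans (inner_le _ _))// ler_wpM2r.
Qed.

(** On a finite measure both convergences pass to [L^1]; with a geometric rate the functions also
    converge almost everywhere, which is what composing them with [eta] requires. *)
Lemma DH_closure_subseq (m : {measure set (borel X) -> \bar R}) (q : R) f F :
  1 <= q -> (m setT < +oo)%E -> DH_closure istar m q f F ->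
  exists (f_ : nat -> X -> R) (F_ : nat -> X -> H) (C : R),
    [/\ forall k, DH istar (f_ k) (F_ k), 0 < C,
      {ae m, forall x : borel X, f_ k x @[k --> \oo] --> f x},
      forall k, (\int[m]_x `|f_ k x - f x|%:E <= (C * (1/2) ^+ k)%:E)%E &
      forall k, (\int[m]_x `|F_ k x - F x|%:E <= (C * (1/2) ^+ k)%:E)%E].
Proof.
move=> q1 mfin [/Lfun_measurable mf [mF _] [f_ [F_ [DHk fc Fc]]]].
have [C C0 CP] := Lnorm1_le q1 mfin.
have /choice[s sP] (k : nat) : exists n,
    (Lnorm m q%:E (fun x => (f_ n x - f x)%:E) <= ((1/2)^+k)%:E)%E /\
    (Lnorm m q%:E (fun x => `|F_ n x - F x|%:E) <= ((1/2)^+k)%:E)%E.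
  have e0 : 0 < (1/2 : R) ^+ k by rewrite exprn_gt0.
  have [K1 K1P] := (ereal_cvg0P (fun n => Lnorm_ge0 _ _ _)).1 fc _ e0.
  have [K2 K2P] := (ereal_cvg0P (fun n => Lnorm_ge0 _ _ _)).1 Fc _ e0.
  by exists (maxn K1 K2); split; [apply: K1P|apply: K2P]; rewrite ?leq_maxl ?leq_maxr.
have mdf k : measurable_fun setT (fun x : borel X => f_ (s k) x - f x).
  by apply: measurable_funB => //; have [] := DH_measurable (DHk (s k)).
have If k : (\int[m]_x `|f_ (s k) x - f x|%:E <= (C * (1/2) ^+ k)%:E)%E.
  have := CP _ (mdf k); under eq_integral do rewrite abse_EFin.
  move=> /le_trans; apply; rewrite EFinM lee_wpmul2l ?lee_fin ?(ltW C0)//.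
  by have [] := sP k.
have IF k : (\int[m]_x `|F_ (s k) x - F x|%:E <= (C * (1/2) ^+ k)%:E)%E.
  have mk : measurable_fun setT (fun x : borel X => `|F_ (s k) x - F x|).
    by apply: (measurable_norm_sub e_dense) => //; have [] := DH_measurable (DHk (s k)).
  have := CP _ mk; under eq_integral do rewrite abse_EFin normr_id.
  move=> /le_trans; apply; rewrite EFinM lee_wpmul2l ?lee_fin ?(ltW C0)//.
  by have [] := sP k.
exists (fun k => f_ (s k)), (fun k => F_ (s k)), C; split=> //.
have mv k : measurable_fun setT (fun x : borel X => `|f_ (s k) x - f x|).
  exact: measurableT_comp.
have [A [mA A0 AP]] := summable_ae mv (fun k x => normr_ge0 _) If.
exists (~` A); split=> //; first exact: measurableC.
move=> x /=; apply: contra_not => Ax.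
have /cvg_series_cvg_0 c0 := AP x Ax.
have : f_ (s k) x - f x @[k --> \oo] --> 0 by apply/norm_cvg0P.
move=> /(cvgD (cvg_cst (f x))); rewrite addr0; apply: cvg_trans.
by apply: near_eq_cvg; apply: nearW => k; rewrite subrKC.
Qed.

Lemma integral_cvg0 (C c : R) (v : nat -> R) : 
  (forall k, `|v k| <= c * (C * (1/2) ^+ k)) -> v k @[k --> \oo] --> 0.
Proof.
move=> vC; apply/norm_cvg0P.
have l0 : c * (C * (1/2) ^+ k) @[k --> \oo] --> (0 : R).
  rewrite -[X in _ --> X](mulr0 c) -[in X in _ --> X](mulr0 C).
  apply: cvgMl_tmp; apply: cvgMl_tmp; apply: cvg_expr.
  by rewrite ger0_norm// ltr_pdivrMr// mul1r ltr1n.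
by apply: (squeeze_cvgr _ (cvg_cst 0) l0); apply: nearW => k; rewrite normr_ge0 vC.
Qed.

Section weight.
Variables (q : R) (u : X -> R) (G : X -> H).
Hypotheses (q1 : 1 <= q) (uG : DH_closure istar mu q u G).

Let mu_u : measurable_fun setT (u : borel X -> R).
Proof. by have [/Lfun_measurable] := uG. Qed.

Let mG : measurable_fun setT (G : borel X -> borel H).
Proof. by have [_ []] := uG. Qed.

Let mu_fin : (mu setT < +oo)%E.
Proof. by rewrite probability_setT ltry. Qed.

Lemma measurable_eta : measurable_fun setT (fun x : borel X => eta (u x)).
Proof.
apply: (measurableT_comp (f := eta)) => //.
exact: continuous_measurable_fun eta_continuous.
Qed.

Lemma itg_grad h : itg mu (fun x => inner (G x) h).
Proof.
have [_ [_ LG] _] := uG.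
have iG : itg mu (fun x => `|G x|).
  by apply/Lfun1_integrable; apply: Lfun_subset LG => //; rewrite ?lee_fin// ge0_fin_numE.
apply: (@itg_le _ _ _ _ (fun x => `|h| * `|G x|)); first exact: measurable_innerr.
  by move=> x; rewrite mulrC inner_le.
exact: itgZ.
Qed.

(** Integration by parts for the cylindrical function [f * eta (u_ k)], then [k] to infinity.
    Bounded factors pass by dominated convergence; the gradient of [u_ k] is first replaced by [G],
    at an error small in [L^1] because its coefficient is bounded. *)
Lemma weighted_ibp f F h g : DH istar f F -> direction i Qoo h g ->
  'E (fun x => eta (u x) * inner (F x) h) =
  'E (fun x => f x * eta (u x) * g x) +
  'E (fun x => f x * (eta (u x) * (1 - eta (u x))) * inner (G x) h).
Proof.
move=> fF hg.
have [u_ [U_ [C [uU C0 uu _ UG]]]] := DH_closure_subseq q1 mu_fin uG.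
have [mf mF] := DH_measurable fF.
have [M MP] := DH_bounded fF.
have [M' M'P] := DH_inner_bounded h fF.
have meta k : measurable_fun setT (fun x : borel X => eta (u_ k x)).
  apply: (measurableT_comp (f := eta)); first exact: continuous_measurable_fun eta_continuous.
  by have [] := DH_measurable (uU k).
have M0 : 0 <= M by exact: le_trans (MP 0).
pose kap (s : R) := eta s * (1 - eta s).
have mkap (w : borel X -> R) : measurable_fun setT (fun x => eta (w x)) ->
    measurable_fun setT (fun x => kap (w x)).
  by move=> mw; apply: measurable_funM => //; exact: measurable_funB.
have ckap : continuous kap.
  move=> s; apply: cvgM; first exact: eta_continuous.
  by apply: cvgB; [exact: cvg_cst|exact: eta_continuous].
have mi K : measurable_fun setT (K : borel X -> borel H) ->
  measurable_fun setT (fun x : borel X => inner (K x) h) by exact: measurable_innerr.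
have iFk k : itg mu (fun x => eta (u_ k x) * inner (F x) h).
  apply: (@itg_bounded _ _ _ _ (M')); first by apply: measurable_funM => //; exact: mi.
  by move=> x; rewrite normrM (le_trans (ler_wpM2r _ (eta_norm _)))// mul1r.
have /choice[MU MUP] (k : nat) : exists M' : R, forall x, `|inner (U_ k x) h| <= M'.
  exact: (DH_inner_bounded h (uU k)).
have fk_le k x : `|f x * kap (u_ k x)| <= M.
  by rewrite normrM (le_trans (ler_pM _ _ (MP x) (eta_slope_norm _)))// mulr1.
have mfk k : measurable_fun setT (fun x : borel X => f x * kap (u_ k x)).
  by apply: measurable_funM => //; exact: mkap.
have iUk k : itg mu (fun x => f x * kap (u_ k x) * inner (U_ k x) h).
  apply: (@itg_bounded _ _ _ _ (M * MU k)).
    by apply: measurable_funM => //; apply: mi; have [] := DH_measurable (uU k).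
  by move=> x; rewrite normrM ler_pM.
have iGk k : itg mu (fun x => f x * kap (u_ k x) * inner (G x) h).
  have := itgM_bounded (itg_grad h) (mfk k) (fk_le k).
  by congr (is_true (itg mu _)); apply/funext => x; rewrite mulrC.
have step k : 'E (fun x => eta (u_ k x) * inner (F x) h) =
    'E (fun x => f x * eta (u_ k x) * g x) +
    'E (fun x => f x * kap (u_ k x) * inner (U_ k x) h).
  have := DH_ibp (DH_M fF (DH_eta (uU k))) hg => <-.
  have iS : itg mu (fun x => inner (f x *: (- (eta (u_ k x) * (1 - eta (u_ k x))) *: U_ k x) +
      (eta \o u_ k) x *: F x) h).
    have := itgB (iFk k) (iUk k); congr (is_true (itg mu _)); apply/funext => x.
    by rewrite innerDl !innerZl /kap /=; ring.
  rewrite -(RintegralD _ iS (iUk k))//.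
  by apply: eq_Rintegral => x _; rewrite innerDl !innerZl /kap /=; ring.
have cu (s : R -> R) : continuous s ->
    {ae mu, forall x : borel X, s (u_ k x) @[k --> \oo] --> s (u x)}.
  by move=> cs; apply: filterS uu => x ux; apply: continuous_cvg ux; exact: cs.
have L1 : 'E (fun x => eta (u_ k x) * inner (F x) h) @[k --> \oo] -->
    'E (fun x => eta (u x) * inner (F x) h).
  apply: (@cvg_Rintegral _ _ _ _ _ _ (fun=> M')) => //.
  - by move=> k; apply: measurable_funM => //; exact: mi.
  - by apply: measurable_funM; [exact: measurable_eta|exact: mi].
  - apply: filterS (cu _ (@eta_continuous R)) => x cx.
    by apply: cvgMr_tmp.
  - exact: itg_cst.
  - by move=> k x; rewrite normrM (le_trans (ler_wpM2r _ (eta_norm _)))// mul1r.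
have L2 : 'E (fun x => f x * eta (u_ k x) * g x) @[k --> \oo] -->
    'E (fun x => f x * eta (u x) * g x).
  apply: (@cvg_Rintegral _ _ _ _ _ _ (fun x : borel X => (M * `|g x : R|)%R)) => //.
  - by move=> k; apply: measurable_funM; [exact: measurable_funM|exact: measurable_cdual].
  - apply: measurable_funM; last exact: measurable_cdual.
    by apply: measurable_funM => //; exact: measurable_eta.
  - apply: filterS (cu _ (@eta_continuous R)) => x cx.
    by apply: cvgMr_tmp; apply: cvgMl_tmp.
  - by apply: itgZ; apply: itg_norm; exact: (itg_cdual mu_cov).
  - move=> k x; rewrite normrM ler_wpM2r// normrM.
    by rewrite (le_trans (ler_pM _ _ (MP x) (eta_norm _)))// mulr1.
have L3 : 'E (fun x => f x * kap (u_ k x) * inner (G x) h) @[k --> \oo] -->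
    'E (fun x => f x * kap (u x) * inner (G x) h).
  apply: (@cvg_Rintegral _ _ _ _ _ _ (fun x : borel X => (M * `|inner (G x) h|)%R)) => //.
  - by move=> k; apply: measurable_funM => //; exact: mi.
  - apply: measurable_funM; last exact: mi.
    by apply: measurable_funM => //; apply: mkap; exact: measurable_eta.
  - apply: filterS (cu _ ckap) => x cx.
    by apply: cvgMr_tmp; apply: cvgMl_tmp.
  - by apply: itgZ; apply: itg_norm; exact: itg_grad.
  - by move=> k x; rewrite normrM ler_wpM2r.
have L4 : 'E (fun x => f x * kap (u_ k x) * inner (U_ k x) h) -
    'E (fun x => f x * kap (u_ k x) * inner (G x) h) @[k --> \oo] --> 0.
  apply: (@integral_cvg0 C (M * `|h|)) => k.
  have mUG : measurable_fun setT (fun x : borel X => `|U_ k x - G x|).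
    by apply: (measurable_norm_sub e_dense) => //; have [] := DH_measurable (uU k).
  have iUG : itg mu (fun x => `|U_ k x - G x|).
    apply/integrableP; split; first exact/measurable_EFinP.
    rewrite (le_lt_trans _ (ltry (C * (1/2) ^+ k)))//.
    by have := UG k; under [X in (_ <= _)%E -> (X <= _)%E]eq_integral do rewrite /= normr_id.
  apply: (@le_trans _ _ ('E (fun x => M * `|h| * `|U_ k x - G x|))).
    apply: E_dist => //; first exact: itgZ.
    move=> x; rewrite -mulrBr -innerBl normrM -mulrA ler_pM//.
    by rewrite mulrC inner_le.
  rewrite RintegralZl// ler_wpM2l ?mulr_ge0// -lee_fin /Rintegral fineK ?UG//.
  exact: integrable_fin_num.
suff L5 : 'E (fun x => eta (u_ k x) * inner (F x) h) @[k --> \oo] -->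
    'E (fun x => f x * eta (u x) * g x) +
    (0 + 'E (fun x => f x * (eta (u x) * (1 - eta (u x))) * inner (G x) h)).
  by rewrite (cvg_unique _ L1 L5) // add0r.
have -> : (fun k => 'E (fun x => eta (u_ k x) * inner (F x) h)) =
    (fun k => 'E (fun x => f x * eta (u_ k x) * g x) +
      ('E (fun x => f x * kap (u_ k x) * inner (U_ k x) h) -
       'E (fun x => f x * kap (u_ k x) * inner (G x) h) +
       'E (fun x => f x * kap (u_ k x) * inner (G x) h))).
  by apply/funext => k; rewrite step subrK.
by apply: cvgD => //; exact: cvgD.
Qed.

Variables (p : R) (nu : {measure set (borel X) -> \bar R}).
Hypotheses (p1 : 1 < p) (pq : p^-1 + q^-1 = 1)
  (nu_density : forall B : set (borel X), measurable B ->
     nu B = (\int[mu]_(x in B) (expR (- u x))%:E)%E).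
Local Notation Np f := (Lnorm nu p%:E (fun x => (f x)%:E)).
Local Notation Nq f := (Lnorm mu q%:E (fun x => (f x)%:E)).

Let p0 : 0 < p. Proof. exact: lt_trans p1. Qed.
Let q0 : 0 < q. Proof. exact: lt_le_trans q1. Qed.

Lemma measurable_expRN (c : R) : measurable_fun setT (fun x : borel X => expR (- (c * u x))).
Proof. by do 2!apply: measurableT_comp => //; exact: measurable_funM. Qed.

Lemma Lnorm_density f : measurable_fun setT (f : borel X -> R) ->
  Lnorm mu p%:E (fun x => (f x * expR (- (p^-1 * u x)))%:E) = Np f.
Proof.
move=> mf; rewrite !LnormE; congr poweR.
have mexp : measurable_fun setT (fun x : borel X => expR (- u x)).
  by have := measurable_expRN 1; congr measurable_fun; apply/funext => x; rewrite mul1r.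
rewrite (ge0_integral_density mexp (fun x => expR_ge0 _) nu_density).
- apply: eq_integral => x _; rewrite -EFinM; congr EFin.
  rewrite normrM powRM// (ger0_norm (expR_ge0 _)); congr (_ * _).
  by rewrite -expRM mulNr mulrAC mulVf ?gt_eqF// mul1r.
- exact: measurable_powR_norm.
- by move=> x; rewrite lee_fin powR_ge0.
Qed.

(* The weight [eta u] compensates [e^(u/p)], so that it trades the L^p norm
   for [nu] of one factor against the L^q norm for [mu] of the other. *)
Lemma weighted_hoelder f w : measurable_fun setT (f : borel X -> R) ->
  measurable_fun setT (w : borel X -> R) ->
  (\int[mu]_x `|f x * w x * eta (u x)|%:E <= Np f * Nq w)%E.
Proof.
move=> mf mw; rewrite -Lnorm_density//.
pose f1 x := f x * expR (- (p^-1 * u x)).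
pose w1 x := w x * (eta (u x) * expR (p^-1 * u x)).
have me : measurable_fun setT (fun x : borel X => eta (u x) * expR (p^-1 * u x)).
  apply: measurable_funM; first exact: measurable_eta.
  by apply: measurableT_comp => //; exact: measurable_funM.
have mf1 : measurable_fun setT (f1 : borel X -> R).
  by apply: measurable_funM => //; exact: measurable_expRN.
have mw1 : measurable_fun setT (w1 : borel X -> R) by exact: measurable_funM.
have -> : (\int[mu]_x `|f x * w x * eta (u x)|%:E)%E =
    Lnorm mu 1%E (EFin \o (f1 \* w1)).
  rewrite Lnorm1; apply: eq_integral => x _; rewrite /= /f1 /w1; congr (`| _ |%:E).
  by rewrite expRN; have := expR_gt0 (p^-1 * u x); move: (expR _) => E E0; field; rewrite gt_eqF.
apply: (le_trans (hoelder mu mf1 mw1 p0 q0 pq)).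
apply: lee_wpmul2l; first exact: Lnorm_ge0.
apply: (le_Lnorm q1) => //; apply: aeW => x; rewrite /w1 normrM.
by rewrite ler_piMr// eta_weight// ltW.
Qed.

Lemma weighted_E f w (r c : R) : measurable_fun setT (f : borel X -> R) ->
  measurable_fun setT (w : borel X -> R) -> 0 <= r -> 0 <= c ->
  (Np f <= r%:E)%E -> (Nq w <= c%:E)%E ->
  itg mu (fun x => f x * w x * eta (u x)) /\
  'E (fun x => `|f x * w x * eta (u x)|) <= r * c.
Proof.
move=> mf mw r0 c0 fr wc.
have le1 : (\int[mu]_x `|f x * w x * eta (u x)|%:E <= (r * c)%:E)%E.
  by rewrite (le_trans (weighted_hoelder mf mw))// EFinM lee_pmul// Lnorm_ge0.
have ifw : itg mu (fun x => f x * w x * eta (u x)).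
  apply/integrableP; split.
    apply/measurable_EFinP; apply: measurable_funM; last exact: measurable_eta.
    exact: measurable_funM.
  by rewrite (le_lt_trans _ (ltry (r * c)))//.
split=> //; rewrite -lee_fin /Rintegral fineK//.
by apply: integrable_fin_num => //; exact: itg_norm.
Qed.

(** [|y| <= q * exp (|y| / q)], raised to the power [q], reduces the moment to exponential
    integrability. *)
Lemma Lnorm_cdual g : (Nq (fun x => g x : R) < +oo)%E.
Proof.
rewrite LnormE poweR_lty//.
pose w x := q `^ q * (expR (1 * g x) + expR (-1 * g x)).
have iw : itg mu w by apply: itgZ; apply: itgD; exact: integrable_expR_cdual.
apply: (@le_lt_trans _ _ (\int[mu]_x (w x)%:E)%E); last first.
  exact: integral_fune_lt_pinfty iw.
apply: ge0_le_integral => //.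
- by apply: measurable_powR_norm; exact: measurable_cdual.
- by have /integrableP[] := iw.
move=> x _; rewrite lee_fin /w mul1r mulN1r; set y : R := g x.
have y1 : `|y| <= q * expR (q^-1 * `|y|).
  rewrite -ler_pdivrMl//; apply: le_trans (expR_ge1Dx _).
  by rewrite lerDr.
apply: (@le_trans _ _ ((q * expR (q^-1 * `|y|)) `^ q)).
  by rewrite ge0_ler_powR ?nnegrE ?mulr_ge0 ?expR_ge0// ltW.
rewrite powRM ?expR_ge0 ?(ltW q0)// ler_wpM2l ?powR_ge0//.
have -> : expR (q^-1 * `|y|) `^ q = expR `|y|.
  by rewrite -expRM mulrAC mulVf ?gt_eqF// mul1r.
have [y0|y0] := leP 0 y; first by rewrite ger0_norm// lerDl expR_ge0.
by rewrite ltr0_norm// lerDr expR_ge0.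
Qed.

(* [weighted_ibp] for [f_ k * psi], where [f_ k] tends to 0 in [L^p(nu)]: the
   factor [eta u] lets both sides pass to the limit under [mu], and the side
   that carries [f_ k] vanishes. *)
Lemma closure_orthogonal F h g psi Psi : DH_closure istar nu p (fun=> 0) F ->
  direction i Qoo h g -> DH istar psi Psi ->
  itg mu (fun x => inner (F x) h * eta (u x)) /\
  'E (fun x => psi x * (inner (F x) h * eta (u x))) = 0.
Proof.
move=> [_ [mF LF] [f_ [F_ [DHk fc Fc]]]] hg psiP.
have [mpsi mPsi] := DH_measurable psiP.
have [M MP] := DH_bounded psiP; have M0 : 0 <= M by exact: le_trans (MP 0).
have [M' M'P] := DH_inner_bounded h psiP.
have mi K : measurable_fun setT (K : borel X -> borel H) ->
  measurable_fun setT (fun x : borel X => inner (K x) h) by exact: measurable_innerr.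
have meta := measurable_eta.
have bound (v : \bar R) : (0 <= v)%E -> (v < +oo)%E -> exists2 C : R, 0 <= C & (v <= C%:E)%E.
  by move=> v0 vy; exists (fine v); rewrite ?fine_ge0// fineK// ge0_fin_numE.
have cfin (c : R) : (Nq (fun _ : X => c) < +oo)%E.
  exact: (@Lnorm_bounded _ _ _ mu q q1 mu_fin (fun=> c) `|c|).
have Nc (c : R) : exists2 C : R, 0 <= C & (Nq (fun _ : X => c) <= C%:E)%E.
  by apply: bound => //; exact: Lnorm_ge0.
have [C1 C10 NC1] := Nc (M * `|h|).
have [C1' C1'0 NC1'] := Nc `|h|.
(* [K] stands for [F] and [F_ k - F] *)
have bnd (K : X -> H) (r : R) : measurable_fun setT (K : borel X -> borel H) ->
    0 <= r -> (Np (fun x => `|K x|) <= r%:E)%E ->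
    itg mu (fun x => inner (K x) h * eta (u x)) /\
    `|'E (fun x => psi x * (inner (K x) h * eta (u x)))| <= r * C1.
  move=> mK r0 Kr.
  have mnK : measurable_fun setT (fun x : borel X => `|K x|).
    by have := measurable_norm_subcst 0 mK; under eq_fun do rewrite subr0.
  have [i1 _] := weighted_E mnK (measurable_cst `|h|) r0 C1'0 Kr NC1'.
  have [i2 E2] := weighted_E mnK (measurable_cst (M * `|h|)) r0 C10 Kr NC1.
  have mKe : measurable_fun setT (fun x : borel X => inner (K x) h * eta (u x)).
    by apply: measurable_funM => //; exact: mi.
  split.
    apply: (itg_le mKe) (itg_norm i1) => x.
    by rewrite !normrM ler_wpM2r// normr_id normr_id inner_le.
  have le1 x : `|psi x * (inner (K x) h * eta (u x))| <= `| `|K x| * (M * `|h|) * eta (u x) |.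
    rewrite mulrA !normrM ler_wpM2r// !normr_id (ger0_norm M0) mulrCA ler_pM//.
    exact: inner_le.
  have i3 : itg mu (fun x => psi x * (inner (K x) h * eta (u x))).
    by apply: (itg_le _ le1 (itg_norm i2)); exact: measurable_funM.
  rewrite (le_trans (le_normr_Rintegral _ i3))// (le_trans _ E2)//.
  by apply: le_Rintegral => //; exact: itg_norm.
have [rF rF0 FrF] : exists2 r : R, 0 <= r & (Np (fun x => `|F x|) <= r%:E)%E.
  by apply: bound; [exact: Lnorm_ge0|exact: Lfun_norm_lty LF].
have [iF _] := bnd F rF mF rF0 FrF; split=> //.
(* All terms in which [f_ k] is not differentiated, with the factor [f_ k * eta u] taken out:
   integration by parts reads [E (psi [F_ k, h] eta) = E (f_ k w eta)]. *)
pose w x := psi x * g x + psi x * (1 - eta (u x)) * inner (G x) h - inner (Psi x) h.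
have mw : measurable_fun setT (w : borel X -> R).
  apply: measurable_funB; last exact: mi.
  apply: measurable_funD; first by apply: measurable_funM => //; exact: measurable_cdual.
  apply: measurable_funM; last exact: mi.
  by apply: measurable_funM => //; exact: measurable_funB.
(* [g] has a finite moment of order [q] by Gaussianity, [|G|] is in [L^q] because [u] lies in
   [W^{1,q}], and the other factors are bounded. *)
have [C2 C20 NC2] : exists2 C : R, 0 <= C & (Nq w <= C%:E)%E.
  apply: bound; first exact: Lnorm_ge0.
  have [_ [_ LG] _] := uG.
  have mnG : measurable_fun setT (fun x : borel X => `|G x|).
    by have := measurable_norm_subcst 0 mG; under eq_fun do rewrite subr0.
  pose a (x : borel X) : R := M * g x; pose b (x : borel X) := M * `|h| * `|G x|.
  have ma : measurable_fun setT a by apply: measurable_funM => //; exact: measurable_cdual.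
  have mb : measurable_fun setT b by exact: measurable_funM.
  have Na : (Nq a < +oo)%E.
    apply: (@le_lt_trans _ _ (M%:E * Nq (fun x => g x : R))%E).
      apply: (Lnorm_leZ q1) => //; first exact: measurable_cdual.
      by apply: aeW => x; rewrite normrM (ger0_norm M0).
    by rewrite lte_mul_pinfty ?lee_fin//; exact: Lnorm_cdual.
  have Nb : (Nq b < +oo)%E.
    apply: (@le_lt_trans _ _ ((M * `|h|)%:E * Nq (fun x => `|G x|))%E).
      apply: (Lnorm_leZ q1) => //; first by rewrite mulr_ge0.
      by apply: aeW => x; rewrite normrM (ger0_norm (mulr_ge0 M0 (normr_ge0 h))).
    by rewrite lte_mul_pinfty ?lee_fin ?mulr_ge0//; exact: Lfun_norm_lty LG.
  pose bc x := b x + M'.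
  have mbc : measurable_fun setT bc by exact: measurable_funD.
  apply: (@le_lt_trans _ _ (Nq a + (Nq b + Nq (fun=> M')))%E); last first.
    by rewrite lte_add_pinfty// lte_add_pinfty.
  have b0 x : 0 <= b x by rewrite !mulr_ge0.
  have M'0 : 0 <= M' by exact: le_trans (M'P 0).
  apply: (@le_trans _ _ (Nq a + Nq bc)%E).
    apply: (Lnorm_leD q1) => //; apply: aeW => x; rewrite /w /bc /a.
    rewrite (ger0_norm (addr_ge0 (b0 x) M'0)) addrA (le_trans (ler_normB _ _))//.
    apply: lerD => //; rewrite (le_trans (ler_normD _ _))// !normrM (ger0_norm M0).
    apply: lerD; first by rewrite ler_wpM2r.
    rewrite /b -!mulrA ler_pM ?mulr_ge0// [leRHS]mulrC -[leRHS]mul1r ler_pM//.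
      rewrite ger0_norm; last by rewrite subr_ge0 ltW// eta_lt1.
      by rewrite gerBl ltW// eta_gt0.
    exact: inner_le.
  by apply: leeD => //; apply: (Lnorm_leD q1) => //; apply: aeW => x; rewrite ler_normD.
have ipsi k : itg mu (fun x => psi x * (inner (F_ k x) h * eta (u x))).
  have [Mk MkP] := DH_inner_bounded h (DHk k); have [_ mFk] := DH_measurable (DHk k).
  apply: (@itg_bounded _ _ _ _ (M * (Mk * 1))).
    by apply: measurable_funM => //; apply: measurable_funM => //; exact: mi.
  by move=> x; rewrite !normrM !ler_pM ?mulr_ge0// eta_norm.
have ak k : 'E (fun x => psi x * (inner (F_ k x) h * eta (u x))) =
    'E (fun x => f_ k x * w x * eta (u x)).
  have [mfk mFk] := DH_measurable (DHk k); have [Mk MkP] := DH_bounded (DHk k).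
  have i2 : itg mu (fun x => f_ k x * inner (Psi x) h * eta (u x)).
    apply: (@itg_bounded _ _ _ _ (Mk * M' * 1)).
      by apply: measurable_funM => //; apply: measurable_funM => //; exact: mi.
    by move=> x; rewrite !normrM !ler_pM ?mulr_ge0// eta_norm.
  have i3 : itg mu (fun x => f_ k x * psi x * eta (u x) * g x).
    have -> : (fun x => f_ k x * psi x * eta (u x) * g x) =
        (fun x => (g x : R) * (f_ k x * psi x * eta (u x))).
      by apply/funext => x; rewrite mulrC.
    apply: (@itgM_bounded _ _ _ _ _ (Mk * M * 1)); first exact: (itg_cdual mu_cov).
      by do 2!apply: measurable_funM => //.
    by move=> x; rewrite !normrM !ler_pM ?mulr_ge0// eta_norm.
  have i4 : itg mu (fun x => f_ k x * psi x * (eta (u x) * (1 - eta (u x))) * inner (G x) h).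
    have -> : (fun x => f_ k x * psi x * (eta (u x) * (1 - eta (u x))) * inner (G x) h) =
        (fun x => inner (G x) h * (f_ k x * psi x * (eta (u x) * (1 - eta (u x))))).
      by apply/funext => x; rewrite mulrC.
    apply: (@itgM_bounded _ _ _ _ _ (Mk * M * 1)); first exact: itg_grad.
      apply: measurable_funM; first exact: measurable_funM.
      by apply: measurable_funM => //; exact: measurable_funB.
    by move=> x; rewrite normrM ler_pM ?eta_slope_norm// normrM ler_pM.
  have := weighted_ibp (DH_M (DHk k) psiP) hg.
  have -> : 'E (fun x => eta (u x) * inner (f_ k x *: Psi x + psi x *: F_ k x) h) =
      'E (fun x => f_ k x * inner (Psi x) h * eta (u x)) +
      'E (fun x => psi x * (inner (F_ k x) h * eta (u x))).
    rewrite -(RintegralD _ i2 (ipsi k))//; apply: eq_Rintegral => x _.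
    by rewrite innerDl !innerZl; ring.
  rewrite -(RintegralD _ i3 i4)// => Ek.
  have -> : 'E (fun x => f_ k x * w x * eta (u x)) =
     'E (fun x => (f_ k x * psi x * eta (u x) * g x +
          f_ k x * psi x * (eta (u x) * (1 - eta (u x))) * inner (G x) h) -
       f_ k x * inner (Psi x) h * eta (u x)).
    by apply: eq_Rintegral => x _; rewrite /w; ring.
  by rewrite (RintegralB _ (itgD i3 i4) i2)// -Ek addrC addKr.
apply/eqP; rewrite -normr_le0; apply/ler_addgt0Pr => r r0; rewrite add0r.
pose s := r / (C1 + C2 + 1).
have C121 : 0 < C1 + C2 + 1 by rewrite ltr_wpDl// addr_ge0.
have s0 : 0 < s by exact: divr_gt0.
have [K1 K1P] := (ereal_cvg0P (fun n => Lnorm_ge0 _ _ _)).1 fc _ s0.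
have [K2 K2P] := (ereal_cvg0P (fun n => Lnorm_ge0 _ _ _)).1 Fc _ s0.
pose k := maxn K1 K2.
have f_s : (Np (f_ k) <= s%:E)%E.
  by have := K1P k (leq_maxl _ _); under eq_Lnorm do rewrite subr0.
have F_s : (Np (fun x => `|F_ k x - F x|) <= s%:E)%E by exact: K2P k (leq_maxr _ _).
have [mfk mFk] := DH_measurable (DHk k).
have [ifk Efk] := weighted_E mfk mw (ltW s0) C20 f_s NC2.
have mFF : measurable_fun setT ((fun x => F_ k x - F x) : borel X -> borel H).
  under eq_fun do rewrite -scaleN1r.
  by apply: (measurable_borelD e_dense) => //; exact: measurable_borelZ.
have [iFF EFk] := bnd _ _ mFF (ltW s0) F_s.
have -> : 'E (fun x => psi x * (inner (F x) h * eta (u x))) =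
    'E (fun x => f_ k x * w x * eta (u x)) -
    'E (fun x => psi x * (inner (F_ k x - F x) h * eta (u x))).
  have ipF : itg mu (fun x => psi x * (inner (F_ k x - F x) h * eta (u x))).
    have := itgM_bounded iFF mpsi MP; congr (is_true (itg mu _)).
    by apply/funext => x; rewrite mulrC.
  rewrite -ak -(RintegralB _ (ipsi k) ipF)//; apply: eq_Rintegral => x _.
  by rewrite innerBl; ring.
rewrite (le_trans (ler_normB _ _))// (@le_trans _ _ (s * C2 + s * C1))//.
  apply: lerD => //; rewrite (le_trans (le_normr_Rintegral _ ifk))//.
rewrite -mulrDr (@le_trans _ _ (s * (C1 + C2 + 1)))//.
  by rewrite ler_pM2l// addrC lerDl.
by rewrite divfK ?gt_eqF.
Qed.

(** The partial derivatives of a C_b^1 function are only continuous, so [[F, h]] need not be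
    cylindrical. Difference quotients along [i h] are, and they converge to it boundedly. *)
Lemma DH_difference f F h : DH istar f F ->
  (exists L : R, forall x n, `|n.+1%:R * (f (x + n.+1%:R^-1 *: i h) - f x)| <= L) /\
  (forall x, n.+1%:R * (f (x + n.+1%:R^-1 *: i h) - f x) @[n --> \oo] --> inner (F x) h).
Proof.
move=> [n [phi [xs [Hphi -> ->]]]]; set b := coords xs (i h).
have cD x (t : R) : coords xs (x + t *: i h) = coords xs x + t *: b.
  by apply/rowP => j; rewrite !mxE linearD linearZ.
split.
  have [L L0 LP] := Cb1_lipschitz Hphi; exists (L * \sum_j `|b 0 j|) => x k.
  rewrite cD normrM normr_nat -ler_pdivlMl// (le_trans (LP _ _))// mulrCA.
  rewrite ler_wpM2l// mulr_sumr; apply: ler_sum => j _.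
  by rewrite mxE normrM gtr0_norm ?invr_gt0.
move=> x; have := @Cb1_derivable_direction _ _ _ (coords xs x) b Hphi.
move=> /cvgr_dnbhsP/(_ (fun n => n.+1%:R^-1)).
have -> : (fun k : nat => k.+1%:R * (phi (coords xs (x + k.+1%:R^-1 *: i h)) - phi (coords xs x))) =
    (fun k : nat => (k.+1%:R^-1)^-1 * (phi (coords xs x + k.+1%:R^-1 *: b) - phi (coords xs x))).
  by apply/funext => k; rewrite cD invrK.
have -> : inner (\sum_(j < n) partial phi j (coords xs x) *: istar (xs j)) h =
    \sum_j b 0 j * partial phi j (coords xs x).
  by rewrite inner_suml; apply: eq_bigr => j _; rewrite innerZl istarE mxE mulrC.
by apply; split=> [k|]; [rewrite invr_neq0|exact: cvg_harmonic].
Qed.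

(** [F_ k] replaces [F] at an [L^1(mu)] error controlled by [weighted_hoelder]. Then a difference
    quotient of [f_ k] replaces [[F_ k, h]] and [eta (u_ n)] replaces [eta u], by bounded
    convergence; the result is a product of cylindrical functions. *)
Lemma closure_approx f F h (r : R) : DH_closure istar nu p f F -> 0 < r ->
  exists psi Psi, DH istar psi Psi /\
    itg mu (fun x => psi x - inner (F x) h * eta (u x)) /\
    'E (fun x => `|psi x - inner (F x) h * eta (u x)|) <= r.
Proof.
move=> [_ [mF LF] [f_ [F_ [DHk _ Fc]]]] r0.
have mi K : measurable_fun setT (K : borel X -> borel H) ->
  measurable_fun setT (fun x : borel X => inner (K x) h) by exact: measurable_innerr.
have meta := measurable_eta.
have [C C0 NC] : exists2 C : R, 0 <= C & (Nq (fun _ : X => `|h|) <= C%:E)%E.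
  have cfin : (Nq (fun _ : X => `|h|) < +oo)%E.
    by apply: (@Lnorm_bounded _ _ _ mu q q1 mu_fin (fun=> `|h|) `|h|) => // x; rewrite normr_id.
  exists (fine (Nq (fun _ : X => `|h|))); first by rewrite fine_ge0// Lnorm_ge0.
  by rewrite fineK// ge0_fin_numE// Lnorm_ge0.
have C1 : 0 < 2 * C + 1 by rewrite ltr_wpDl// mulr_ge0.
pose s := r / (2 * C + 1); have s0 : 0 < s by exact: divr_gt0.
have [k kP] := (ereal_cvg0P (fun n => Lnorm_ge0 _ _ _)).1 Fc _ s0.
have [mfk mFk] := DH_measurable (DHk k).
have mFF : measurable_fun setT (fun x : borel X => `|F_ k x - F x|).
  exact: (measurable_norm_sub e_dense).
have [i1 E1] := weighted_E mFF (measurable_cst `|h|) (ltW s0) C0 (kP k (leqnn k)) NC.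
have le1 x : `|inner (F_ k x) h * eta (u x) - inner (F x) h * eta (u x)| <=
    `| `|F_ k x - F x| * `|h| * eta (u x) |.
  by rewrite -mulrBl -innerBl !normrM ler_wpM2r// !normr_id inner_le.
have i2 : itg mu (fun x => inner (F_ k x) h * eta (u x) - inner (F x) h * eta (u x)).
  apply: (itg_le _ le1 (itg_norm i1)).
  by apply: measurable_funB; apply: measurable_funM => //; exact: mi.
have [u_ [U_ [C' [uU _ uu _ _]]]] := DH_closure_subseq q1 mu_fin uG.
have [[L LP] Lc] := DH_difference h (DHk k).
pose psi n x := n.+1%:R * (f_ k (x + n.+1%:R^-1 *: i h) - f_ k x) * eta (u_ n x).
have Dpsi n : exists Psi, DH istar (psi n) Psi.
  have -> : psi n = (fun x => n.+1%:R * (f_ k (x + n.+1%:R^-1 *: i h) + -1 * f_ k x) *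
      (eta \o u_ n) x) by apply/funext => x; rewrite mulN1r.
  exact: (ex_intro _ _ (DH_M (DH_Z n.+1%:R (DH_D (DH_shift (n.+1%:R^-1 *: i h) (DHk k))
    (DH_Z (-1) (DHk k)))) (DH_eta (uU n)))).
have mpsi n : measurable_fun setT (psi n : borel X -> R).
  by have [Psi /DH_measurable[]] := Dpsi n.
have cpsi : 'E (fun x => `|psi n x - inner (F_ k x) h * eta (u x)|) @[n --> \oo] -->
    'E (fun _ : X => 0).
  have mlim : measurable_fun setT (fun x : borel X => inner (F_ k x) h * eta (u x)).
    by apply: measurable_funM => //; exact: mi.
  have LL x : `|inner (F_ k x) h| <= L.
    have c1 : `|n.+1%:R * (f_ k (x + n.+1%:R^-1 *: i h) - f_ k x)| @[n --> \oo] -->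
        `|inner (F_ k x) h| by apply: cvg_norm; exact: Lc.
    by apply: (cvgr_to_le c1); apply: nearW => n; exact: LP.
  apply: (@cvg_Rintegral _ _ _ _ _ _ (fun=> L + L)) => //.
  - by move=> n; apply: measurableT_comp => //; exact: measurable_funB.
  - apply: filterS uu => x ux; apply/norm_cvg0P.
    rewrite -(subrr (inner (F_ k x) h * eta (u x))); apply: cvgB; last exact: cvg_cst.
    apply: cvgM; first exact: Lc.
    by apply: continuous_cvg ux; exact: eta_continuous.
  - exact: itg_cst.
  - move=> n x; rewrite normr_id (le_trans (ler_normB _ _))// !normrM.
    by apply: lerD; rewrite -[leRHS]mulr1 ler_pM// ?eta_norm// -normrM LP.
have [n nP] : exists n, 'E (fun x => `|psi n x - inner (F_ k x) h * eta (u x)|) <= s.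
  move: cpsi; rewrite E_cst => /cvgrPdist_le/(_ _ s0)[n _ nP]; exists n.
  by have := nP n (leqnn n); rewrite /= sub0r normrN; apply: le_trans; rewrite ler_norm.
have i3 : itg mu (fun x => psi n x - inner (F_ k x) h * eta (u x)).
  have [Psi DP] := Dpsi n; have [B BP] := DH_bounded DP.
  have [B' BP'] := DH_inner_bounded h (DHk k).
  apply: (@itg_bounded _ _ _ _ (B + B' * 1)).
    by apply: measurable_funB => //; apply: measurable_funM => //; exact: mi.
  by move=> x; rewrite (le_trans (ler_normB _ _))// lerD// normrM ler_pM// eta_norm.
have [Psi DP] := Dpsi n; exists (psi n), Psi; split=> //.
have i4 : itg mu (fun x => psi n x - inner (F x) h * eta (u x)).
  have := itgD i3 i2; congr (is_true (itg mu _)).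
  by apply/funext => x; rewrite subrKA.
split=> //.
apply: (@le_trans _ _ ('E (fun x => `|psi n x - inner (F_ k x) h * eta (u x)| +
    `| `|F_ k x - F x| * `|h| * eta (u x) |))).
  apply: le_Rintegral => //.
  - exact: itg_norm.
  - by apply: itgD; exact: itg_norm.
  move=> x _; rewrite -(subrKA (inner (F_ k x) h * eta (u x))).
  by rewrite (le_trans (ler_normD _ _))// lerD2l.
rewrite (RintegralD _ (itg_norm i3) (itg_norm i1))//.
rewrite (le_trans (lerD nP E1))// -[X in X + _]mulr1 -mulrDr.
rewrite (@le_trans _ _ (s * (2 * C + 1)))//; last by rewrite divfK ?gt_eqF.
by rewrite ler_pM2l// addrC lerD2r ler_peMl// ler1n.
Qed.

(* With [w = inner (F x) h * eta u], testing against [1 - 2 * eta psi] for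
   [psi] converging to [w] gives [E (sg w * w) = 0] where [sg] has the sign of
   its argument. *)
Lemma closure_zero_direction F h g : DH_closure istar nu p (fun=> 0) F ->
  direction i Qoo h g -> {ae mu, forall x : borel X, inner (F x) h = 0}.
Proof.
move=> clF hg; have [_ [mF _] _] := clF.
pose w x := inner (F x) h * eta (u x).
have mw : measurable_fun setT (w : borel X -> R).
  by apply: measurable_funM; [exact: measurable_innerr|exact: measurable_eta].
have [iw _] := closure_orthogonal clF hg (DH_cst _ 0).
have /choice[psi psiP] (m : nat) : exists psi, (exists Psi, DH istar psi Psi) /\
    itg mu (fun x => psi x - w x) /\ 'E (fun x => `|psi x - w x|) <= (1/2) ^+ m.
  have r0 : 0 < (1/2 : R) ^+ m by rewrite exprn_gt0.
  by have [psi [Psi [DP P]]] := closure_approx h clF r0; exists psi; split=> //; exists Psi.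
have mpsi m : measurable_fun setT (psi m : borel X -> R).
  by have [[Psi /DH_measurable[]]] := psiP m.
have psiw : {ae mu, forall x : borel X, psi m x @[m --> \oo] --> w x}.
  have mv m : measurable_fun setT (fun x : borel X => `|psi m x - w x|).
    by apply: measurableT_comp => //; exact: measurable_funB.
  have Iv m : (\int[mu]_x `|psi m x - w x|%:E <= (1 * (1/2) ^+ m)%:E)%E.
    have [_ [im Em]] := psiP m; rewrite mul1r -(fineK (integrable_fin_num _ (itg_norm im)))//.
  have [A [mA A0 AP]] := summable_ae mv (fun k x => normr_ge0 _) Iv.
  exists (~` A); split=> //; first exact: measurableC.
  move=> x /=; apply: contra_not => Ax; have /cvg_series_cvg_0 c0 := AP x Ax.
  have : psi m x - w x @[m --> \oo] --> 0 by apply/norm_cvg0P.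
  move=> c1; rewrite -[X in _ --> X](add0r (w x)).
  have -> : (fun m => psi m x) = (fun m => psi m x - w x + w x).
    by apply/funext => m; rewrite subrK.
  by apply: cvgD => //; exact: cvg_cst.
(* This is [tanh (s / 2)]; being affine in [eta], it takes cylindrical functions to cylindrical
   functions. *)
pose sg (s : R) := 1 - 2 * eta s.
have sg1 s : `|sg s| <= 1.
  by have := eta_gt0 s; have := eta_lt1 s; rewrite ler_norml /sg; lra.
have csg : continuous sg.
  move=> s; apply: cvgB; first exact: cvg_cst.
  by apply: cvgMl_tmp; exact: eta_continuous.
have msg : measurable_fun setT sg by exact: continuous_measurable_fun.
have E0 m : 'E (fun x => sg (psi m x) * w x) = 0.
  have [[Psi DP] _] := psiP m.
  have DS := DH_D (DH_cst istar 1) (DH_Z (-2) (DH_eta DP)).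
  have [_ <-] := closure_orthogonal clF hg DS.
  by apply: eq_Rintegral => x _; rewrite /sg /= mulNr.
have lim0 : 'E (fun x => sg (psi m x) * w x) @[m --> \oo] --> 'E (fun x => sg (w x) * w x).
  apply: (@cvg_Rintegral _ _ _ _ _ _ (fun x : borel X => (`|w x|)%R)) => //.
  - by move=> m; apply: measurable_funM => //; exact: measurableT_comp.
  - by apply: measurable_funM => //; exact: measurableT_comp.
  - by apply: filterS psiw => x cx; apply: cvgMr_tmp; apply: continuous_cvg cx; exact: csg.
  - exact: itg_norm.
  - by move=> m x; rewrite normrM ler_piMl.
have Ew : 'E (fun x => sg (w x) * w x) = 0.
  by move: lim0; rewrite (funext E0) => /(cvg_unique _ (cvg_cst (0:R))) <-.
have sgw s : 0 <= sg s * s /\ (sg s * s = 0 -> s = 0).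
  have den : 0 < 1 + expR s by rewrite addr_gt0// expR_gt0.
  have sgE : sg s = (expR s - 1) / (1 + expR s).
    by rewrite /sg /eta; move: den; move: (expR s) => E den; field; rewrite gt_eqF.
  rewrite sgE; case: (ltgtP s 0) => [s0|s0|->]; last by rewrite mulr0.
    have e1 : expR s - 1 < 0 by rewrite subr_lt0 -expR0 ltr_expR.
    have P : 0 < (expR s - 1) / (1 + expR s) * s.
      by rewrite nmulr_lgt0// pmulr_llt0// invr_gt0.
    by split; [exact: ltW|move=> E; rewrite E ltxx in P].
  have e1 : 0 < expR s - 1 by rewrite subr_gt0 -expR0 ltr_expR.
  have P : 0 < (expR s - 1) / (1 + expR s) * s by rewrite !mulr_gt0// invr_gt0.
  by split; [exact: ltW|move=> E; rewrite E ltxx in P].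
have isw : itg mu (fun x => sg (w x) * w x).
  have := itgM_bounded iw (measurableT_comp msg mw) (fun x => sg1 (w x)).
  by congr (is_true (itg mu _)); apply/funext => x; rewrite mulrC.
have int0 : (\int[mu]_x `|(sg (w x) * w x)%:E| = 0)%E.
  under eq_integral do rewrite gee0_abs ?lee_fin ?(sgw _).1//.
  by rewrite -[LHS]fineK ?integrable_fin_num// [fine _]Ew.
have /ae_eq_integral_abs : measurable_fun setT (fun x : borel X => (sg (w x) * w x)%:E).
  by have /integrableP[] := isw.
move=> /(_ mu measurableT) [/(_ int0) ae0 _].
apply: filterS ae0 => x /(_ I)[] /(sgw _).2 /eqP.
by rewrite mulf_eq0 (gt_eqF (eta_gt0 _)) orbF => /eqP.
Qed.

Hypothesis direction_dense : forall k (r : R), 0 < r ->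
  exists h g, direction i Qoo h g /\ `|k - h| < r.

(** The directions [hh (n, m)], chosen within [1 / (m + 1)] of [e n], form a countable dense family,
    so their null sets can be united; a vector orthogonal to a dense set is 0. Null sets of [mu] are
    null for [nu], which has a density. *)
Lemma weighted_closable : DH_closable istar nu p.
Proof.
move=> F clF.
have /choice[hh hhP] (nm : nat * nat) : exists h, (exists g, direction i Qoo h g) /\
    `|e nm.1 - h| < nm.2.+1%:R^-1.
  by have [|h [g [hg eh]]] := direction_dense (e nm.1) (r := nm.2.+1%:R^-1);
    [rewrite invr_gt0|exists h; split=> //; exists g].
have ae0 : {ae mu, forall x : borel X, forall nm, inner (F x) (hh nm) = 0}.
  have /ae_foralln : forall k : nat, {ae mu, forall x : borel X,
      if unpickle k is Some nm then inner (F x) (hh nm) = 0 else True}.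
    move=> k; case: (unpickle k) => [nm|]; last exact: aeW.
    by have [[g hg] _] := hhP nm; exact: closure_zero_direction clF hg.
  by apply: filterS => x Fx nm; have := Fx (pickle nm); rewrite pickleK.
have aeF : {ae mu, forall x : borel X, F x = 0}.
  apply: filterS ae0 => x Fx0; apply/eqP; rewrite -normr_le0; apply/ler_addgt0Pr => r r0.
  rewrite add0r; have r2 : 0 < r / 2 by rewrite divr_gt0.
  have [n nP] := e_dense (F x) r2.
  pose m := Num.truncn (r / 2)^-1.
  have mr : m.+1%:R^-1 <= r / 2.
    by rewrite -[leRHS]invrK lef_pV2 ?posrE ?invr_gt0// ltW// truncnS_gt.
  have [_ hP] := hhP (n, m).
  have : `|F x - hh (n, m)| <= r.
    rewrite -(subrKA (e n)) (le_trans (ler_normD _ _))// [r]splitr lerD// ltW//.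
    exact: lt_le_trans hP mr.
  (* By orthogonality, [|F x|] is at most the distance from [F x] to the chosen direction. *)
  apply: le_trans; rewrite -(@ler_sqr _ (`|F x|)) ?nnegrE// norm_sqrB Fx0 mulr0 subr0.
  by rewrite lerDl sqr_ge0.
have [N [mN N0 FN]] := aeF; exists N; split=> //.
rewrite nu_density// null_set_integral//.
apply/measurable_EFinP; apply: measurable_funTS.
by have := measurable_expRN 1; congr measurable_fun; apply/funext => x; rewrite mul1r.
Qed.

End weight.

End closability.

(** The laws of the seminorm are asked on the domain only, and its values elsewhere are arbitrary.
    This suits spaces of functions that are handled as representatives rather than as classes. *)
Record seminormed_space (R : realType) (V : lmodType R) := SeminormedSpace {
  ss_dom : set V;
  ss_norm : V -> R;
  ss_dom0 : ss_dom 0;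
  ss_dom_lin : forall a x y, ss_dom x -> ss_dom y -> ss_dom (a *: x + y);
  ss_normZ : forall a x, ss_dom x -> ss_norm (a *: x) = `|a| * ss_norm x;
  ss_normD : forall x y, ss_dom x -> ss_dom y -> ss_norm (x + y) <= ss_norm x + ss_norm y;
  ss_complete : forall x_ : nat -> V, (forall n, ss_dom (x_ n)) ->
    (forall e : R, 0 < e -> exists K, forall i j, (K <= i)%N -> (K <= j)%N ->
      ss_norm (x_ i - x_ j) <= e) ->
    exists2 x, ss_dom x & forall e : R, 0 < e -> exists K, forall n, (K <= n)%N ->
      ss_norm (x_ n - x) <= e }.

(** * The Sobolev spaces *)

Section seminormed_quotient.
Context {R : realType} {V : lmodType R} (S : seminormed_space V).
Local Notation W := (ss_dom S).
Local Notation N := (ss_norm S).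
Implicit Types (x y z : V) (a : R).

Lemma ss_norm0 : N 0 = 0.
Proof. by have := ss_normZ 0 (ss_dom0 S); rewrite scale0r normr0 mul0r. Qed.

Lemma ss_domZ a x : W x -> W (a *: x).
Proof. by move=> Wx; rewrite -[a *: x]addr0; apply: ss_dom_lin => //; exact: ss_dom0. Qed.

Lemma ss_domD x y : W x -> W y -> W (x + y).
Proof. by move=> Wx Wy; rewrite -[x]scale1r; exact: ss_dom_lin. Qed.

Lemma ss_domN x : W x -> W (- x).
Proof. by move=> Wx; rewrite -scaleN1r; exact: ss_domZ. Qed.

Lemma ss_domB x y : W x -> W y -> W (x - y).
Proof. by move=> Wx Wy; apply: ss_domD => //; exact: ss_domN. Qed.

Lemma ss_normN x : W x -> N (- x) = N x.
Proof. by move=> Wx; rewrite -scaleN1r ss_normZ// normrN normr1 mul1r. Qed.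

Lemma ss_normBC x y : W x -> W y -> N (x - y) = N (y - x).
Proof. by move=> Wx Wy; rewrite -opprB ss_normN//; exact: ss_domB. Qed.

Lemma ss_norm_ge0 x : W x -> 0 <= N x.
Proof.
move=> Wx; have := ss_normD Wx (ss_domN Wx); rewrite subrr ss_norm0 ss_normN//; lra.
Qed.

Lemma ss_norm_le0 x : W x -> N x <= 0 -> N x = 0.
Proof. by move=> Wx x0; apply/le_anti; rewrite x0 ss_norm_ge0. Qed.

Lemma ss_normB x y z : W x -> W y -> W z -> N (x - z) <= N (x - y) + N (y - z).
Proof.
move=> Wx Wy Wz; rewrite -(subrKA y); apply: ss_normD; exact: ss_domB.
Qed.

Definition ss_repr x : V := xget 0 [set y | W y /\ N (x - y) = 0].

Lemma ss_reprP x : W x -> W (ss_repr x) /\ N (x - ss_repr x) = 0.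
Proof.
move=> Wx; apply: (@xgetPex _ 0 [set y | W y /\ N (x - y) = 0]); exists x.
by split; rewrite // subrr ss_norm0.
Qed.

(** Equivalent points have the same equivalence class as a set, and [xget] depends on the set
    alone. *)
Lemma ss_repr_eq x y : W x -> W y -> N (x - y) = 0 -> ss_repr x = ss_repr y.
Proof.
move=> Wx Wy xy; rewrite /ss_repr; congr xget; apply/seteqP; split=> z [Wz] H;
  split=> //; apply: ss_norm_le0; do ?exact: ss_domB.
  by have := ss_normB Wy Wx Wz; rewrite (ss_normBC Wy Wx) xy H addr0.
by have := ss_normB Wx Wy Wz; rewrite xy H addr0.
Qed.

(* The quotient of the domain by the null space, as the set of the canonical
   representatives of its classes. *)
Record ss_quotient := SSQuotient { ss_val : V; ss_valP : W ss_val /\ ss_repr ss_val = ss_val }.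

Lemma ss_val_inj : injective ss_val.
Proof. by move=> [x Px] [y Py] /= xy; subst y; congr SSQuotient; exact: Prop_irrelevance. Qed.

Lemma ss_repr_valP x : W x -> W (ss_repr x) /\ ss_repr (ss_repr x) = ss_repr x.
Proof.
move=> Wx; have [Wr r0] := ss_reprP Wx; split=> //.
by apply: ss_repr_eq => //; rewrite ss_normBC.
Qed.

(** Total on [V]: points outside the domain are sent to the class of 0. *)
Definition ss_class x : ss_quotient :=
  if pselect (W x) is left Wx then SSQuotient (ss_repr_valP Wx)
  else SSQuotient (ss_repr_valP (ss_dom0 S)).

Lemma ss_val_class x : W x -> ss_val (ss_class x) = ss_repr x.
Proof. by rewrite /ss_class; case: pselect. Qed.

Lemma ss_class_eq x y : W x -> W y -> ss_class x = ss_class y <-> N (x - y) = 0.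
Proof.
move=> Wx Wy; split=> [/(congr1 ss_val)|xy]; last first.
  by apply: ss_val_inj; rewrite !ss_val_class//; exact: ss_repr_eq.
rewrite !ss_val_class// => rxy; have [Wr xr] := ss_reprP Wx; have [Wr' yr] := ss_reprP Wy.
apply: ss_norm_le0; first exact: ss_domB.
have := ss_normB Wx Wr Wy; by rewrite xr rxy (ss_normBC Wr' Wy) yr addr0.
Qed.

Lemma ss_classP (b : ss_quotient) : exists2 x, W x & b = ss_class x.
Proof.
have [Wb rb] := ss_valP b; exists (ss_val b) => //.
by apply: ss_val_inj; rewrite ss_val_class.
Qed.

HB.instance Definition _ := gen_eqMixin ss_quotient.
HB.instance Definition _ := gen_choiceMixin ss_quotient.

Let add (b c : ss_quotient) := ss_class (ss_val b + ss_val c).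
Let opp (b : ss_quotient) := ss_class (- ss_val b).
Let scale a (b : ss_quotient) := ss_class (a *: ss_val b).

Let addE x y : W x -> W y -> add (ss_class x) (ss_class y) = ss_class (x + y).
Proof.
move=> Wx Wy; rewrite /add !ss_val_class//.
have [Wr xr] := ss_reprP Wx; have [Wr' yr] := ss_reprP Wy.
apply/ss_class_eq; [exact: ss_domD|exact: ss_domD|].
apply: ss_norm_le0; first by apply: ss_domB; exact: ss_domD.
rewrite opprD addrACA (le_trans (ss_normD _ _))//; [exact: ss_domB|exact: ss_domB|].
by rewrite ss_normBC// xr ss_normBC// yr addr0.
Qed.

Let scaleE a x : W x -> scale a (ss_class x) = ss_class (a *: x).
Proof.
move=> Wx; rewrite /scale ss_val_class//; have [Wr xr] := ss_reprP Wx.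
apply/ss_class_eq; [exact: ss_domZ|exact: ss_domZ|].
rewrite -scalerBr ss_normZ; last exact: ss_domB.
by rewrite ss_normBC// xr mulr0.
Qed.

Let oppE x : W x -> opp (ss_class x) = ss_class (- x).
Proof.
by move=> Wx; have := scaleE (-1) Wx; rewrite scaleN1r /scale scaleN1r.
Qed.

Let addA : associative add.
Proof.
move=> b c d; have [x Wx ->] := ss_classP b; have [y Wy ->] := ss_classP c.
by have [z Wz ->] := ss_classP d; rewrite !addE ?addrA//; exact: ss_domD.
Qed.

Let addC : commutative add. Proof. by move=> b c; rewrite /add addrC. Qed.

Let add0 : left_id (ss_class 0) add.
Proof. by move=> b; have [x Wx ->] := ss_classP b; rewrite addE ?add0r//; exact: ss_dom0. Qed.

Let addN : left_inverse (ss_class 0) opp add.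
Proof.
move=> b; have [x Wx ->] := ss_classP b.
by rewrite oppE// addE ?addNr//; exact: ss_domN.
Qed.

HB.instance Definition _ := GRing.isZmodule.Build ss_quotient addA addC add0 addN.

Let plusE x y : W x -> W y -> ss_class x + ss_class y = ss_class (x + y).
Proof. exact: addE. Qed.

Let scaleA a a' b : scale a (scale a' b) = scale (a * a') b.
Proof.
have [x Wx ->] := ss_classP b.
by rewrite !scaleE ?scalerA//; exact: ss_domZ.
Qed.

Let scale1 : left_id 1 scale.
Proof. by move=> b; have [x Wx ->] := ss_classP b; rewrite scaleE// scale1r. Qed.

Let scaleDr : right_distributive scale +%R.
Proof.
move=> a b c; have [x Wx ->] := ss_classP b; have [y Wy ->] := ss_classP c.
rewrite plusE// !scaleE// ?plusE ?scalerDr//; do ?exact: ss_domZ.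
exact: ss_domD.
Qed.

Let scaleDl b : {morph scale^~ b : a a' / a + a'}.
Proof.
move=> a a'; have [x Wx ->] := ss_classP b.
by rewrite /= !scaleE// plusE ?scalerDl//; exact: ss_domZ.
Qed.

HB.instance Definition _ :=
  GRing.Zmodule_isLmodule.Build R ss_quotient scaleA scale1 scaleDr scaleDl.

Lemma ss_class_linear a x y : W x -> W y ->
  ss_class (a *: x + y) = a *: ss_class x + ss_class y.
Proof.
move=> Wx Wy; rewrite -[RHS]/(add (scale a (ss_class x)) _) scaleE// addE//.
exact: ss_domZ.
Qed.

Let norm (b : ss_quotient) := N (ss_val b).

Let normE x : W x -> norm (ss_class x) = N x.
Proof.
move=> Wx; rewrite /norm ss_val_class//; have [Wr xr] := ss_reprP Wx.
have := ss_normB Wx Wr (ss_dom0 S); have := ss_normB Wr Wx (ss_dom0 S).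
by rewrite (ss_normBC Wr Wx) xr !subr0 !add0r => H1 H2; apply/le_anti; rewrite H1 H2.
Qed.

Let normD b c : norm (b + c) <= norm b + norm c.
Proof.
have [x Wx ->] := ss_classP b; have [y Wy ->] := ss_classP c.
by rewrite plusE// !normE ?ss_normD//; exact: ss_domD.
Qed.

Let normZ a b : norm (a *: b) = `|a| * norm b.
Proof.
have [x Wx ->] := ss_classP b.
by rewrite -[_ *: _]/(scale _ _) scaleE// !normE ?ss_normZ//; exact: ss_domZ.
Qed.

Let norm0_eq0 b : norm b = 0 -> b = 0.
Proof.
have [x Wx ->] := ss_classP b; rewrite normE// => x0.
by apply/ss_class_eq => //; rewrite ?subr0//; exact: ss_dom0.
Qed.

HB.instance Definition _ := Lmodule_isNormed.Build R ss_quotient normD normZ norm0_eq0.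

Lemma ss_norm_class x : W x -> `|ss_class x| = N x. Proof. exact: normE. Qed.

(** Centres of balls of radius [1 / (n + 1)] that belong to the filter form a Cauchy sequence. It
    lifts to the domain, converges there, and the class of its limit is a limit of the filter. *)
Let complete (F : set_system ss_quotient) : ProperFilter F -> cauchy F -> cvg F.
Proof.
move=> FF cF.
have /choice[b bP] (n : nat) : exists b : ss_quotient, F (ball b n.+1%:R^-1).
  by move/cauchyP : cF => /(_ n.+1%:R^-1); apply; rewrite invr_gt0.
have /choice[x_ xP] (n : nat) : exists x, W x /\ b n = ss_class x.
  by have [x Wx ->] := ss_classP (b n); exists x.
have xn i j : N (x_ i - x_ j) <= i.+1%:R^-1 + j.+1%:R^-1.
  have [Wi bi] := xP i; have [Wj bj] := xP j.
  have [c [ci cj]] := filter_ex (filterI (bP i) (bP j)).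
  rewrite -ss_norm_class; last exact: ss_domB.
  have -> : ss_class (x_ i - x_ j) = b i - b j.
    by rewrite bi bj addrC -scaleN1r ss_class_linear// scaleN1r addrC.
  move: ci cj; rewrite -!ball_normE/= => ci cj.
  by rewrite -(subrKA c) (le_trans (ler_normD _ _))// lerD ?ltW// distrC.
have small (r : R) : 0 < r -> exists K : nat, forall n, (K <= n)%N -> n.+1%:R^-1 <= r.
  move=> r0; exists (Num.truncn r^-1) => n Kn.
  rewrite -[leRHS]invrK lef_pV2 ?posrE ?invr_gt0// (le_trans (ltW (truncnS_gt _)))//.
  by rewrite ler_nat ltnS.
have [n|r r0|x Wx xlim] := @ss_complete _ _ S x_.
- by have [] := xP n.
- have [K KP] := small _ (divr_gt0 r0 (ltr0n R 2)); exists K => i j Ki Kj.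
  by rewrite (le_trans (xn i j))// [r]splitr lerD// KP.
apply/cvg_ex; exists (ss_class x); apply/cvg_ballP => r r0.
have r3 : 0 < r / 3 by rewrite divr_gt0.
have [K1 K1P] := small _ r3; have [K2 K2P] := xlim _ r3.
pose n := maxn K1 K2; have [Wn bn] := xP n.
apply: filterS (bP n) => c; rewrite -!ball_normE/= => bc.
have : `|ss_class x - b n| <= r / 3.
  have -> : ss_class x - b n = ss_class (x - x_ n).
    by rewrite bn (addrC x) -scaleN1r ss_class_linear// scaleN1r addrC.
  rewrite ss_norm_class; last exact: ss_domB.
  by rewrite (ss_normBC Wx Wn); apply: K2P; exact: leq_maxr.
move=> xb; rewrite -(subrKA (b n)) (le_lt_trans (ler_normD _ _))//.
have := lt_le_trans bc (K1P n (leq_maxl _ _)); lra.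
Qed.

HB.instance Definition _ := Uniform_isComplete.Build ss_quotient complete.

End seminormed_quotient.

Lemma seminormed_banach (R : realType) (V : lmodType R) (S : seminormed_space V) :
  exists (B : completeNormedModType R) (cls : V -> B),
  [/\ forall a x y, ss_dom S x -> ss_dom S y -> cls (a *: x + y) = a *: cls x + cls y,
      forall x, ss_dom S x -> `|cls x| = ss_norm S x &
      forall b, exists2 x, ss_dom S x & cls x = b].
Proof.
exists (ss_quotient S : completeNormedModType R), (@ss_class _ _ S); split.
- exact: ss_class_linear.
- exact: ss_norm_class.
- by move=> b; have [x Wx ->] := ss_classP b; exists x.
Qed.

(** * The Hilbert quotient of a complete semi-inner-product space *)

Section semi_inner_product.
Context {R : realType} {V : lmodType R}.
Variables (W : set V) (b : V -> V -> R).
Hypotheses (W0 : W 0) (Wlin : forall a x y, W x -> W y -> W (a *: x + y))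
  (bC : forall x y, W x -> W y -> b x y = b y x)
  (blin : forall a x y z, W x -> W y -> W z -> b (a *: x + y) z = a * b x z + b y z)
  (bge0 : forall x, W x -> 0 <= b x x)
  (complete : forall x_ : nat -> V, (forall n, W (x_ n)) ->
    (forall e : R, 0 < e -> exists K, forall i j, (K <= i)%N -> (K <= j)%N ->
      b (x_ i - x_ j) (x_ i - x_ j) <= e) ->
    exists2 x, W x & forall e : R, 0 < e -> exists K, forall n, (K <= n)%N ->
      b (x_ n - x) (x_ n - x) <= e).
Implicit Types (x y z : V).

Lemma semi_inner_expand (a : R) x y : W x -> W y ->
  b (a *: x + y) (a *: x + y) = a ^+ 2 * b x x + 2 * a * b x y + b y y.
Proof.
move=> Wx Wy; have Wz := Wlin a Wx Wy.
rewrite blin// (bC Wx Wz) (bC Wy Wz) !blin// (bC Wy Wx); ring.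
Qed.

(** A nonnegative quadratic polynomial in [a] is evaluated at its minimiser [- B / A] or, when
    [A = 0] and [B != 0], at a point where it would be -1. *)
Lemma semi_inner_cauchy x y : W x -> W y -> b x y ^+ 2 <= b x x * b y y.
Proof.
move=> Wx Wy.
have q a : 0 <= a ^+ 2 * b x x + 2 * a * b x y + b y y.
  by rewrite -semi_inner_expand// bge0//; exact: Wlin.
have A0 := bge0 Wx; have C0 := bge0 Wy.
move: (b x x) (b x y) (b y y) q A0 C0 => A B C q A0 C0.
have [A00|An0] := eqVneq A 0.
  suff -> : B = 0 by rewrite expr0n A00 mul0r.
  apply/eqP; apply: contraT => Bn0; have := q (- (C + 1) / (2 * B)).
  rewrite A00 mulr0 add0r (_ : 2 * _ * B = - (C + 1)); last by field.
  by rewrite leNgt => /negP[]; lra.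
have Ap : 0 < A by rewrite lt_neqAle eq_sym An0.
have := q (- B / A).
rewrite (_ : _ + _ = (A * C - B ^+ 2) / A); last by field.
by rewrite pmulr_lge0 ?invr_gt0// subr_ge0.
Qed.

Let N x := Num.sqrt (b x x).

Let WZ a x : W x -> W (a *: x).
Proof. by move=> Wx; rewrite -[a *: x]addr0; exact: Wlin. Qed.

Let bZ a x : W x -> b (a *: x) (a *: x) = a ^+ 2 * b x x.
Proof.
move=> Wx; have := semi_inner_expand a Wx W0; rewrite addr0 => ->.
have b0 z : W z -> b 0 z = 0 by move=> Wz; have := blin (-1) Wz Wz Wz; rewrite scaleN1r addNr mulN1r addNr.
by rewrite (bC Wx W0) !b0// mulr0 !addr0.
Qed.

Let normZ a x : W x -> N (a *: x) = `|a| * N x.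
Proof. by move=> Wx; rewrite /N bZ// sqrtrM ?sqr_ge0// sqrtr_sqr. Qed.

Let WD x y : W x -> W y -> W (x + y).
Proof. by move=> Wx Wy; rewrite -[x]scale1r; exact: Wlin. Qed.

Let normD x y : W x -> W y -> N (x + y) <= N x + N y.
Proof.
move=> Wx Wy; rewrite -(@ler_sqr _ (N (x + y))) ?nnegrE ?addr_ge0 ?sqrtr_ge0//.
rewrite sqrrD /N !sqr_sqrtr ?bge0//; last exact: WD.
have := semi_inner_expand 1 Wx Wy; rewrite scale1r expr1n mul1r mulr1 => ->.
suff : b x y <= Num.sqrt (b x x) * Num.sqrt (b y y) by rewrite mulr2n; lra.
rewrite (le_trans (ler_norm _))// -(@ler_sqr _ `|_|) ?nnegrE ?mulr_ge0 ?sqrtr_ge0//.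
by rewrite exprMn real_normK ?num_real// !sqr_sqrtr ?bge0// semi_inner_cauchy.
Qed.

Let WB x y : W x -> W y -> W (x - y).
Proof. by move=> Wx Wy; apply: WD => //; rewrite -scaleN1r; exact: WZ. Qed.

Let ncomplete (x_ : nat -> V) : (forall n, W (x_ n)) ->
    (forall e : R, 0 < e -> exists K, forall i j, (K <= i)%N -> (K <= j)%N ->
      N (x_ i - x_ j) <= e) ->
    exists2 x, W x & forall e : R, 0 < e -> exists K, forall n, (K <= n)%N ->
      N (x_ n - x) <= e.
Proof.
move=> Wx cN; have [e e0|x Wxl xP] := complete Wx.
  have s0 : 0 < Num.sqrt e by rewrite sqrtr_gt0.
  have [K KP] := cN _ s0; exists K => i j Ki Kj.
  by have := KP i j Ki Kj; rewrite /N ler_sqrt// ltW.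
exists x => // e e0; have [K KP] := xP _ (exprn_gt0 2 e0); exists K => n /KP nx.
by rewrite /N -[leRHS](gtr0_norm e0) -sqrtr_sqr ler_sqrt// exprn_ge0// ltW.
Qed.

(** The inner product of two classes is [b] on chosen preimages. Two preimages of a class differ by
    a vector of zero norm, which the Cauchy-Schwarz inequality makes invisible to [b]. *)
Lemma semi_inner_hilbert : exists (B : hilbertType R) (cls : V -> B),
  [/\ forall a x y, W x -> W y -> cls (a *: x + y) = a *: cls x + cls y,
      forall x y, W x -> W y -> inner (cls x) (cls y) = b x y &
      forall z : B, exists2 x, W x & cls x = z].
Proof.
have [B [cls [lin nrm surj]]] := seminormed_banach
  (SeminormedSpace W0 Wlin normZ normD ncomplete).
have /choice[r rP] (z : B) : exists x, W x /\ cls x = z.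
  by have [x Wx xz] := surj z; exists x.
pose ip (z w : B) := b (r z) (r w).
have nrm' x : W x -> N x = `|cls x| by move=> Wx; rewrite nrm.
have rE x z : W x -> W z -> b (r (cls x)) z = b x z.
  move=> Wx Wz; have [Wr rE] := rP (cls x).
  have WB' := WB Wr Wx.
  have n0 : b (r (cls x) - x) (r (cls x) - x) = 0.
    have : N (r (cls x) - x) = 0.
      rewrite nrm'// addrC -scaleN1r lin// scaleN1r rE addNr normr0//.
    by rewrite /N => /eqP; rewrite sqrtr_eq0 => le0; apply/le_anti; rewrite le0 bge0.
  have : b (r (cls x) - x) z = 0.
    have := semi_inner_cauchy WB' Wz; rewrite n0 mul0r => le0.
    by apply/eqP; rewrite -sqrf_eq0; apply/eqP/le_anti; rewrite le0 sqr_ge0.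
  rewrite addrC -scaleN1r blin// mulN1r addrC => /eqP.
  by rewrite subr_eq0 => /eqP.
have ipE1 x (z : B) : W x -> ip (cls x) z = b x (r z).
  by move=> Wx; have [Wz _] := rP z; exact: rE.
have ipC (z w : B) : ip z w = ip w z.
  by have [Wz _] := rP z; have [Ww _] := rP w; exact: bC.
have ipE x y : W x -> W y -> ip (cls x) (cls y) = b x y.
  move=> Wx Wy; have [Wr _] := rP (cls y).
  by rewrite ipE1// bC// rE// bC.
have ipD (z w t : B) : ip (z + w) t = ip z t + ip w t.
  have [x Wx <-] := surj z; have [y Wy <-] := surj w; have [Wt _] := rP t.
  have -> : cls x + cls y = cls (x + y) by rewrite -[x in RHS]scale1r lin// scale1r.
  have -> : x + y = 1 *: x + y by rewrite scale1r.
  rewrite !ipE1//; last exact: Wlin.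
  by rewrite blin// mul1r.
have cls0 : cls 0 = 0 by have := lin (-1) _ _ W0 W0; rewrite scaler0 addr0 scaleN1r addNr.
have ipZ a (z w : B) : ip (a *: z) w = a * ip z w.
  have [x Wx <-] := surj z; have [Ww _] := rP w.
  have -> : a *: cls x = cls (a *: x + 0) by rewrite lin// cls0 addr0.
  rewrite !ipE1//; last exact: Wlin.
  rewrite blin//.
  have := blin (-1) W0 W0 Ww; rewrite scaleN1r oppr0 addr0 mulN1r addNr => ->.
  by rewrite addr0.
have ipN (z : B) : ip z z = `|z| ^+ 2.
  have [x Wx <-] := surj z; rewrite ipE// -nrm'// /N sqr_sqrtr//; exact: bge0.
pose HM := CompleteNormedModule_isHilbert.Build R B ipC ipD ipZ ipN.
pose BH : hilbertType R := HB.pack (CompleteNormedModule.sort B) HM.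
by exists BH, cls; split.
Qed.

End semi_inner_product.

(** * Linearity and completeness of the closure of the gradient *)

Section sobolev_space.
Context {R : realType} {X : completeNormedModType R} {H : hilbertType R}.
Variables (istar : cdual X -> H) (nu : {measure set (borel X) -> \bar R}) (p : R).
Variable e : nat -> H.
Hypotheses (e_dense : forall h (r : R), 0 < r -> exists n, `|h - e n| < r)
  (p1 : 1 <= p) (nu_fin : (nu setT < +oo)%E).
Implicit Types (f g : X -> R) (F G : X -> H) (a r : R).
Local Notation Np f := (Lnorm nu p%:E (fun x => (f x)%:E)).
Local Notation cl := (DH_closure istar nu p).

Lemma measurable_norm_borel F : measurable_fun setT (F : borel X -> borel H) ->
  measurable_fun setT (fun x : borel X => `|F x|).
Proof.
by move=> mF; have := measurable_norm_subcst 0 mF; under eq_fun do rewrite subr0.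
Qed.

Lemma DH_Lp f F : DH istar f F -> (f : borel X -> R) \in Lfun nu p%:E /\ LpH nu p F.
Proof.
move=> fF; have [mf mF] := DH_measurable fF.
have [M MP] := DH_bounded fF; have [M' M'P] := DH_bounded_grad fF.
have mnF := measurable_norm_borel mF.
split; first by apply: Lfun_intro => //; apply: (Lnorm_bounded p1 nu_fin (e := M)) => //; exact: le_trans (MP 0).
split=> //; apply: Lfun_intro => //; apply: (Lnorm_bounded p1 nu_fin (e := M')) => //.
  exact: le_trans (M'P 0).
by move=> x; rewrite normr_id.
Qed.

Lemma measurable_lincomb a f g : measurable_fun setT (f : borel X -> R) ->
  measurable_fun setT (g : borel X -> R) ->
  measurable_fun setT (fun x : borel X => a * f x + g x).
Proof. by move=> mf mg; apply: measurable_funD => //; exact: measurable_funM. Qed.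

Lemma measurable_lincombH a F G : measurable_fun setT (F : borel X -> borel H) ->
  measurable_fun setT (G : borel X -> borel H) ->
  measurable_fun setT ((fun x => a *: F x + G x) : borel X -> borel H).
Proof.
by move=> mF mG; apply: (measurable_borelD e_dense) => //; exact: measurable_borelZ.
Qed.

Lemma Lnorm_lincomb a (b c d : X -> R) : measurable_fun setT (b : borel X -> R) ->
  measurable_fun setT (c : borel X -> R) -> measurable_fun setT (d : borel X -> R) ->
  (forall x, `|d x| <= `|a| * `|b x| + `|c x|) -> (Np d <= `|a|%:E * Np b + Np c)%E.
Proof.
move=> mb mc md dbc; apply: (@le_trans _ _ (Np (fun x => a * b x) + Np c)%E).
  apply: (Lnorm_leD p1) => //; first exact: measurable_funM.
  by apply: aeW => x; rewrite normrM.
rewrite leeD2r//; apply: (Lnorm_leZ p1) => //; first exact: measurable_funM.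
by apply: aeW => x; rewrite normrM.
Qed.

Lemma Lnorm_lincomb_fin a (b c d : X -> R) : measurable_fun setT (b : borel X -> R) ->
  measurable_fun setT (c : borel X -> R) -> measurable_fun setT (d : borel X -> R) ->
  (forall x, `|d x| <= `|a| * `|b x| + `|c x|) ->
  (Np b < +oo)%E -> (Np c < +oo)%E -> (Np d < +oo)%E.
Proof.
move=> mb mc md dbc bfin cfin; apply: le_lt_trans (Lnorm_lincomb mb mc md dbc) _.
by rewrite lte_add_pinfty// lte_mul_pinfty// lee_fin.
Qed.

Lemma LpH_measurable F : LpH nu p F ->
  measurable_fun setT (F : borel X -> borel H) /\ (Np (fun x => `|F x|) < +oo)%E.
Proof. by move=> [mF /Lfun_norm_lty]. Qed.

Lemma Lnorm_cvg_lincomb a (b_ c_ d_ : nat -> X -> R) :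
  (forall k, measurable_fun setT (b_ k : borel X -> R)) ->
  (forall k, measurable_fun setT (c_ k : borel X -> R)) ->
  (forall k, measurable_fun setT (d_ k : borel X -> R)) ->
  (forall k x, `|d_ k x| <= `|a| * `|b_ k x| + `|c_ k x|) ->
  Np (b_ k) @[k --> \oo] --> 0%E -> Np (c_ k) @[k --> \oo] --> 0%E ->
  Np (d_ k) @[k --> \oo] --> 0%E.
Proof.
move=> mb mc md dbc; have N0 (u : nat -> X -> R) k : (0 <= Np (u k))%E by exact: Lnorm_ge0.
move=> /(ereal_cvg0P (N0 b_)) b0 /(ereal_cvg0P (N0 c_)) c0; apply/(ereal_cvg0P (N0 d_)) => r r0.
have a1 : 0 < `|a| + 1 by rewrite ltr_wpDl.
have s0 : 0 < r / (`|a| + 1) by exact: divr_gt0.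
have [K1 K1P] := b0 _ s0; have [K2 K2P] := c0 _ s0.
exists (maxn K1 K2) => n; rewrite geq_max => /andP[/K1P nb /K2P nc].
apply: (le_trans (Lnorm_lincomb (mb n) (mc n) (md n) (dbc n))).
apply: (@le_trans _ _ (`|a|%:E * (r / (`|a| + 1))%:E + (r / (`|a| + 1))%:E)%E).
  by rewrite leeD// lee_wpmul2l// lee_fin.
rewrite -EFinM -EFinD lee_fin le_eqVlt; apply/orP; left; apply/eqP.
by field; rewrite gt_eqF.
Qed.

Lemma closure_lin a f F g G : cl f F -> cl g G ->
  cl (fun x => a * f x + g x) (fun x => a *: F x + G x).
Proof.
move=> [Lf LF [f_ [F_ [Df cf cF]]]] [Lg LG [g_ [G_ [Dg cg cG]]]].
have mf := Lfun_measurable Lf; have mg := Lfun_measurable Lg.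
have [mF fF] := LpH_measurable LF; have [mG fG] := LpH_measurable LG.
have mfg := measurable_lincomb a mf mg.
have mFG := measurable_lincombH a mF mG.
have mfk k := (DH_measurable (Df k)).1; have mFk k := (DH_measurable (Df k)).2.
have mgk k := (DH_measurable (Dg k)).1; have mGk k := (DH_measurable (Dg k)).2.
split.
- apply: Lfun_intro => //; apply: (Lnorm_lincomb_fin mf mg mfg (a := a)).
  + by move=> x; rewrite -normrM ler_normD.
  + exact: Lfun_norm_lty Lf.
  + exact: Lfun_norm_lty Lg.
- split=> //; apply: Lfun_intro; first exact: measurable_norm_borel.
  apply: (Lnorm_lincomb_fin (a := a) _ _ _ _ fF fG); do ?exact: measurable_norm_borel.
  by move=> x; rewrite !normr_id -normrZ ler_normD.
exists (fun k x => a * f_ k x + g_ k x), (fun k x => a *: F_ k x + G_ k x); split.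
- by move=> k; apply: DH_D (Dg k); exact: DH_Z.
- apply: (Lnorm_cvg_lincomb (a := a) _ _ _ _ cf cg) => [k|k|k|k x].
  + exact: measurable_funB.
  + exact: measurable_funB.
  + by apply: measurable_funB => //; exact: measurable_lincomb.
  + by rewrite opprD addrACA -mulrBr (le_trans (ler_normD _ _))// normrM.
- apply: (Lnorm_cvg_lincomb (a := a) _ _ _ _ cF cG) => [k|k|k|k x].
  + exact: (measurable_norm_sub e_dense).
  + exact: (measurable_norm_sub e_dense).
  + by apply: (measurable_norm_sub e_dense) => //; exact: measurable_lincombH.
  + by rewrite !normr_id opprD addrACA -scalerBr (le_trans (ler_normD _ _))// normrZ.
Qed.

Lemma closure0 : cl (fun=> 0) (fun=> 0).
Proof.
have D0 := DH_cst istar (0 : R); have [L1 L2] := DH_Lp D0.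
have N00 : Np (fun _ : X => 0) = 0%E by rewrite Lnorm0// eqe gt_eqF// (lt_le_trans ltr01).
split=> //; exists (fun _ _ => 0), (fun _ _ => 0); split=> //.
- rewrite /Lp_cvg (_ : (fun _ => _) = (fun=> 0%E)); first exact: cvg_cst.
  by apply/funext => k; rewrite -[RHS]N00; apply: eq_Lnorm => x; rewrite subrr.
- apply/ereal_cvg0P => [k|r r0]; first exact: Lnorm_ge0.
  exists 0%N => k _; under eq_Lnorm do rewrite subrr normr0.
  by rewrite N00 lee_fin ltW.
Qed.

(** [riesz_fischer] is applied separately to the functions and to their gradients. The limit pair
    belongs to the closure by a diagonal choice: cylindrical functions within [1 / (n + 1)] of the
    [n]-th pair. *)
Lemma W1p_complete (f_ : nat -> X -> R) (F_ : nat -> X -> H) :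
  (forall n, cl (f_ n) (F_ n)) ->
  (forall r, 0 < r -> exists K, forall i j, (K <= i)%N -> (K <= j)%N ->
     (Np (fun x => (f_ i x - f_ j x)) <= r%:E)%E /\
     (Np (fun x => `|F_ i x - F_ j x|) <= r%:E)%E) ->
  exists f F, cl f F /\ forall r, 0 < r -> exists K, forall n, (K <= n)%N ->
     (Np (fun x => (f_ n x - f x)) <= r%:E)%E /\
     (Np (fun x => `|F_ n x - F x|) <= r%:E)%E.
Proof.
move=> clfF cauchy.
have mf n : measurable_fun setT (f_ n : borel X -> R).
  by have [/Lfun_measurable] := clfF n.
have mF n : measurable_fun setT (F_ n : borel X -> borel H).
  by have [_ []] := clfF n.
have mB (A : set (borel X)) : measurable A -> measurable_fun setT (fun x : borel X => x \in A).
  by move=> mA; apply: (measurable_fun_bool true); rewrite setTI (_ : _ @^-1` _ = A)//; apply/seteqP; split=> x /=; [exact: set_mem|exact: mem_set].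
have Nabs (b : X -> R) : Np (fun x => `|b x|) = Np b.
  by rewrite -[RHS]Lnorm_abse; apply: eq_Lnorm.
have [||||f mfl fl] := @riesz_fischer _ (borel X) R nu p p1 nu_fin R
  [set f | measurable_fun setT (f : borel X -> R)] _ _ _ f_ mf _.
- by move=> b c /= mb mc; apply: measurableT_comp => //; exact: measurable_funB.
- by move=> A b /= mA mb; apply: measurable_fun_ifT => //; exact: mB.
- by move=> b_ b /= mb bb; apply: (@measurable_fun_cvg _ (borel X) R setT b_) => // x _; exact: bb.
- move=> r r0; have [K KP] := cauchy r r0; exists K => i j Ki Kj.
  by rewrite Nabs; have [] := KP i j Ki Kj.
have [||||F mFl Fl] := @riesz_fischer _ (borel X) R nu p p1 nu_fin H
  [set F | measurable_fun setT (F : borel X -> borel H)] _ _ _ F_ mF _.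
- by move=> b c /= mb mc; exact: (measurable_norm_sub e_dense).
- by move=> A b /= mA mb; apply: measurable_fun_ifT => //; exact: mB.
- by move=> b_ b /= mb bb; exact: (measurable_borel_cvg e_dense mb bb).
- move=> r r0; have [K KP] := cauchy r r0; exists K => i j Ki Kj.
  by have [] := KP i j Ki Kj.
have lim r : 0 < r -> exists K, forall n, (K <= n)%N ->
     (Np (fun x => (f_ n x - f x)) <= r%:E)%E /\
     (Np (fun x => `|F_ n x - F x|) <= r%:E)%E.
  move=> r0; have [K1 K1P] := fl r r0; have [K2 K2P] := Fl r r0.
  exists (maxn K1 K2) => n; rewrite geq_max => /andP[/K1P nf /K2P nF].
  by rewrite -Nabs.
exists f, F; split=> //.
have mnF := measurable_norm_borel mFl.
have [K1 /(_ _ (leqnn _))[fK FK]] := lim 1 ltr01.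
have sub1 (x y : R) : `|x| <= `|1 : R| * `|y - x| + `|y|.
  by rewrite normr1 mul1r -{1}[x](subKr y) [leRHS]addrC ler_normB.
split.
- apply: Lfun_intro => //; apply: (Lnorm_lincomb_fin (a := 1) (b := fun x => f_ K1 x - f x) (c := f_ K1)) => //.
  + exact: measurable_funB.
  + exact: le_lt_trans fK (ltry _).
  + by have [/Lfun_norm_lty] := clfF K1.
- split=> //; apply: Lfun_intro => //.
  apply: (Lnorm_lincomb_fin (a := 1) (b := fun x => `|F_ K1 x - F x|) (c := fun x => `|F_ K1 x|)) => //.
  + exact: (measurable_norm_sub e_dense).
  + exact: measurable_norm_borel.
  + by move=> x; rewrite !normr_id normr1 mul1r -{1}[F x](subKr (F_ K1 x)) [leRHS]addrC ler_normB.
  + exact: le_lt_trans FK (ltry _).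
  + by have [_ [_ /Lfun_norm_lty]] := clfF K1.
have /choice[g gP] (n : nat) : exists gG : (X -> R) * (X -> H), [/\ DH istar gG.1 gG.2,
    (Np (fun x => gG.1 x - f_ n x) <= (n.+1%:R^-1)%:E)%E &
    (Np (fun x => `|gG.2 x - F_ n x|) <= (n.+1%:R^-1)%:E)%E].
  have [_ _ [g_ [G_ [DgG cg cG]]]] := clfF n.
  have n0 : 0 < n.+1%:R^-1 :> R by rewrite invr_gt0.
  have [k1 k1P] := (ereal_cvg0P (fun n => Lnorm_ge0 _ _ _)).1 cg _ n0.
  have [k2 k2P] := (ereal_cvg0P (fun n => Lnorm_ge0 _ _ _)).1 cG _ n0.
  exists (g_ (maxn k1 k2), G_ (maxn k1 k2)); split=> //=.
    by apply: k1P; exact: leq_maxl.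
  by apply: k2P; exact: leq_maxr.
have h0 : (n.+1%:R^-1 : R)%:E @[n --> \oo] --> 0%E.
  by apply: cvg_EFin; [exact: nearW|exact: cvg_harmonic].
have inv0 (b_ : nat -> X -> R) : (forall n, Np (b_ n) <= (n.+1%:R^-1)%:E)%E ->
    Np (b_ n) @[n --> \oo] --> 0%E.
  move=> bn; apply: (squeeze_cvge _ (cvg_cst 0%E) h0).
  by apply: nearW => n; rewrite Lnorm_ge0 bn.
have mg n := (DH_measurable (let: And3 D _ _ := gP n in D)).1.
have mG n := (DH_measurable (let: And3 D _ _ := gP n in D)).2.
exists (fun n => (g n).1), (fun n => (g n).2); split.
- by move=> n; have [] := gP n.
- apply: (@Lnorm_cvg_lincomb 1 (fun n x => (g n).1 x - f_ n x) (fun n x => f_ n x - f x)).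
  + by move=> n; exact: measurable_funB.
  + by move=> n; exact: measurable_funB.
  + by move=> n; exact: measurable_funB.
  + by move=> n x; rewrite normr1 mul1r -(subrKA (f_ n x)) ler_normD.
  + by apply: inv0 => n; have [] := gP n.
  + apply/ereal_cvg0P => [n|r r0]; first exact: Lnorm_ge0.
    by have [K KP] := lim r r0; exists K => n /KP[].
- apply: (@Lnorm_cvg_lincomb 1 (fun n x => `|(g n).2 x - F_ n x|) (fun n x => `|F_ n x - F x|)).
  + by move=> n; exact: (measurable_norm_sub e_dense).
  + by move=> n; exact: (measurable_norm_sub e_dense).
  + by move=> n; exact: (measurable_norm_sub e_dense).
  + by move=> n x; rewrite !normr_id normr1 mul1r -(subrKA (F_ n x)) ler_normD.
  + by apply: inv0 => n; have [] := gP n.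
  + apply/ereal_cvg0P => [n|r r0]; first exact: Lnorm_ge0.
    by have [K KP] := lim r r0; exists K => n /KP[].
Qed.

End sobolev_space.

Section sobolev_quotient.
Context {R : realType} {X : completeNormedModType R} {H : hilbertType R}.
Variables (istar : cdual X -> H) (nu : {measure set (borel X) -> \bar R}) (p : R).
Variable e : nat -> H.
Hypotheses (e_dense : forall h (r : R), 0 < r -> exists n, `|h - e n| < r)
  (p1 : 1 <= p) (nu_fin : (nu setT < +oo)%E) (closable : DH_closable istar nu p).
Implicit Types (f g : X -> R) (F G : X -> H) (a r : R).
Local Notation Np f := (Lnorm nu p%:E (fun x => (f x)%:E)).
Local Notation cl := (DH_closure istar nu p).
Local Notation W := (W1p istar nu p).

Lemma Lnorm_ae0 f : measurable_fun setT (f : borel X -> R) ->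
  Np f = 0%E <-> {ae nu, forall x : borel X, f x = 0}.
Proof.
move=> mf; split=> [f0|f0].
  have p0 : (0 < p%:E)%E by rewrite lte_fin (lt_le_trans ltr01).
  have mEf : measurable_fun setT (fun x : borel X => (f x)%:E) by exact/measurable_EFinP.
  by apply: filterS (Lnorm_eq0_eq0 mEf p0 f0) => x /= /(_ I)[].
apply/le_anti; rewrite Lnorm_ge0 andbT.
have N00 : Np (fun _ : X => 0) = 0%E by rewrite Lnorm0// eqe gt_eqF// (lt_le_trans ltr01).
rewrite -N00; apply: (le_Lnorm p1) => //.
by apply: filterS f0 => x ->; rewrite normr0.
Qed.

(** Closability concerns the function 0 itself, whereas [f - g] vanishes only almost everywhere; a
    sequence that approximates the difference approximates 0 as well, with the same gradients. *)
Lemma closure_unique f g F G : cl f F -> cl g G ->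
  {ae nu, forall x : borel X, f x = g x} -> {ae nu, forall x : borel X, F x = G x}.
Proof.
move=> cf cg fg; have [Lh LK [h_ [H_ [DhH ch cH]]]] := closure_lin e_dense p1 (-1) cg cf.
have mh := Lfun_measurable Lh.
suff : cl (fun=> 0) (fun x => -1 *: G x + F x).
  move=> /closable; apply: filterS => x.
  by rewrite scaleN1r addrC => /eqP; rewrite subr_eq0 => /eqP.
have [L0 _ _] := closure0 istar p1 nu_fin.
split=> //; exists h_, H_; split=> //.
apply/ereal_cvg0P => [n|r r0]; first exact: Lnorm_ge0.
have [K KP] := (ereal_cvg0P (fun n => Lnorm_ge0 _ _ _)).1 ch r r0.
exists K => n /KP; apply: le_trans; have [mhn _] := DH_measurable (DhH n).
apply: (le_Lnorm p1); [exact: measurable_funB|exact: measurable_funB|].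
by apply: filterS fg => x ->; rewrite mulN1r addNr.
Qed.

(** One gradient in the closure, fixed once; under closability any other agrees with it almost
    everywhere. Outside the domain it is 0. *)
Definition weak_grad f : X -> H := xget (fun=> 0) [set F | cl f F].

Lemma weak_gradP f : W f -> cl f (weak_grad f).
Proof. by move=> fF; exact: (@xgetPex _ _ [set F | cl f F] fF). Qed.

Lemma weak_grad_unique f F : cl f F -> {ae nu, forall x : borel X, F x = weak_grad f x}.
Proof.
move=> fF; apply: (closure_unique fF (weak_gradP (ex_intro _ F fF))).
exact: aeW.
Qed.

Lemma W1p_lin a f g : W f -> W g -> W (fun x => a * f x + g x).
Proof. by move=> [F fF] [G gG]; exists (fun x => a *: F x + G x); exact: (closure_lin e_dense p1 a fF gG). Qed.

Lemma closure_measurable f F : cl f F ->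
  [/\ measurable_fun setT (f : borel X -> R), measurable_fun setT (F : borel X -> borel H),
    measurable_fun setT (fun x : borel X => `|F x|),
    (Np f < +oo)%E & (Np (fun x => `|F x|) < +oo)%E].
Proof.
move=> [Lf LF _]; have [mF fF] := LpH_measurable LF.
split=> //; [exact: Lfun_measurable Lf|exact: measurable_norm_borel|exact: Lfun_norm_lty Lf].
Qed.

Definition W1p_norm f : R := fine (Np f + Np (fun x => `|weak_grad f x|))%E.

Lemma W1p_normE f F : cl f F -> (W1p_norm f)%:E = (Np f + Np (fun x => `|F x|))%E.
Proof.
move=> fF; have [mf mF mnF ff fFn] := closure_measurable fF.
have [_ _ mnG _ fGn] := closure_measurable (weak_gradP (ex_intro _ F fF)).
have FG := weak_grad_unique fF.
have -> : Np (fun x => `|F x|) = Np (fun x => `|weak_grad f x|).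
  by apply/le_anti/andP; split; apply: (le_Lnorm p1) => //; apply: filterS FG => x ->.
by rewrite fineK// fin_numD !ge0_fin_numE ?Lnorm_ge0// ff fGn.
Qed.

Lemma Lnorm_scale a f : measurable_fun setT (f : borel X -> R) ->
  Np (fun x => a * f x) = (`|a|%:E * Np f)%E.
Proof.
move=> mf; apply/le_anti/andP; split.
  apply: (Lnorm_leZ p1) => //; first exact: measurable_funM.
  by apply: aeW => x; rewrite normrM.
have [->|a0] := eqVneq a 0; first by rewrite normr0 mul0e Lnorm_ge0.
apply: (@le_trans _ _ (`|a|%:E * (`|a^-1|%:E * Np (fun x => a * f x)))%E).
  apply: lee_wpmul2l => //; apply: (Lnorm_leZ p1) => //; first exact: measurable_funM.
  by apply: aeW => x; rewrite -normrM mulKf.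
by rewrite muleA -EFinM -normrM divff// normr1 mul1e.
Qed.

Lemma W1p_normZ a f : W f -> W1p_norm (fun x => a * f x) = `|a| * W1p_norm f.
Proof.
move=> Wf; have fF := weak_gradP Wf.
have [mf mF mnF ff fFn] := closure_measurable fF.
have := closure_lin e_dense p1 a fF (closure0 istar p1 nu_fin).
rewrite (_ : (fun x => a * f x + 0) = (fun x => a * f x)); last by apply/funext => x; rewrite addr0.
move=> /W1p_normE afE; apply: EFin_inj.
rewrite afE EFinM (W1p_normE fF) ge0_muleDr ?Lnorm_ge0//; congr (_ + _)%E.
  exact: Lnorm_scale.
have := Lnorm_scale `|a| mnF; rewrite normr_id => <-; apply: eq_Lnorm => x.
by rewrite addr0 normrZ.
Qed.

Lemma W1p_normD f g : W f -> W g ->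
  W1p_norm (fun x => f x + g x) <= W1p_norm f + W1p_norm g.
Proof.
move=> Wf Wg; have fF := weak_gradP Wf; have gG := weak_gradP Wg.
have [mf mF mnF _ _] := closure_measurable fF; have [mg mG mnG _ _] := closure_measurable gG.
have := closure_lin e_dense p1 1 fF gG.
rewrite (_ : (fun x => 1 * f x + g x) = (fun x => f x + g x)); last by apply/funext => x; rewrite mul1r.
move=> fgFG; have [mfg _ mnFG _ _] := closure_measurable fgFG.
rewrite -lee_fin EFinD (W1p_normE fF) (W1p_normE gG) (W1p_normE fgFG) addeACA leeD//.
  by apply: (Lnorm_leD p1) => //; apply: aeW => x; exact: ler_normD.
by apply: (Lnorm_leD p1) => //; apply: aeW => x; rewrite !normr_id scale1r ler_normD.
Qed.

Lemma W1p_normB_le f g F G r : cl f F -> cl g G -> W1p_norm (fun x => f x - g x) <= r ->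
  (Np (fun x => f x - g x) <= r%:E)%E /\ (Np (fun x => `|F x - G x|) <= r%:E)%E.
Proof.
move=> fF gG; have := closure_lin e_dense p1 (-1) gG fF.
have -> : (fun x => -1 * g x + f x) = (fun x => f x - g x).
  by apply/funext => x; rewrite mulN1r addrC.
have -> : (fun x => -1 *: G x + F x) = (fun x => F x - G x).
  by apply/funext => x; rewrite scaleN1r addrC.
move=> /W1p_normE fgE; rewrite -lee_fin fgE => le.
by split; apply: le_trans le; rewrite ?leeDl ?leeDr// Lnorm_ge0.
Qed.

Lemma W1p_norm_complete (f_ : nat -> X -> R) : (forall n, W (f_ n)) ->
  (forall r, 0 < r -> exists K, forall i j, (K <= i)%N -> (K <= j)%N ->
    W1p_norm (f_ i - f_ j) <= r) ->
  exists2 f, W f & forall r, 0 < r -> exists K, forall n, (K <= n)%N ->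
    W1p_norm (f_ n - f) <= r.
Proof.
move=> Wf cf; have cl_ n := weak_gradP (Wf n).
have [r r0|f [F [fF lim]]] := W1p_complete e_dense p1 nu_fin cl_.
  have [K KP] := cf r r0; exists K => i j Ki Kj.
  exact: (W1p_normB_le (cl_ i) (cl_ j) (KP i j Ki Kj)).
exists f; first by exists F.
move=> r r0; have [K KP] := lim _ (divr_gt0 r0 (ltr0n R 2)); exists K => n /KP[nf nF].
have := closure_lin e_dense p1 (-1) fF (cl_ n).
have -> : (fun x => -1 * f x + f_ n x) = f_ n - f.
  by apply/funext => x; rewrite mulN1r addrC.
have -> : (fun x => -1 *: F x + weak_grad (f_ n) x) = (fun x => weak_grad (f_ n) x - F x).
  by apply/funext => x; rewrite scaleN1r addrC.
by move=> /W1p_normE nE; rewrite -lee_fin nE [r]splitr EFinD leeD.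
Qed.

(** Almost everywhere equality of functions reaches their gradients only through [closure_unique],
    that is, through closability. This identifies the null space of the seminorm. *)
Lemma W1p_ae f g : W f -> W g ->
  W1p_norm (fun x => f x - g x) = 0 <-> {ae nu, forall x : borel X, f x = g x}.
Proof.
move=> Wf Wg; have fF := weak_gradP Wf; have gG := weak_gradP Wg.
have [mf mF _ _ _] := closure_measurable fF; have [mg mG _ _ _] := closure_measurable gG.
have mfg : measurable_fun setT (fun x : borel X => f x - g x) by exact: measurable_funB.
split=> [fg0|fg].
  have [N1 _] := W1p_normB_le fF gG (eq_ind_r (fun z => z <= 0) (lexx (0:R)) fg0).
  have /(Lnorm_ae0 mfg) : Np (fun x => f x - g x) = 0%E.
    by apply/le_anti; rewrite N1 Lnorm_ge0.
  by apply: filterS => x /eqP; rewrite subr_eq0 => /eqP.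
have FG := closure_unique fF gG fg.
have := closure_lin e_dense p1 (-1) gG fF.
have -> : (fun x => -1 * g x + f x) = (fun x => f x - g x).
  by apply/funext => x; rewrite mulN1r addrC.
have -> : (fun x => -1 *: weak_grad g x + weak_grad f x) =
    (fun x => weak_grad f x - weak_grad g x).
  by apply/funext => x; rewrite scaleN1r addrC.
move=> fgE; have [_ _ mn _ _] := closure_measurable fgE.
apply: EFin_inj; rewrite (W1p_normE fgE).
rewrite (Lnorm_ae0 mfg).2 ?(Lnorm_ae0 mn).2 ?adde0//.
  by apply: filterS FG => x ->; rewrite subrr normr0.
by apply: filterS fg => x ->; rewrite subrr.
Qed.

Lemma W1p_0 : W (fun=> 0).
Proof. by exists (fun=> 0); exact: closure0. Qed.

Lemma W1p_banach : W1p_is_banach istar nu p.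
Proof.
have [B [cls [lin nrm surj]]] := seminormed_banach
  (@SeminormedSpace R (X -> R) W W1p_norm W1p_0 W1p_lin W1p_normZ W1p_normD W1p_norm_complete).
exists B, cls; split; last by move=> f F fF; rewrite nrm ?(W1p_normE fF)//; exists F.
split=> //.
- exact: W1p_0.
- by move=> a f g Wf Wg; split; [exact: W1p_lin|exact: lin].
- move=> f g Wf Wg; rewrite -(W1p_ae Wf Wg).
  have W' : W (fun x => f x - g x).
    have := W1p_lin (-1) Wg Wf; congr (W _).
    by apply/funext => x; rewrite mulN1r addrC.
  rewrite -[W1p_norm _](nrm _ W').
  have -> : cls (fun x => f x - g x) = cls f - cls g.
    have -> : cls f - cls g = -1 *: cls g + cls f by rewrite scaleN1r addrC.
    rewrite -(lin (-1) _ _ Wg Wf); congr cls; apply/funext => x.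
    by rewrite [RHS](_ : _ = -1 * g x + f x)// mulN1r addrC.
  split=> [->|/normr0_eq0/eqP]; first by rewrite subrr normr0.
  by rewrite subr_eq0 => /eqP.
Qed.

End sobolev_quotient.

Section sobolev_hilbert.
Context {R : realType} {X : completeNormedModType R} {H : hilbertType R}.
Variables (istar : cdual X -> H) (nu : {measure set (borel X) -> \bar R}).
Variable e : nat -> H.
Hypotheses (e_dense : forall h (r : R), 0 < r -> exists n, `|h - e n| < r)
  (nu_fin : (nu setT < +oo)%E) (closable : DH_closable istar nu 2).
Implicit Types (f g h : X -> R) (F G : X -> H) (a r : R).
Local Notation N2 f := (Lnorm nu 2%:E (fun x => (f x)%:E)).
Local Notation cl := (DH_closure istar nu 2).
Local Notation W := (W1p istar nu 2).
Local Notation grad := (weak_grad istar nu 2).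
Local Notation int u := (nu.-integrable setT (EFin \o (u : borel X -> R))).

Let p1 : 1 <= 2 :> R. Proof. by rewrite ler1n. Qed.

Lemma L2_mul (b c : X -> R) : measurable_fun setT (b : borel X -> R) ->
  measurable_fun setT (c : borel X -> R) -> (N2 b < +oo)%E -> (N2 c < +oo)%E ->
  int (fun x => b x * c x).
Proof.
move=> mb mc bfin cfin; apply/Lfun1_integrable.
by apply: Lfun2_mul_Lfun1; apply: Lfun_intro.
Qed.

Lemma L2_sqr_le (b : X -> R) r : measurable_fun setT (b : borel X -> R) ->
  (N2 b < +oo)%E -> 0 <= r -> (N2 b <= r%:E)%E <-> \int[nu]_x (b x ^+ 2) <= r ^+ 2.
Proof.
move=> mb bfin r0; rewrite Lnorm_leP//.
have ib : int (fun x => b x ^+ 2) by have := L2_mul mb mb bfin bfin.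
have -> : (\int[nu]_x (`|b x| `^ 2)%:E)%E = (\int[nu]_x (b x ^+ 2))%:E.
  rewrite /Rintegral fineK ?integrable_fin_num//; apply: eq_integral => x _.
  by rewrite powR_mulrn// real_normK// num_real.
by rewrite powR_mulrn// lee_fin.
Qed.

Lemma closure_int f g F G : cl f F -> cl g G ->
  int (fun x => f x * g x) /\ int (fun x => inner (F x) (G x)).
Proof.
move=> fF gG; have [mf mF mnF ff Ff] := closure_measurable fF.
have [mg mG mnG gf Gf] := closure_measurable gG; split; first exact: L2_mul.
have i1 : int (fun x => `|F x| * `|G x|) by exact: L2_mul.
apply: le_integrable i1 => //.
  by apply/measurable_EFinP; exact: (measurable_inner e_dense).
move=> x _ /=; rewrite lee_fin [leRHS]ger0_norm ?mulr_ge0//; exact: inner_le.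
Qed.

Definition W12_inner f g : R :=
  \int[nu]_x (f x * g x) + \int[nu]_x inner (grad f x) (grad g x).

Lemma W12_innerE f g F G : cl f F -> cl g G ->
  W12_inner f g = \int[nu]_x (f x * g x) + \int[nu]_x inner (F x) (G x).
Proof.
move=> fF gG; congr (_ + _); have fF' := weak_gradP (ex_intro _ F fF).
have gG' := weak_gradP (ex_intro _ G gG).
have [_ mF _ _ _] := closure_measurable fF; have [_ mG _ _ _] := closure_measurable gG.
have [_ mF' _ _ _] := closure_measurable fF'; have [_ mG' _ _ _] := closure_measurable gG'.
rewrite /Rintegral; congr fine; apply: ae_eq_integral => //.
- by apply/measurable_EFinP; exact: (measurable_inner e_dense).
- by apply/measurable_EFinP; exact: (measurable_inner e_dense).
have FE := weak_grad_unique e_dense p1 nu_fin closable fF.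
have GE := weak_grad_unique e_dense p1 nu_fin closable gG.
by apply: filterS (filterI FE GE) => x [-> ->].
Qed.

Let W0 : W (fun=> 0). Proof. exact: W1p_0. Qed.

Let Wlin a f g : W f -> W g -> W (fun x => a * f x + g x).
Proof. exact: (W1p_lin e_dense p1). Qed.

Lemma W12_innerC f g : W12_inner f g = W12_inner g f.
Proof.
by congr (_ + _); apply: eq_Rintegral => x _; [rewrite mulrC|rewrite innerC].
Qed.

Lemma W12_inner_lin a f g h : W f -> W g -> W h ->
  W12_inner (fun x => a * f x + g x) h = a * W12_inner f h + W12_inner g h.
Proof.
move=> /weak_gradP fF /weak_gradP gG /weak_gradP hK.
have [i1 i2] := closure_int fF hK; have [i3 i4] := closure_int gG hK.
rewrite (W12_innerE (closure_lin e_dense p1 a fF gG) hK) mulrDr addrACA.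
congr (_ + _).
  rewrite -RintegralZl// -RintegralD//; last exact: (integrableZl _ a i1).
  by apply: eq_Rintegral => x _; rewrite mulrDl mulrA.
rewrite -RintegralZl// -RintegralD//; last exact: (integrableZl _ a i2).
by apply: eq_Rintegral => x _; rewrite innerDl innerZl.
Qed.

Lemma W12_inner_sqr f F : cl f F ->
  W12_inner f f = \int[nu]_x (f x ^+ 2) + \int[nu]_x (`|F x| ^+ 2).
Proof.
move=> fF; rewrite (W12_innerE fF fF); congr (_ + _).
by apply: eq_Rintegral => x _; rewrite inner_norm.
Qed.

Lemma Rintegral_sqr_ge0 (b : X -> R) : 0 <= \int[nu]_x (b x ^+ 2).
Proof. by apply: Rintegral_ge0 => x _; rewrite sqr_ge0. Qed.

Lemma W12_inner_ge0 f : W f -> 0 <= W12_inner f f.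
Proof.
by move=> /weak_gradP/W12_inner_sqr ->; rewrite addr_ge0// Rintegral_sqr_ge0.
Qed.

Lemma W12_inner_le f F r : cl f F -> 0 <= r ->
  W12_inner f f <= r ^+ 2 -> (N2 f <= r%:E)%E /\ (N2 (fun x => `|F x|) <= r%:E)%E.
Proof.
move=> fF r0; have [mf _ mnF ff Ff] := closure_measurable fF.
rewrite (W12_inner_sqr fF) => le.
split; apply/L2_sqr_le => //; apply: le_trans le; rewrite ?lerDl ?lerDr; exact: Rintegral_sqr_ge0.
Qed.

Lemma W12_inner_small f F r : cl f F -> 0 <= r ->
  (N2 f <= r%:E)%E -> (N2 (fun x => `|F x|) <= r%:E)%E -> W12_inner f f <= 2 * r ^+ 2.
Proof.
move=> fF r0; have [mf _ mnF ff Ff] := closure_measurable fF.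
move=> /(L2_sqr_le mf ff r0) le1 /(L2_sqr_le mnF Ff r0) le2.
by rewrite (W12_inner_sqr fF) mulr_natl mulr2n lerD.
Qed.

Lemma closureB f g F G : cl f F -> cl g G ->
  cl (fun x => f x - g x) (fun x => F x - G x).
Proof.
move=> fF gG; have := closure_lin e_dense p1 (-1) gG fF.
rewrite (_ : (fun x => -1 * g x + f x) = (fun x => f x - g x)); last first.
  by apply/funext => x; rewrite mulN1r addrC.
rewrite (_ : (fun x => -1 *: G x + F x) = (fun x => F x - G x))//.
by apply/funext => x; rewrite scaleN1r addrC.
Qed.

(** Smallness for the inner product and smallness of the two [L^2] norms imply each other up to a
    constant, so completeness is inherited from [W1p_complete]. *)
Lemma W12_complete (f_ : nat -> X -> R) : (forall n, W (f_ n)) ->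
  (forall r, 0 < r -> exists K, forall i j, (K <= i)%N -> (K <= j)%N ->
    W12_inner (f_ i - f_ j) (f_ i - f_ j) <= r) ->
  exists2 f, W f & forall r, 0 < r -> exists K, forall n, (K <= n)%N ->
    W12_inner (f_ n - f) (f_ n - f) <= r.
Proof.
move=> Wf cf; have cl_ n := weak_gradP (Wf n).
have [r r0|f [F [fF lim]]] := W1p_complete e_dense p1 nu_fin cl_.
  have [K KP] := cf _ (exprn_gt0 2 r0); exists K => i j Ki Kj.
  exact: (W12_inner_le (closureB (cl_ i) (cl_ j)) (ltW r0) (KP i j Ki Kj)).
exists f; first by exists F.
(* The halving of [r] compensates the factor 2 of [W12_inner_small], one square for the function and
   one for its gradient. *)
move=> r r0; have s0 : 0 < Num.sqrt (r / 2) by rewrite sqrtr_gt0 divr_gt0.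
have [K KP] := lim _ s0; exists K => n /KP[nf nF].
rewrite (le_trans (W12_inner_small (closureB (cl_ n) fF) (ltW s0) nf nF))//.
have r2 : 0 <= r / 2 by rewrite divr_ge0// ltW.
by rewrite sqr_sqrtr// mulrC divfK.
Qed.

Lemma W12_ae f g : W f -> W g ->
  W12_inner (fun x => f x - g x) (fun x => f x - g x) = 0 <->
  {ae nu, forall x : borel X, f x = g x}.
Proof.
move=> /weak_gradP fF /weak_gradP gG; have fgFG := closureB fF gG.
have [mfg _ mn _ _] := closure_measurable fgFG.
split=> [fg0|fg].
  have [N0 _] := W12_inner_le fgFG (lexx 0) (eq_ind_r (fun z => z <= 0 ^+ 2) (sqr_ge0 (0:R)) fg0).
  have /(Lnorm_ae0 nu p1 mfg) : N2 (fun x => f x - g x) = 0%E.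
    by apply/le_anti; rewrite N0 Lnorm_ge0.
  by apply: filterS => x /eqP; rewrite subr_eq0 => /eqP.
have FG := closure_unique e_dense p1 nu_fin closable fF gG fg.
apply/le_anti; rewrite W12_inner_ge0 ?andbT; last by exists (fun x => grad f x - grad g x).
have := W12_inner_small fgFG (lexx 0); rewrite expr0n mulr0; apply.
  rewrite (Lnorm_ae0 nu p1 mfg).2//.
  by apply: filterS fg => x ->; rewrite subrr.
rewrite (Lnorm_ae0 nu p1 mn).2//.
by apply: filterS FG => x ->; rewrite subrr normr0.
Qed.

Lemma W12_hilbert : W12_is_hilbert istar nu.
Proof.
have [B [cls [lin ip surj]]] := @semi_inner_hilbert R (X -> R) W W12_inner W0 Wlin
  (fun f g _ _ => W12_innerC f g) W12_inner_lin W12_inner_ge0 W12_complete.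
exists B, cls; split; last first.
  move=> f g F G fF gG; rewrite ip ?(W12_innerE fF gG)//; [by exists F|by exists G].
split=> //.
- by move=> a f g Wf Wg; split; [exact: Wlin|exact: lin].
- move=> f g Wf Wg; rewrite -(W12_ae Wf Wg).
  have W' : W (fun x => f x - g x).
    have := Wlin (-1) Wg Wf; congr (W _).
    by apply/funext => x; rewrite mulN1r addrC.
  rewrite -(ip _ _ W' W').
  have -> : cls (fun x => f x - g x) = cls f - cls g.
    have -> : cls f - cls g = -1 *: cls g + cls f by rewrite scaleN1r addrC.
    rewrite -(lin (-1) _ _ Wg Wf); congr cls; apply/funext => x.
    by rewrite [RHS](_ : _ = -1 * g x + f x)// mulN1r addrC.
  split=> [->|/inner_eq0/eqP]; first by rewrite subrr inner0l.
  by rewrite subr_eq0 => /eqP.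
Qed.

End sobolev_hilbert.

Theorem proposition2p17 (R : realType) (X : completeNormedModType R)
  (sepX : separable_space X)
  (* (1) *)
  (Q : {linear cdual X -> X})
  (Q_bounded : exists M : R, forall f, `|Q f| <= M * dual_norm f)
  (Q_sym : forall f g : cdual X, g (Q f) = f (Q g))
  (Q_ge0 : forall f : cdual X, 0 <= (f (Q f) : R))
  (DA : set X) (A : X -> X) (T : R -> clin X X)
  (T_semigroup : contraction_semigroup T) (A_gen : generates DA A T)
  (* the reproducing kernel Hilbert space of Q *)
  (H : hilbertType R) (i : clin H X) (istar : cdual X -> H)
  (H_rkhs : is_rkhs Q i istar)
  (* (2) *)
  (Qt : R -> cdual X -> X)
  (Qt_def : forall t f, 0 < t ->
     is_integral 0 t (fun s => T s (Q (dual_map (T s) f))) (Qt t f))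
  (Qt_gauss : forall t, 0 < t -> exists m : probability (borel X) R,
     centred_gaussian m /\ covariance_operator m (Qt t))
  (Qoo : cdual X -> X)
  (Qoo_def : forall f g : cdual X,
     (g (Qt t f) : R) @[t --> +oo] --> (g (Qoo f) : R))
  (mu : probability (borel X) R)
  (mu_gauss : centred_gaussian mu) (mu_nondeg : nondegenerate_gaussian mu)
  (mu_cov : covariance_operator mu Qoo)
  (* (3) *)
  (hQA : exists2 c : R, 0 < c & forall f g : cdual X, adjoint_at DA A f g ->
     exists2 h : H, i h = Qoo g & `|h| <= c * `|istar f|)
  (* (4) *)
  (U : X -> \bar R)
  (U_proper : proper_fun U) (U_lsc : lower_semicontinuous U)
  (U_convex : convex_fun U)
  (U_sobolev : forall p : R, 1 <= p -> exists2 u : X -> R,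
     W1p istar mu p u & {ae mu, forall x : borel X, U x = (u x)%:E})
  (nu : {measure set (borel X) -> \bar R})
  (nu_def : forall B : set (borel X), measurable B ->
     nu B = (\int[mu]_(x in B) expeR (- U x))%E) :
  [/\ forall p : R, 1 < p ->
        (forall f F, DH istar f F ->
           (f : borel X -> R) \in Lfun nu p%:E /\ LpH nu p F) /\
        DH_closable istar nu p,
      forall p : R, 1 < p -> W1p_is_banach istar nu p &
      W12_is_hilbert istar nu].
Proof.
have istarE := rkhs_adjoint H_rkhs.
have [e e_dense] := rkhs_separable H_rkhs sepX.
have nu_fin := weighted_finite mu_gauss U_proper U_lsc U_convex nu_def.
have dense_dir :=
  direction_dense T_semigroup H_rkhs Q_bounded Qt_def Qoo_def mu_gauss mu_cov
    A_gen hQA.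
have closable p : 1 < p -> DH_closable istar nu p.
  move=> p1.
  have p_gt0 : 0 < p := lt_trans ltr01 p1.
  have pV1 : p^-1 < 1 by rewrite invf_lt1.
  (* The exponent conjugate to [p]. The representative [u] of [U] and its gradient [G] are taken in
     [W^{1,q}] and may change with [p]. *)
  pose q := (1 - p^-1)^-1.
  have q1 : 1 <= q.
    by rewrite /q invf_ge1 ?subr_gt0// gerBl invr_ge0 ltW.
  have pq : p^-1 + q^-1 = 1 by rewrite invrK addrC subrK.
  have [u [G uG] Uu] := U_sobolev q q1.
  have mu_u : measurable_fun setT (u : borel X -> R).
    by case: uG => /Lfun_measurable.
  exact: (weighted_closable istarE mu_gauss mu_cov e_dense q1 uG p1 pq
    (weighted_density U_lsc mu_u Uu nu_def) dense_dir).
split=> [p p1|p p1|].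
- by split=> [f F|]; [exact: (DH_Lp (ltW p1) nu_fin)|exact: closable].
- exact: (W1p_banach e_dense (ltW p1) nu_fin (closable p p1)).
- by apply: (W12_hilbert e_dense nu_fin); apply: closable; rewrite ltr1n.
Qed.
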